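(* Let $c\in\mathbb{R}$, $c\ge 2$, and let $h,w\in\mathbb{R}$ satisfy $$h\ge\frac{c-2}{24},\qquad |w|\le\sqrt{\frac{8}{198+45c}}\left(2h-\frac{c-2}{12}\right)^{3/2}.$$ Then the irreducible lowest weight representation $V_{c,h,w}$ of the $\mathcal{W}_3$-algebra with central charge $c$ and lowest weight $(h,w)$ is unitary.
   Context: Let $V$ be a complex vector space. A formal series $\sum_{n\in\mathbb{Z}}A_n z^{-n}$ with $A_n\in\mathrm{End}(V)$ is a field on $V$ if for every $v\in V$ there is $n_v$ with $A_nv=0$ for all $n\ge n_v$. A representation of the $\mathcal{W}_3$-algebra with central charge $c\in\mathbb{C}$, $c\ne-\frac{22}{5}$, on $V$ consists of linear operators $\{L_n,W_n\}_{n\in\mathbb{Z}}$ on $V$ such that $L(z)=\sum_n L_nz^{-n-2}$ and $W(z)=\sum_n W_nz^{-n-3}$ are fields and, for all $m,n\in\mathbb{Z}$, $$[L_m,L_n]=(m-n)L_{m+n}+\tfrac{c}{12}m(m^2-1)\delta_{m+n,0},\qquad [L_m,W_n]=(2m-n)W_{m+n},$$ $$[W_m,W_n]=\tfrac{c}{3\cdot5!}(m^2-4)(m^2-1)m\,\delta_{m+n,0}+b^2(m-n)\Lambda_{m+n}+\tfrac{1}{30}(m-n)(2m^2-mn+2n^2-8)L_{m+n},$$ where $b^2=\frac{16}{22+5c}$ and $\Lambda_n=\sum_{k>-2}L_{n-k}L_k+\sum_{k\le-2}L_kL_{n-k}-\frac{3}{10}(n+2)(n+3)L_n$. A nonzero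 vector $\Omega$ is a lowest weight vector with lowest weight $(h,w)\in\mathbb{C}^2$ if $L_n\Omega=W_n\Omega=0$ for all $n>0$, $L_0\Omega=h\Omega$ and $W_0\Omega=w\Omega$. The representation is a lowest weight representation if it has a cyclic lowest weight vector (the smallest subspace containing $\Omega$ and invariant under all $L_n,W_n$ is $V$). For $c,h,w\in\mathbb{R}$, $c\neq-\frac{22}{5}$, there is an up to isomorphism unique irreducible lowest weight representation with central charge $c$ and lowest weight $(h,w)$, denoted $V_{c,h,w}$. It is called unitary if it admits an invariant inner product, i.e. a positive definite Hermitian form $\langle\cdot,\cdot\rangle$ with $\langle L_{-n}x,y\rangle=\langle x,L_ny\rangle$ and $\langle W_{-n}x,y\rangle=\langle x,W_ny\rangle$ for all $x,y$ and all $n\in\mathbb{Z}$. *)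

(* Defs.v *)
From HB Require Import structures.
From mathcomp Require Import all_boot all_order all_algebra.
From mathcomp Require Import complex.
From mathcomp Require Import all_classical all_reals all_analysis.

Set Implicit Arguments.
Unset Strict Implicit.
Unset Printing Implicit Defensive.

Import Order.TTheory GRing.Theory Num.Theory.
Import ComplexField.

Local Open Scope classical_set_scope.
Local Open Scope complex_scope.
Local Open Scope ring_scope.

Section W3.
Variables (R : realType) (V : lmodType R[i]).
Implicit Types (L W A : int -> {linear V -> V}) (c h w : R[i]) (S : set V).

(* [A n] is the coefficient of z^(-n). *)
Definition is_field A : Prop :=
  forall v : V, exists nv : int, forall n : int, nv <= n -> A n v = 0.

(* When L(z) is a field, for each v only finitely many terms of either sum are
   nonzero, so the finitely supported sums below are the genuine ones. *)
Definition Lambda L (n : int) (v : V) : V :=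
  \sum_(k \in [set k : int | -2 < k]) L (n - k) (L k v)
  + \sum_(k \in [set k : int | k <= -2]) L k (L (n - k) v)
  - (3 / 10 * ((n + 2) * (n + 3))%:~R) *: L n v.

Record W3_representation c L W : Prop := {
  W3_charge : c != - (22 / 5);
  (* L(z) = \sum_n L_n z^(-n-2) and W(z) = \sum_n W_n z^(-n-3) *)
  W3_fieldL : is_field (fun n => L (n - 2));
  W3_fieldW : is_field (fun n => W (n - 3));
  W3_LL : forall (m n : int) (v : V),
    L m (L n v) - L n (L m v) =
      (m - n)%:~R *: L (m + n) v
      + (c / 12 * (m * (m ^+ 2 - 1))%:~R * (m + n == 0)%:R) *: v;
  W3_LW : forall (m n : int) (v : V),
    L m (W n v) - W n (L m v) = (2 * m - n)%:~R *: W (m + n) v;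
  W3_WW : forall (m n : int) (v : V),
    W m (W n v) - W n (W m v) =
      (c / (3 * 5`!%:R) * ((m ^+ 2 - 4) * (m ^+ 2 - 1) * m)%:~R
         * (m + n == 0)%:R) *: v
      + (16 / (22 + 5 * c) * (m - n)%:~R) *: Lambda L (m + n) v
      + (1 / 30 * ((m - n) * (2 * m ^+ 2 - m * n + 2 * n ^+ 2 - 8))%:~R)
          *: L (m + n) v
}.

Definition invariant_subspace L W S : Prop :=
  submod_closed (mem S)
  /\ forall (n : int) (v : V), S v -> S (L n v) /\ S (W n v).

Record lowest_weight_vector h w L W (Omega : V) : Prop := {
  lwv_neq0 : Omega != 0;
  lwv_L : forall n : int, 0 < n -> L n Omega = 0;
  lwv_W : forall n : int, 0 < n -> W n Omega = 0;
  lwv_L0 : L 0 Omega = h *: Omega;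
  lwv_W0 : W 0 Omega = w *: Omega
}.

Definition cyclic_vector L W (Omega : V) : Prop :=
  smallest (invariant_subspace L W) [set Omega] = setT.

Definition lowest_weight_representation c h w L W : Prop :=
  W3_representation c L W /\
  exists Omega : V, lowest_weight_vector h w L W Omega /\ cyclic_vector L W Omega.

Definition irreducible_representation L W : Prop :=
  (exists v : V, v != 0) /\
  forall S, invariant_subspace L W S -> S = [set 0] \/ S = setT.

(* A form of type [{dot V for Num.conj}] is linear in its first argument and
   conjugate-linear in its second one. *)
Definition unitary_representation L W : Prop :=
  exists form : {dot V for Num.conj},
    forall (n : int) (x y : V),
      form (L (- n) x) y = form x (L n y)
      /\ form (W (- n) x) y = form x (W n y).

End W3.

(* Main.v *)
Require Import Defs.
From HB Require Import structures.
From mathcomp Require Import all_boot all_order all_algebra.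
From mathcomp Require Import complex finmap.
From mathcomp Require Import all_classical all_reals all_analysis.
From mathcomp Require Import ring zify lra.

(** The representation is realized on the Fock space of two free bosons. In complex
    form these are two conjugate Heisenberg currents x and y, with
      [x_m, y_n] = m delta_{m+n,0},  [x_m, x_n] = [y_m, y_n] = 0,
      x_n^* = y_{-n},  x_0 = p  and  y_0 = conj(p),
    where p is a complex number. For a real background charge beta, normal ordered
    quadratic and cubic expressions in the currents give fields [freeL] and [freeW]
    (a Miura, or Fateev-Zamolodchikov, realization), and L = freeL, W = (b / 6) freeW
    satisfy the relations with c = 2 + 24 beta^2 and b^2 = 16 / (22 + 5 c). After a shift of the
    zero modes their coefficients are real, so L_n^* = L_{-n} and W_n^* = W_{-n} for the
    positive definite inner product of the Fock space ([Fock_unitary]). The vacuum is a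
    lowest weight vector with
      h = |p|^2 + beta^2,   w = (b / 3) (p^3 + conj(p)^3).
    When c >= 2 there is a real beta with beta^2 = (c - 2) / 24; for a given h, the value
    of |p| is then fixed, p^3 + conj(p)^3 takes all values between - 2 |p|^3 and 2 |p|^3, and
    these are the values of w allowed by the hypothesis ([complex_charge]).

    It remains to pass from the Fock space to the irreducible representation V
    ([unitary_of_lowest_weight]). In the direct sum of V and the Fock space, let G be
    the cyclic subspace generated by the pair of lowest weight vectors. It consists of
    multiples of that pair plus sums of vectors of higher energy. As V is irreducible,
    G meets V in 0; as the form is positive definite, G meets the Fock space in 0. Hence
    G is the graph of an injective intertwiner from V to the Fock space, along which the
    inner product pulls back.

    The commutation relations rest on a form of Schur's lemma: an operator on the Fock
    space that commutes with all the modes of x and y is the scalar given by its vacuum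
    expectation ([schur_eq]). Commuting with a mode lowers the degree of a normal ordered
    expression, so an identity between such expressions follows from identities of lower
    degree and from one vacuum expectation; by homogeneity the latter matters only
    when the indices add up to 0, and it is then the sum of a polynomial over an interval
    of integers ([zsum_telescope]). The relation for [W_m, W_n] ([freeW_freeW]) takes two
    such steps, as its double commutators with modes of x alone, or of y alone, can
    be computed directly. *)

Set Implicit Arguments.
Unset Strict Implicit.
Unset Printing Implicit Defensive.

Import Order.TTheory GRing.Theory Num.Theory.
Import ComplexField.

Local Open Scope classical_set_scope.
Local Open Scope complex_scope.
Local Open Scope ring_scope.

(** * Identities between linear combinations *)

(** Identities between operators are linear combinations of noncommuting words,
    to which [ring] does not apply. They are reflected here into one identity between
    scalar coefficients for each atom. *)
Section Lincomb.
Variables (K : comPzRingType) (V : lmodType K).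

Inductive lexp :=
  LVar of nat | LAdd of lexp & lexp | LOpp of lexp | LScale of K & lexp | LZero.

Fixpoint leval (env : seq V) e : V :=
  match e with
  | LVar i => nth 0 env i
  | LAdd e1 e2 => leval env e1 + leval env e2
  | LOpp e1 => - leval env e1
  | LScale a e1 => a *: leval env e1
  | LZero => 0
  end.

Fixpoint lcoef e (i : nat) : K :=
  match e with
  | LVar j => if eqn i j then 1 else 0
  | LAdd e1 e2 => lcoef e1 i + lcoef e2 i
  | LOpp e1 => - lcoef e1 i
  | LScale a e1 => a * lcoef e1 i
  | LZero => 0
  end.

Lemma leval_coef env e :
  leval env e = \sum_(i < size env) lcoef e i *: nth 0 env i.
Proof.
elim: e => [j|e1 IH1 e2 IH2|e1 IH|a e1 IH|] /=.
- have [lt_j|le_j] := ltnP j (size env).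
    rewrite (bigD1 (Ordinal lt_j)) //= (introT eqnP erefl) scale1r big1 ?addr0 // => i.
    by move=> /eqP ne; case: eqnP => [e|]; rewrite ?scale0r //; case: ne; apply: val_inj.
  rewrite nth_default // big1 // => i _; case: eqnP => [e|]; rewrite ?scale0r //.
  by move: (ltn_ord i); rewrite e ltnNge le_j.
- by rewrite IH1 IH2 -big_split; apply: eq_bigr => i _ /=; rewrite scalerDl.
- by rewrite IH -sumrN; apply: eq_bigr => i _; rewrite scaleNr.
- by rewrite IH scaler_sumr; apply: eq_bigr => i _; rewrite scalerA.
- by rewrite big1 // => i _; rewrite scale0r.
Qed.

Fixpoint lcoef_eq e1 e2 (n : nat) : Prop :=
  if n is n'.+1 then lcoef e1 n' = lcoef e2 n' /\ lcoef_eq e1 e2 n' else True.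

Lemma leval_eq env e1 e2 :
  lcoef_eq e1 e2 (size env) -> leval env e1 = leval env e2.
Proof.
rewrite !leval_coef => H; apply: eq_bigr => -[i /= lt_i] _; congr (_ *: _).
by elim: (size env) lt_i H => [//|n IH]; rewrite ltnS leq_eqVlt
  => /predU1P[->|/IH IH'] [] //.
Qed.
End Lincomb.

Ltac latom_find x l :=
  match l with
  | cons x _ => constr:(0%nat)
  | cons ?y _ => let _ := match goal with _ => unify x y end in constr:(0%nat)
  | cons _ ?t => let n := latom_find x t in constr:(S n)
  end.
Ltac latom_add x l :=
  match l with
  | _ => let n := latom_find x l in l
  | _ => constr:(cons x l)
  end.
Ltac latoms t l :=
  lazymatch t with
  | (?a + ?b)%R => let l := latoms a l in latoms b l
  | (- ?a)%R => latoms a l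
  | (_ *: ?a)%R => latoms a l
  | 0%R => l
  | _ => latom_add t l
  end.
Ltac lquote K t l :=
  lazymatch t with
  | (?a + ?b)%R => let a := lquote K a l in let b := lquote K b l in
                   constr:(@LAdd K a b)
  | (- ?a)%R => let a := lquote K a l in constr:(@LOpp K a)
  | (?c *: ?a)%R => let a := lquote K a l in constr:(@LScale K c a)
  | 0%R => constr:(@LZero K)
  | _ => let n := latom_find t l in constr:(@LVar K n)
  end.
(* The atoms are collected up to syntactic unification, so they have to be brought to
   a common form beforehand. *)
Ltac lincomb K :=
  lazymatch goal with
  | |- @eq (?V) ?s ?t =>
    let l := latoms s (@nil V) in
    let l := latoms t l in
    let e1 := lquote K s l in
    let e2 := lquote K t l in
    apply: (@leval_eq K _ l e1 e2); cbn [size lcoef_eq lcoef eqn Nat.eqb];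
    repeat split
  end.

(** * The algebra of endomorphisms *)

Section EndAlgebra.
Variables (K : numFieldType) (V : lmodType K).

Definition linear_pred : {pred V -> V} := fun f => `[< linear f >].

Record lend := Lend { lend_fun : V -> V; _ : lend_fun \in linear_pred }.
HB.instance Definition _ := [isSub of lend for lend_fun].
HB.instance Definition _ := [Choice of lend by <:].

Lemma linear_pred_submod : submod_closed linear_pred.
Proof.
split; first by apply/asboolP => a u v; rewrite scaler0 addr0.
move=> a f g /asboolP lf /asboolP lg; apply/asboolP => b u v.
rewrite !fctE lf lg !scalerDr !scalerA mulrC.
by rewrite addrACA.
Qed.
HB.instance Definition _ :=
  GRing.isSubmodClosed.Build K (V -> V) linear_pred linear_pred_submod.
HB.instance Definition _ := [SubChoice_isSubLmodule of lend by <:].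

Lemma lend_linear (A : lend) : linear (lend_fun A).
Proof. by case: A => f /= /asboolP. Qed.

HB.instance Definition _ (A : lend) :=
  GRing.isLinear.Build K V V *:%R (lend_fun A) (lend_linear A).

Lemma lendP (A B : lend) : (forall v, lend_fun A v = lend_fun B v) -> A = B.
Proof. by move=> AB; apply/val_inj/funext. Qed.

Fact lend1_key : (fun v : V => v) \in linear_pred.
Proof. by apply/asboolP. Qed.
Definition lend1 := Lend lend1_key.

Fact lend_mul_key (A B : lend) :
  (fun v : V => lend_fun A (lend_fun B v)) \in linear_pred.
Proof. by apply/asboolP => a u v; rewrite !linearP. Qed.
Definition lend_mul A B := Lend (lend_mul_key A B).

Lemma lend_mulA : associative lend_mul.
Proof. by move=> A B C; apply: lendP. Qed.
Lemma lend_mul1 : left_id lend1 lend_mul.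
Proof. by move=> A; apply: lendP. Qed.
Lemma lend_mulr1 : right_id lend1 lend_mul.
Proof. by move=> A; apply: lendP. Qed.
Lemma lend_mulDl : left_distributive lend_mul +%R.
Proof. by move=> A B C; apply: lendP. Qed.
Lemma lend_mulDr : right_distributive lend_mul +%R.
Proof. by move=> A B C; apply: lendP => v /=; rewrite linearD. Qed.

HB.instance Definition _ := GRing.Zmodule_isPzRing.Build lend
  lend_mulA lend_mul1 lend_mulr1 lend_mulDl lend_mulDr.

Lemma lendD (A B : lend) v : lend_fun (A + B) v = lend_fun A v + lend_fun B v.
Proof. by []. Qed.
Lemma lendN (A : lend) v : lend_fun (- A) v = - lend_fun A v.
Proof. by []. Qed.
Lemma lendZ a (A : lend) v : lend_fun (a *: A) v = a *: lend_fun A v.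
Proof. by []. Qed.
Lemma lendM (A B : lend) v : lend_fun (A * B) v = lend_fun A (lend_fun B v).
Proof. by []. Qed.
Lemma lend_id v : lend_fun 1 v = v.
Proof. by []. Qed.
Lemma lend_0 v : lend_fun 0 v = 0.
Proof. by []. Qed.
Definition lendE := (lendD, lendN, lendZ, lendM, lend_id, lend_0).

Lemma lend_scalerAl a (A B : lend) : a *: (A * B) = (a *: A) * B.
Proof. by apply: lendP. Qed.
Lemma lend_scalerAr a (A B : lend) : a *: (A * B) = A * (a *: B).
Proof. by apply: lendP => v; rewrite !lendE linearZ. Qed.

Lemma lend_mulZl a (A B : lend) : (a *: A) * B = a *: (A * B).
Proof. by rewrite lend_scalerAl. Qed.
Lemma lend_mulZr a (A B : lend) : A * (a *: B) = a *: (A * B).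
Proof. by rewrite lend_scalerAr. Qed.
Definition mul_lin := (@mulrDl lend, @mulrDr lend, @mulNr lend, @mulrN lend, @mul1r lend,
  @mulr1 lend, @mul0r lend, @mulr0 lend, lend_mulZl, lend_mulZr).

(** Locked, as are the fields below, so that the rules of bilinearity do not see
    through commutators and fields treated as atoms. *)
Definition comm (A B : lend) : lend := locked (A * B - B * A).
Local Notation "\[ A , B \]" := (comm A B).
Lemma commE A B : \[A, B\] = A * B - B * A.
Proof. by rewrite /comm -lock. Qed.

Lemma commC A B : \[A, B\] = - \[B, A\].
Proof. by rewrite !commE opprB. Qed.
Lemma commDl A B C : \[A + B, C\] = \[A, C\] + \[B, C\].
Proof. by rewrite !commE mulrDl mulrDr opprD addrACA. Qed.
Lemma commDr A B C : \[A, B + C\] = \[A, B\] + \[A, C\].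
Proof. by rewrite !commE mulrDl mulrDr opprD addrACA. Qed.
Lemma commNl A B : \[- A, B\] = - \[A, B\].
Proof. by rewrite !commE mulNr mulrN opprD. Qed.
Lemma commNr A B : \[A, - B\] = - \[A, B\].
Proof. by rewrite !commE mulNr mulrN opprD. Qed.
Lemma commZl a A B : \[a *: A, B\] = a *: \[A, B\].
Proof. by rewrite !commE -lend_scalerAl -lend_scalerAr scalerBr. Qed.
Lemma commZr a A B : \[A, a *: B\] = a *: \[A, B\].
Proof. by rewrite !commE -lend_scalerAl -lend_scalerAr scalerBr. Qed.
Lemma comm1l A : \[1, A\] = 0.
Proof. by rewrite !commE mul1r mulr1 subrr. Qed.
Lemma comm1r A : \[A, 1\] = 0.
Proof. by rewrite !commE mul1r mulr1 subrr. Qed.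
Lemma comm0l A : \[0, A\] = 0.
Proof. by rewrite !commE mul0r mulr0 subrr. Qed.
Lemma comm0r A : \[A, 0\] = 0.
Proof. by rewrite !commE mul0r mulr0 subrr. Qed.
Lemma commMl A B C : \[A * B, C\] = A * \[B, C\] + \[A, C\] * B.
Proof. by rewrite !commE mulrBr mulrBl !mulrA addrA subrK. Qed.
Lemma commMr A B C : \[A, B * C\] = B * \[A, C\] + \[A, B\] * C.
Proof. rewrite !commE !(mulrBl, mulrBr, mulrA); lincomb K; ring. Qed.
Lemma comm_jacobi A B C : \[\[A, B\], C\] = \[A, \[B, C\]\] - \[B, \[A, C\]\].
Proof.
rewrite !commE !(mulrBl, mulrBr, mulrA).
by lincomb K; ring.
Qed.
End EndAlgebra.
Notation "\[ A , B \]" := (comm A B).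

(** * Finitely supported sums over the integers *)

Section IntegerSums.
Variable U : zmodType.
Implicit Types f g : int -> U.

Definition zbound (N : nat) f := forall k : int, (N < `|k|)%N -> f k = 0.
Definition zfin f := exists N, zbound N f.
Definition zsum f : U := \sum_(k \in [set: int]) f k.

Lemma zboundW N N' f : (N <= N')%N -> zbound N f -> zbound N' f.
Proof. by move=> le_N fN k ltk; apply: fN; apply: leq_ltn_trans ltk. Qed.

Lemma zsumE N f : zbound N f ->
  zsum f = \sum_(i < N.*2.+1) f (i%:Z - N%:Z).
Proof.
move=> fN; pose s : seq int := [seq i%:Z - N%:Z | i <- iota 0 N.*2.+1].
have sE (k : int) : (k \in s) = (`|k| <= N)%N.
  apply/mapP/idP => [ki|lek].
    by case: ki => i; rewrite mem_iota => ? ->; lia.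
  by exists (absz (k + N%:Z)); [rewrite mem_iota | ]; lia.
rewrite -(big_mkord xpredT (fun i => f (i%:Z - N%:Z))) /index_iota subn0.
rewrite -(big_map (fun i : nat => i%:Z - N%:Z) xpredT f) -/s.
rewrite /zsum fsbig_supp; apply: (fsbig_fwiden s).
- by move=> k [_] /= /eqP fk; rewrite sE leqNgt; apply: contraNN fk => /fN/eqP.
- by rewrite map_inj_uniq ?iota_uniq // => i j; lia.
- by move=> k [_ nk]; apply: contrapT => fk; apply: nk.
Qed.

Lemma eq_zsum f g : (forall k, f k = g k) -> zsum f = zsum g.
Proof. by move=> fg; apply: eq_fsbigr => k _; apply: fg. Qed.

Lemma zfinD f g : zfin f -> zfin g -> zfin (fun k => f k + g k).
Proof.
move=> [N fN] [M gM]; exists (maxn N M) => k ltk.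
by rewrite fN ?gM ?addr0 //; lia.
Qed.

Lemma zfin1 f (k0 : int) : (forall k : int, k != k0 -> f k = 0) -> zfin f.
Proof. by move=> f0; exists `|k0|%N => k ltk; apply: f0; lia. Qed.

Lemma zsum0 f : (forall k, f k = 0) -> zsum f = 0.
Proof. by move=> f0; apply: fsbig1. Qed.

Lemma zsum1 f (k0 : int) : (forall k : int, k != k0 -> f k = 0) -> zsum f = f k0.
Proof.
move=> f0; rewrite -[RHS](@fsbig_set1 _ 0 +%R int k0 f); apply/esym/fsbig_widen => //.
by move=> k [_] /= /eqP /f0.
Qed.

Lemma zsumD f g : zfin f -> zfin g -> zsum (fun k => f k + g k) = zsum f + zsum g.
Proof.
move=> [N fN] [M gM]; rewrite (@zsumE (maxn N M)); last first.
  by move=> k ltk; rewrite fN ?gM ?addr0 //; lia.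
rewrite (zsumE (zboundW (leq_maxl N M) fN)) (zsumE (zboundW (leq_maxr N M) gM)).
exact: big_split.
Qed.

Lemma zsum_bij (s : int -> int) f : bijective s -> zsum (fun k => f (s k)) = zsum f.
Proof. by move=> s_bij; rewrite /zsum [RHS](reindex_fsbigT s). Qed.

End IntegerSums.

Lemma zsum_morph (U U' : zmodType) (phi : {additive U -> U'}) (f : int -> U) :
  zfin f -> phi (zsum f) = zsum (fun k => phi (f k)).
Proof.
move=> [N fN]; rewrite (zsumE fN) raddf_sum (@zsumE _ N (fun k => phi (f k))) // => k /fN ->.
exact: raddf0.
Qed.

Lemma zfin_morph (U U' : zmodType) (phi : {additive U -> U'}) (f : int -> U) :
  zfin f -> zfin (fun k => phi (f k)).
Proof. by move=> [N fN]; exists N => k /fN ->; apply: raddf0. Qed.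

(** Contractions lead to sums of polynomials over integer intervals whose bounds depend
    on the indices of the modes. Written with a difference of two steps, such a sum
    changes sign when the bounds are exchanged, and a polynomial antiderivative evaluates
    it whatever the order of the bounds is. *)
Section Telescoping.
Variable K : pzRingType.
Implicit Types f T : int -> K.

Definition step (a i : int) : K := (a < i)%R%:R.

Lemma zfin_step f a b : zfin (fun i => f i * (step a i - step b i)).
Proof.
exists (maxn `|a| `|b|) => k ltk; rewrite /step.
suff -> : (a < k)%R = (b < k)%R by rewrite subrr mulr0.
by lia.
Qed.

Lemma zsum_telescope f T a b : (forall i, T i - T (i - 1) = f i) ->
  zsum (fun i => f i * (step a i - step b i)) = T b - T a.
Proof.
move=> Tf.
have up (d : nat) a' : zsum (fun i => f i * (step a' i - step (a' + d%:Z) i)) =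
  T (a' + d%:Z) - T a'.
  elim: d => [|d IH].
    by rewrite addr0 subrr zsum0 // => k; rewrite subrr mulr0.
  have -> : a' + d.+1%:Z = a' + d%:Z + 1 by lia.
  set e := a' + d%:Z in IH *.
  rewrite (eq_zsum (g := fun i => f i * (step a' i - step e i) + f i * (i == e + 1)%:R)).
    rewrite zsumD; [| exact: zfin_step | ].
      rewrite IH (@zsum1 _ _ (e + 1)); last by move=> k /negPf ->; rewrite mulr0.
      by rewrite eqxx mulr1 -Tf addrK addrC addrA subrK.
    by apply: (@zfin1 _ _ (e + 1)) => k /negPf ->; rewrite mulr0.
  move=> k; have -> : step e k = step (e + 1) k + (k == e + 1)%:R.
    rewrite /step; have [->|ne] := eqVneq k (e + 1).
      have -> : (e < e + 1)%R = true by lia.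
      by rewrite ltxx add0r.
    by rewrite addr0; congr (nat_of_bool _)%:R; lia.
  by rewrite -mulrDr opprD addrA subrK ?addrA.
have [le_ab|lt_ba] := lerP a b.
  by have := up `|b - a|%N a; rewrite (_ : a + `|b - a|%N%:Z = b); last lia.
have := up `|a - b|%N b; rewrite (_ : b + `|a - b|%N%:Z = a); last lia.
move=> H; rewrite -[RHS]opprB -H.
rewrite [RHS](zsum_morph (-%R : {additive K -> K})); last exact: zfin_step.
by apply: eq_zsum => k /=; rewrite -mulrN opprB.
Qed.
End Telescoping.

(** * Locally finite sums of operators *)

Section OperatorSums.
Variables (K : numFieldType) (V : lmodType K).
Implicit Types (f g : int -> lend V) (A : lend V).

Definition lfin f := forall v, zfin (fun k => lend_fun (f k) v).

Fact opsum_key f : lfin f ->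
  (fun v => zsum (fun k => lend_fun (f k) v)) \in linear_pred (V := V).
Proof.
move=> ff; apply/asboolP => a u v.
rewrite (zsum_morph ( *:%R a : {additive V -> V})) //= -zsumD //.
- by apply: eq_zsum => k; rewrite linearP.
- exact: (zfin_morph ( *:%R a : {additive V -> V})).
Qed.

(** Total, so that sums can be manipulated before their finiteness is established. *)
Definition opsum f : lend V :=
  if pselect (lfin f) is left ff then Lend (opsum_key ff) else 0.

Lemma opsumE f v : lfin f -> lend_fun (opsum f) v = zsum (fun k => lend_fun (f k) v).
Proof. by move=> ff; rewrite /opsum; case: pselect. Qed.

Lemma eq_opsum f g : (forall k, f k = g k) -> opsum f = opsum g.
Proof. by move=> /funext ->. Qed.

Lemma lfin0 : lfin (fun _ => 0).
Proof. by move=> v; exists 0%N. Qed.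
Lemma lfinD f g : lfin f -> lfin g -> lfin (fun k => f k + g k).
Proof. by move=> ff fg v; apply: (zfinD (ff v) (fg v)). Qed.
Lemma lfinZ (c : K) f : lfin f -> lfin (fun k => c *: f k).
Proof. by move=> ff v; case: (ff v) => N fN; exists N => k /fN; rewrite lendE => ->;
  rewrite scaler0. Qed.
Lemma lfinZk (c : int -> K) f : lfin f -> lfin (fun k => c k *: f k).
Proof. by move=> ff v; case: (ff v) => N fN; exists N => k /fN; rewrite lendE => ->;
  rewrite scaler0. Qed.
Lemma lfinN f : lfin f -> lfin (fun k => - f k).
Proof. by move=> ff v; case: (ff v) => N fN; exists N => k /fN; rewrite lendE => ->;
  rewrite oppr0. Qed.
Lemma lfinMl A f : lfin f -> lfin (fun k => A * f k).
Proof. by move=> ff v; case: (ff v) => N fN; exists N => k /fN; rewrite lendE => ->;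
  rewrite linear0. Qed.
Lemma lfinMr A f : lfin f -> lfin (fun k => f k * A).
Proof. by move=> ff v; exact: ff. Qed.
Lemma eq_lfin f g : (forall k, f k = g k) -> lfin f -> lfin g.
Proof. by move=> /funext ->. Qed.
Lemma lfin_comml A f : lfin f -> lfin (fun k => \[f k, A\]).
Proof.
move=> ff; apply: eq_lfin (lfinD (lfinMr A ff) (lfinN (lfinMl A ff))) => k.
by rewrite commE.
Qed.
Lemma lfin_commr A f : lfin f -> lfin (fun k => \[A, f k\]).
Proof.
move=> ff; apply: eq_lfin (lfinD (lfinMl A ff) (lfinN (lfinMr A ff))) => k.
by rewrite commE.
Qed.
Lemma lfin1 f (k0 : int) : (forall k : int, k != k0 -> f k = 0) -> lfin f.
Proof. by move=> f0 v; apply: (@zfin1 _ _ k0) => k /f0 ->. Qed.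

Lemma opsum0 f : (forall k, f k = 0) -> opsum f = 0.
Proof.
move=> f0; apply: lendP => v; rewrite (eq_opsum f0) opsumE; last exact: lfin0.
exact: zsum0.
Qed.
Lemma opsum1 f (k0 : int) : (forall k : int, k != k0 -> f k = 0) -> opsum f = f k0.
Proof.
move=> f0; apply: lendP => v; rewrite opsumE; last exact: lfin1 f0.
by apply: zsum1 => k /f0 ->.
Qed.
Lemma opsumD f g : lfin f -> lfin g -> opsum (fun k => f k + g k) = opsum f + opsum g.
Proof.
move=> ff fg; apply: lendP => v; rewrite lendE (opsumE v (lfinD ff fg)) !opsumE //.
exact: (zsumD (ff v) (fg v)).
Qed.
Lemma opsumMl A f : lfin f -> A * opsum f = opsum (fun k => A * f k).
Proof.
move=> ff; apply: lendP => v; rewrite lendE !opsumE //; last exact: lfinMl.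
exact: (zsum_morph (lend_fun A : {additive V -> V})).
Qed.
Lemma opsumMr A f : lfin f -> opsum f * A = opsum (fun k => f k * A).
Proof. by move=> ff; apply: lendP => v; rewrite lendE !opsumE //; apply: lfinMr. Qed.
Lemma opsumZ (c : K) f : lfin f -> c *: opsum f = opsum (fun k => c *: f k).
Proof.
move=> ff; apply: lendP => v; rewrite lendE !opsumE //; last exact: lfinZ.
exact: (zsum_morph ( *:%R c : {additive V -> V})).
Qed.
Lemma opsumN f : lfin f -> - opsum f = opsum (fun k => - f k).
Proof.
move=> ff; rewrite -scaleN1r opsumZ //; apply: eq_opsum => k; exact: scaleN1r.
Qed.
Lemma opsumB f g : lfin f -> lfin g -> opsum (fun k => f k - g k) = opsum f - opsum g.
Proof. by move=> ff fg; rewrite opsumD ?opsumN //; apply: lfinN. Qed.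
Lemma comm_opsuml f A : lfin f -> \[opsum f, A\] = opsum (fun k => \[f k, A\]).
Proof.
move=> ff; rewrite commE opsumMr // opsumMl // -opsumB; last exact: lfinMl.
  by apply: eq_opsum => k; rewrite commE.
exact: lfinMr.
Qed.
Lemma comm_opsumr f A : lfin f -> \[A, opsum f\] = opsum (fun k => \[A, f k\]).
Proof.
move=> ff; rewrite commC comm_opsuml // opsumN; last exact: lfin_comml.
by apply: eq_opsum => k; rewrite -commC.
Qed.

Lemma lfin_shift (s : int) f : lfin f -> lfin (fun k => f (k + s)).
Proof. by move=> ff v; case: (ff v) => N fN; exists (N + `|s|)%N => k ltk; apply: fN; lia. Qed.
Lemma lfin_refl (s : int) f : lfin f -> lfin (fun k => f (s - k)).
Proof. by move=> ff v; case: (ff v) => N fN; exists (N + `|s|)%N => k ltk; apply: fN; lia. Qed.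
Lemma opsum_shift (s : int) f : lfin f -> opsum (fun k => f (k + s)) = opsum f.
Proof.
move=> ff; apply: lendP => v; rewrite !opsumE //; last exact: lfin_shift.
apply: (@zsum_bij _ (fun k => k + s) (fun k => lend_fun (f k) v)).
by exists (fun k => k - s) => k; rewrite ?addrK ?subrK.
Qed.
Lemma opsum_refl (s : int) f : lfin f -> opsum (fun k => f (s - k)) = opsum f.
Proof.
move=> ff; apply: lendP => v; rewrite !opsumE //; last exact: lfin_refl.
apply: (@zsum_bij _ (fun k => s - k) (fun k => lend_fun (f k) v)).
by exists (fun k => s - k) => k; lia.
Qed.
End OperatorSums.

(** * Two conjugate Heisenberg currents *)

(** Two real bosons combined into conjugate currents [hx] and [hy]. The zero modes are
    the scalars [hp] and [hq], [hb] is the background charge, and [vac], [vev] are the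
    vacuum and its dual. The computations use [schur] as the only form of irreducibility.
    Keeping the currents abstract makes the symmetry [swap] available. *)
Record heisenberg (K : numFieldType) (V : lmodType K) := Heisenberg {
  hx : int -> lend V;
  hy : int -> lend V;
  hp : K;
  hq : K;
  hb : K;
  vac : V;
  vev : {scalar V};
  hxx : forall m n, \[hx m, hx n\] = 0;
  hyy : forall m n, \[hy m, hy n\] = 0;
  hxy : forall m n, \[hx m, hy n\] = (m%:~R * (m + n == 0)%:R) *: (1 : lend V);
  hx0 : hx 0 = hp *: (1 : lend V);
  hy0 : hy 0 = hq *: (1 : lend V);
  hx_field : forall v, exists N : nat, forall k : int, N%:Z <= k -> lend_fun (hx k) v = 0;
  hy_field : forall v, exists N : nat, forall k : int, N%:Z <= k -> lend_fun (hy k) v = 0;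
  hx_vac : forall n : int, 0 < n -> lend_fun (hx n) vac = 0;
  hy_vac : forall n : int, 0 < n -> lend_fun (hy n) vac = 0;
  vev_hx : forall (n : int) v, n < 0 -> vev (lend_fun (hx n) v) = 0;
  vev_hy : forall (n : int) v, n < 0 -> vev (lend_fun (hy n) v) = 0;
  vev_vac : vev vac = 1;
  schur : forall A : lend V, (forall k, \[A, hx k\] = 0) ->
    (forall k, \[A, hy k\] = 0) -> A = vev (lend_fun A vac) *: (1 : lend V)
}.

Section Heisenberg.
Variables (K : numFieldType) (V : lmodType K).
Implicit Types (h : heisenberg V) (A B : lend V) (a : int -> lend V).

Fact hyx h m n : \[hy h m, hx h n\] = (m%:~R * (m + n == 0)%:R) *: (1 : lend V).
Proof.
rewrite commC hxy -scaleNr addrC; congr (_ *: _).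
have [e|] := eqVneq (m + n) 0; last by rewrite !mulr0 oppr0.
by rewrite !mulr1 -rmorphN /=; congr (_%:~R); lia.
Qed.

Fact swap_schur h A : (forall k, \[A, hy h k\] = 0) ->
  (forall k, \[A, hx h k\] = 0) -> A = vev h (lend_fun A (vac h)) *: (1 : lend V).
Proof. by move=> Ay Ax; apply: schur. Qed.

(** The background charge is carried by the difference of the currents, hence the sign.
    The fields [freeL] and [freeW] are invariant ([freeL_swap], [freeW_swap]), which
    turns each relation with modes of [hx] into one with modes of [hy]. *)
Definition swap h : heisenberg V :=
  Heisenberg (- hb h) (hyy h) (hxx h) (hyx h) (hy0 h) (hx0 h)
    (hy_field h) (hx_field h) (hy_vac h) (hx_vac h) (@vev_hy _ _ h) (@vev_hx _ _ h)
    (vev_vac h) (@swap_schur h).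

Definition efield a := forall v, exists N : nat, forall k : int,
  N%:Z <= k -> lend_fun (a k) v = 0.
Definition commuting a := forall m n, \[a m, a n\] = 0.

Lemma comm_mulC A B : \[A, B\] = 0 -> A * B = B * A.
Proof. by rewrite commE => /eqP; rewrite subr_eq0 => /eqP. Qed.

(** All the modes of one of the two currents commute, so its powers need no normal
    ordering. *)
Definition sq a (n : int) := locked (opsum (fun i => a i * a (n - i))).
Definition cube a (n : int) := locked (opsum (fun i => a i * sq a (n - i))).
Lemma sqE a n : sq a n = opsum (fun i => a i * a (n - i)).
Proof. by rewrite /sq -lock. Qed.
Lemma cubeE a n : cube a n = opsum (fun i => a i * sq a (n - i)).
Proof. by rewrite /cube -lock. Qed.

Section Commuting.
Variable a : int -> lend V.
Hypotheses (af : efield a) (ac : commuting a).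

(** Far from 0 one of the two indices is large; since the modes commute, that one may
    be assumed to act first. *)
Lemma sq_lfin n : lfin (fun i => a i * a (n - i)).
Proof.
move=> v; have [N aN] := af v; exists (N + `|n|)%N => k ltk.
have [k0|k0] := lerP 0 k.
  by rewrite (comm_mulC (ac _ _)) lendE aN ?linear0 //; lia.
by rewrite lendE aN ?linear0 //; lia.
Qed.

Lemma sq_field : efield (sq a).
Proof.
move=> v; have [N aN] := af v; exists N.*2 => k ltk.
rewrite sqE opsumE; last exact: sq_lfin.
apply: zsum0 => i; have [le_i|gt_i] := lerP N%:Z i.
  by rewrite (comm_mulC (ac _ _)) lendE aN ?linear0.
by rewrite lendE aN ?linear0 //; lia.
Qed.

Lemma comm_sq A n : \[sq a n, A\] =
  opsum (fun i => a i * \[a (n - i), A\] + \[a i, A\] * a (n - i)).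
Proof.
rewrite sqE comm_opsuml; last exact: sq_lfin.
by apply: eq_opsum => i; rewrite commMl.
Qed.

Lemma sq_comm n k : \[sq a n, a k\] = 0.
Proof. by rewrite comm_sq opsum0 // => i; rewrite !ac mulr0 mul0r addr0. Qed.

Lemma sq_sq m n : \[sq a m, sq a n\] = 0.
Proof.
by rewrite comm_sq opsum0 // => i; rewrite !(commC (a _)) !sq_comm oppr0 mulr0 mul0r addr0.
Qed.

Lemma cube_lfin n : lfin (fun i => a i * sq a (n - i)).
Proof.
move=> v; have [N aN] := af v; have [M aM] := sq_field v.
exists (N + M + `|n|)%N => k ltk; have [k0|k0] := lerP 0 k.
  have /comm_mulC <- := sq_comm (n - k) k.
  by rewrite lendE aN ?linear0 //; lia.
by rewrite lendE aM ?linear0 //; lia.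
Qed.

Lemma comm_cube A n : \[cube a n, A\] =
  opsum (fun i => a i * \[sq a (n - i), A\] + \[a i, A\] * sq a (n - i)).
Proof.
rewrite cubeE comm_opsuml; last exact: cube_lfin.
by apply: eq_opsum => i; rewrite commMl.
Qed.

Lemma cube_field : efield (cube a).
Proof.
move=> v; have [N aN] := af v; have [M aM] := sq_field v.
exists (N + M)%N => k ltk; rewrite cubeE opsumE; last exact: cube_lfin.
apply: zsum0 => i; have [le_i|gt_i] := lerP N%:Z i.
  by rewrite -(comm_mulC (sq_comm _ _)) lendE aN ?linear0.
by rewrite lendE aM ?linear0 //; lia.
Qed.

Lemma cube_comm n k : \[cube a n, a k\] = 0.
Proof. by rewrite comm_cube opsum0 // => i; rewrite ac sq_comm mulr0 mul0r addr0. Qed.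

End Commuting.

Lemma lfin_dlt (s : int) (g : int -> lend V) :
  lfin (fun i => (i + s == 0)%:R *: g i).
Proof.
apply: (@lfin1 _ _ _ (- s)) => i ne; rewrite (_ : (_ == _) = false) ?scale0r //.
by apply/eqP; lia.
Qed.

Lemma opsum_dlt (s : int) (g : int -> lend V) :
  opsum (fun i => (i + s == 0)%:R *: g i) = g (- s).
Proof.
rewrite (@opsum1 _ _ _ (- s)) ?addNr ?eqxx ?scale1r // => i ne.
by rewrite (_ : (_ == _) = false) ?scale0r //; apply/eqP; lia.
Qed.

Section Contraction.
Variables (a : int -> lend V) (A : lend V).
Hypotheses (af : efield a) (ac : commuting a).
(* [A] is a mode of index [k] of a current conjugate to [a]. *)
Variables (k : int) (c : K).
Hypothesis aA : forall i, \[a i, A\] = (c * (i + k == 0)%:R) *: (1 : lend V).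

(** Wick's rule for a single contraction: commutation with [A] is a derivation whose
    values on the modes of [a] are scalars. *)
Lemma comm_sq_mode n : \[sq a n, A\] = (2 * c) *: a (n + k).
Proof.
rewrite comm_sq // (eq_opsum (g := fun i => (i + (- (n + k)) == 0)%:R *: (c *: a i)
   + (i + k == 0)%:R *: (c *: a (n - i)))).
  by rewrite (opsumD (lfin_dlt _ _) (lfin_dlt _ _)) !opsum_dlt !opprK; lincomb K; ring.
move=> i; rewrite !aA -lend_scalerAl -lend_scalerAr mul1r mulr1 !scalerA ![c * _]mulrC.
by congr (_%:R * _ *: _ + _); congr nat_of_bool; lia.
Qed.

Lemma comm_cube_mode n : \[cube a n, A\] = (3 * c) *: sq a (n + k).
Proof.
rewrite comm_cube // (eq_opsum (g := fun i => (2 * c) *: (a i * a (n + k - i))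
   + (i + k == 0)%:R *: (c *: sq a (n - i)))).
  rewrite (opsumD (lfinZ _ (sq_lfin af ac (n + k))) (lfin_dlt _ _)) opsum_dlt.
  by rewrite -(opsumZ _ (sq_lfin af ac (n + k))) -sqE opprK; lincomb K; ring.
move=> i; rewrite comm_sq_mode aA -lend_scalerAl -lend_scalerAr mul1r scalerA [c * _]mulrC.
by congr (_ *: (_ * a _) + _); lia.
Qed.
End Contraction.
End Heisenberg.

(** * Normal ordered quadratics and the fields L and W *)

(* Identifies the atoms [f i], [f j] for which [i = j] holds by linear arithmetic. *)
Ltac zmerge f :=
  repeat match goal with |- context [f ?i] =>
    match goal with |- context [f ?j] =>
      tryif constr_eq i j then fail else
        (rewrite (_ : f j = f i); [| by congr (f _); lia]) end end.
Ltac zmerge_eq :=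
  repeat match goal with |- context [@eq_op ?T ?i ?z] =>
    match goal with |- context [@eq_op ?T' ?j ?z'] =>
      tryif constr_eq i j then fail else
        (rewrite (_ : @eq_op T' j z' = @eq_op T i z); [| by lia]) end end.

Section FreeField.
Variables (K : numFieldType) (V : lmodType K).
Implicit Types (h : heisenberg V) (A B : lend V).

(** The index of the mode of [hx] alone decides: the two modes fail to commute only when
    the indices are opposite, and then the annihilating one is on the right. *)
Definition nord h (i j : int) : lend V :=
  if i <= 0 then hx h i * hy h j else hy h j * hx h i.

Definition nquad h (f : int -> K) (n : int) :=
  locked (opsum (fun i => f i *: nord h i (n - i))).
Lemma nquadE h f n : nquad h f n = opsum (fun i => f i *: nord h i (n - i)).
Proof. by rewrite /nquad -lock. Qed.

Lemma nord_lfin h n : lfin (fun i => nord h i (n - i)).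
Proof.
move=> v; have [N xN] := hx_field h v; have [M yM] := hy_field h v.
exists (N + M + `|n|)%N => k ltk; rewrite /nord; case: lerP => k0.
  by rewrite lendE yM ?linear0 //; lia.
by rewrite lendE xN ?linear0 //; lia.
Qed.

Lemma nquad_lfin h f n : lfin (fun i => f i *: nord h i (n - i)).
Proof. exact/lfinZk/nord_lfin. Qed.

(** The bound does not depend on the weights [f], which in [freeW] vary with the mode. *)
Lemma nquad_vanish h v : exists N : nat, forall (f : int -> K) (k : int),
  N%:Z <= k -> lend_fun (nquad h f k) v = 0.
Proof.
have [N xN] := hx_field h v; have [M yM] := hy_field h v.
exists (N + M)%N => f k ltk; rewrite !nquadE opsumE; last exact: nquad_lfin.
apply: zsum0 => i; rewrite lendE /nord; case: lerP => i0.
  by rewrite lendE yM ?linear0 ?scaler0 //; lia.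
have [le_i|gt_i] := lerP N%:Z i; first by rewrite lendE xN ?linear0 ?scaler0.
have e : i + (k - i) != 0 by apply/eqP; lia.
have /comm_mulC <- : \[hx h i, hy h (k - i)\] = 0.
  by rewrite hxy (negPf e) mulr0 scale0r.
by rewrite lendE yM ?linear0 ?scaler0 //; lia.
Qed.

Lemma nquad_field h f : efield (nquad h f).
Proof. by move=> v; have [N nquadN] := nquad_vanish h v; exists N; apply: nquadN. Qed.

Lemma nord_swap h i j : nord (swap h) j i = nord h i j.
Proof.
rewrite /nord /=; case: (lerP i 0) => i0; case: (lerP j 0) => j0 //.
  have [e|ne] := eqVneq (i + j) 0.
    have [-> ->] : i = 0 /\ j = 0 by lia.
    by rewrite hx0 hy0 -!lend_scalerAl !mul1r !scalerA mulrC.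
  by apply/esym/comm_mulC; rewrite hxy (negPf ne) mulr0 scale0r.
have ne : i + j != 0 by apply/eqP; lia.
by apply/comm_mulC; rewrite hxy (negPf ne) mulr0 scale0r.
Qed.

Lemma nquad_swap h f n : nquad (swap h) f n = nquad h (fun i => f (n - i)) n.
Proof.
rewrite !nquadE -(opsum_refl n (nquad_lfin (swap h) f n)); apply: eq_opsum => i.
by rewrite nord_swap; congr (_ *: nord _ _ _); lia.
Qed.

Lemma eq_nquad h f g n : (forall i, f i = g i) -> nquad h f n = nquad h g n.
Proof. by move=> /funext ->. Qed.

Lemma nquadN h f n : nquad h (fun i => - f i) n = - nquad h f n.
Proof.
rewrite !nquadE opsumN; last exact: nquad_lfin.
by apply: eq_opsum => i; rewrite scaleNr.
Qed.

Lemma nord_x h i j k : \[nord h i j, hx h k\] = ((j + k == 0)%:R * (- k)%:~R) *: hx h i.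
Proof.
rewrite /nord; case: ifP => _; rewrite commMl hxx hyx ?mul0r ?mulr0 ?addr0 ?add0r.
  rewrite -lend_scalerAr mulr1 mulrC; congr (_ *: _).
  by case: eqVneq => e; rewrite ?mul0r // !mul1r; congr (_%:~R); lia.
rewrite -lend_scalerAl mul1r mulrC; congr (_ *: _).
by case: eqVneq => e; rewrite ?mul0r // !mul1r; congr (_%:~R); lia.
Qed.

Lemma nquad_x h f n k : \[nquad h f n, hx h k\] = (- (k%:~R * f (n + k))) *: hx h (n + k).
Proof.
rewrite !nquadE comm_opsuml; last exact: nquad_lfin.
rewrite (eq_opsum (g := fun i => (i + (- (n + k)) == 0)%:R *: ((- (k%:~R * f i)) *: hx h i))).
  by rewrite opsum_dlt opprK.
move=> i; rewrite commZl nord_x !scalerA.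
rewrite (_ : (n - i + k == 0) = (i - (n + k) == 0)); last by lia.
by congr (_ *: _); ring.
Qed.

Lemma nquad_y h f n k : \[nquad h f n, hy h k\] = (- (k%:~R * f (- k))) *: hy h (n + k).
Proof.
have -> : nquad h f n = nquad (swap h) (fun i => f (n - i)) n.
  by rewrite nquad_swap; apply: eq_nquad => i; congr f; lia.
by rewrite (nquad_x (swap h)) /=; congr ((- (_ * f _)) *: _); lia.
Qed.

Lemma sqx_y h n k : \[sq (hx h) n, hy h k\] = (- (2 * k%:~R)) *: hx h (n + k).
Proof.
rewrite (@comm_sq_mode _ _ _ _ (hx_field h) (hxx h) k (- k%:~R)); first by congr (_ *: _); ring.
by move=> i; rewrite hxy; congr (_ *: _); case: eqVneq => e; rewrite ?mulr0 // !mulr1 -rmorphN;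
  congr (_%:~R); lia.
Qed.

Lemma cubex_y h n k : \[cube (hx h) n, hy h k\] = (- (3 * k%:~R)) *: sq (hx h) (n + k).
Proof.
rewrite (@comm_cube_mode _ _ _ _ (hx_field h) (hxx h) k (- k%:~R)); first by congr (_ *: _); ring.
by move=> i; rewrite hxy; congr (_ *: _); case: eqVneq => e; rewrite ?mulr0 // !mulr1 -rmorphN;
  congr (_%:~R); lia.
Qed.

Lemma sqy_x h n k : \[sq (hy h) n, hx h k\] = (- (2 * k%:~R)) *: hy h (n + k).
Proof. exact: (sqx_y (swap h)). Qed.
Lemma cubey_x h n k : \[cube (hy h) n, hx h k\] = (- (3 * k%:~R)) *: sq (hy h) (n + k).
Proof. exact: (cubex_y (swap h)). Qed.
Lemma sqx_x h n k : \[sq (hx h) n, hx h k\] = 0.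
Proof. exact: sq_comm (hx_field h) (hxx h) _ _. Qed.
Lemma sqy_y h n k : \[sq (hy h) n, hy h k\] = 0.
Proof. exact: sq_comm (hy_field h) (hyy h) _ _. Qed.
Lemma cubex_x h n k : \[cube (hx h) n, hx h k\] = 0.
Proof. exact: cube_comm (hx_field h) (hxx h) _ _. Qed.

(** With these weights [nquad] has the modes of the quadratic field :x y' - x' y:, of
    conformal weight 3. *)
Definition asymf (n i : int) : K := (2 * i - n)%:~R.

(** The energy-momentum field of the two currents with a background charge. A shift of
    the zero modes by the charge replaces the customary factor n + 1 of the linear term
    by n, and produces the constant: this makes all coefficients real and hermiticity
    manifest. *)
Definition freeL h (n : int) : lend V := locked (
  nquad h (fun=> 1) n + (hb h * n%:~R) *: (hx h n - hy h n)
  + (hb h ^+ 2 * (n == 0)%:R) *: (1 : lend V)).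
Lemma freeLE h n : freeL h n = nquad h (fun=> 1) n + (hb h * n%:~R) *: (hx h n - hy h n)
  + (hb h ^+ 2 * (n == 0)%:R) *: (1 : lend V).
Proof. by rewrite /freeL -lock. Qed.

(** A multiple of the weight 3 current of the Miura transformation, in terms of the same
    shifted zero modes. *)
Definition freeW h (n : int) : lend V := locked (
  2 *: (cube (hx h) n + cube (hy h) n)
  - (3 * hb h * n%:~R) *: (sq (hx h) n - sq (hy h) n)
  + (3 * hb h) *: nquad h (asymf n) n
  + (3 * hb h ^+ 2 * n%:~R ^+ 2) *: (hx h n + hy h n)).
Lemma freeWE h n : freeW h n = 2 *: (cube (hx h) n + cube (hy h) n)
  - (3 * hb h * n%:~R) *: (sq (hx h) n - sq (hy h) n)
  + (3 * hb h) *: nquad h (asymf n) n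
  + (3 * hb h ^+ 2 * n%:~R ^+ 2) *: (hx h n + hy h n).
Proof. by rewrite /freeW -lock. Qed.

Definition comm_lin := (commDl, commDr, commNl, commNr, commZl, commZr, comm1l, comm1r,
  comm0l, comm0r).

Lemma freeL_swap h n : freeL (swap h) n = freeL h n.
Proof. by rewrite !freeLE nquad_swap /=; lincomb K; ring. Qed.

Lemma freeW_swap h n : freeW (swap h) n = freeW h n.
Proof.
rewrite !freeWE nquad_swap /=.
have -> : nquad h (fun i => asymf n (n - i)) n = - nquad h (asymf n) n; last by lincomb K; ring.
by rewrite -nquadN; apply: eq_nquad => i; rewrite /asymf -rmorphN; congr (_%:~R); lia.
Qed.

Lemma freeL_x h n k : \[freeL h n, hx h k\] =
  (- k%:~R) *: hx h (n + k) - (hb h * k%:~R ^+ 2 * (n + k == 0)%:R) *: (1 : lend V).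
Proof.
rewrite !freeLE !comm_lin nquad_x hxx hyx.
lincomb K; try ring.
by case: eqVneq => e /=; [have -> : k = - n by lia|]; ring.
Qed.

Lemma freeL_y h n k : \[freeL h n, hy h k\] =
  (- k%:~R) *: hy h (n + k) + (hb h * k%:~R ^+ 2 * (n + k == 0)%:R) *: (1 : lend V).
Proof. by rewrite -freeL_swap (freeL_x (swap h)) /=; lincomb K; ring. Qed.

Lemma freeW_x h n k : \[freeW h n, hx h k\] =
  (- (6 * k%:~R)) *: sq (hy h) (n + k) - (6 * hb h * n%:~R * k%:~R) *: hy h (n + k)
  - (3 * hb h * k%:~R * (n + 2 * k)%:~R) *: hx h (n + k)
  - (3 * hb h ^+ 2 * k%:~R ^+ 3 * (n + k == 0)%:R) *: (1 : lend V).
Proof.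
rewrite !freeWE !comm_lin nquad_x hxx hyx sqx_x sqy_x cubex_x cubey_x /asymf.
lincomb K; try ring.
by case: eqVneq => e /=; [have -> : k = - n by lia|]; ring.
Qed.

Lemma freeW_y h n k : \[freeW h n, hy h k\] =
  (- (6 * k%:~R)) *: sq (hx h) (n + k) + (6 * hb h * n%:~R * k%:~R) *: hx h (n + k)
  + (3 * hb h * k%:~R * (n + 2 * k)%:~R) *: hy h (n + k)
  - (3 * hb h ^+ 2 * k%:~R ^+ 3 * (n + k == 0)%:R) *: (1 : lend V).
Proof. by rewrite -freeW_swap (freeW_x (swap h)) /=; lincomb K; ring. Qed.

End FreeField.

(** * Vacuum expectations and grading *)

(* Evaluates the integer comparisons that are decided by the context. *)
Ltac zdecide :=
  rewrite ?/step; repeat match goal with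
  | |- context [@Order.lt ?d ?T ?a ?b] =>
    first [rewrite (_ : @Order.lt d T a b = true); [|by lia]
          |rewrite (_ : @Order.lt d T a b = false); [|by lia]]
  | |- context [@eq_op ?T ?a ?b] =>
    first [rewrite (_ : @eq_op T a b = true); [|by lia]
          |rewrite (_ : @eq_op T a b = false); [|by lia]]
  end; rewrite /=.

Section Vev.
Variables (K : numFieldType) (V : lmodType K).
Implicit Types (h : heisenberg V) (A B : lend V).

Definition ev h A := vev h (lend_fun A (vac h)).

Lemma evD h A B : ev h (A + B) = ev h A + ev h B.
Proof. by rewrite /ev lendE linearD. Qed.
Lemma evN h A : ev h (- A) = - ev h A.
Proof. by rewrite /ev lendE linearN. Qed.
Lemma evZ h c A : ev h (c *: A) = c * ev h A.
Proof. by rewrite /ev lendE linearZ. Qed.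
Lemma ev1 h : ev h 1 = 1.
Proof. by rewrite /ev lendE vev_vac. Qed.
Lemma ev0 h : ev h 0 = 0.
Proof. by rewrite /ev lendE linear0. Qed.
Definition evE := (evD, evN, evZ, ev1, ev0).

Lemma ev_opsum h f : lfin f -> ev h (opsum f) = zsum (fun i => ev h (f i)).
Proof. by move=> ff; rewrite /ev opsumE // zsum_morph. Qed.

Lemma ev_Mx h A n : 0 < n -> ev h (A * hx h n) = 0.
Proof. by move=> n0; rewrite /ev lendE hx_vac ?linear0. Qed.
Lemma ev_xM h A n : n < 0 -> ev h (hx h n * A) = 0.
Proof. by move=> n0; rewrite /ev lendE vev_hx. Qed.
Lemma ev_Mx0 h A : ev h (A * hx h 0) = hp h * ev h A.
Proof. by rewrite hx0 -lend_scalerAr mulr1 evZ. Qed.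
Lemma ev_x0M h A : ev h (hx h 0 * A) = hp h * ev h A.
Proof. by rewrite hx0 -lend_scalerAl mul1r evZ. Qed.
(* An annihilating mode is moved to the right at the price of its commutator. *)
Lemma ev_xcomm h A n : 0 < n -> ev h (hx h n * A) = ev h \[hx h n, A\].
Proof. by move=> n0; rewrite commE evD evN ev_Mx // oppr0 addr0. Qed.
Lemma ev_commx h A n : n < 0 -> ev h (A * hx h n) = ev h \[A, hx h n\].
Proof. by move=> n0; rewrite commE evD evN ev_xM // oppr0 addr0. Qed.

Lemma ev_My h A n : 0 < n -> ev h (A * hy h n) = 0.
Proof. exact: (ev_Mx (swap h)). Qed.
Lemma ev_yM h A n : n < 0 -> ev h (hy h n * A) = 0.
Proof. exact: (ev_xM (swap h)). Qed.
Lemma ev_My0 h A : ev h (A * hy h 0) = hq h * ev h A.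
Proof. exact: (ev_Mx0 (swap h)). Qed.
Lemma ev_y0M h A : ev h (hy h 0 * A) = hq h * ev h A.
Proof. exact: (ev_x0M (swap h)). Qed.
Lemma ev_ycomm h A n : 0 < n -> ev h (hy h n * A) = ev h \[hy h n, A\].
Proof. exact: (ev_xcomm (swap h)). Qed.

Lemma ev_x h n : ev h (hx h n) = (n == 0)%:R * hp h.
Proof.
have [->|n0] := eqVneq n 0; first by rewrite hx0 evZ ev1 mulr1 mul1r.
have [gt0|lt0] : 0 < n \/ n < 0 by lia.
  by rewrite -[hx h n]mul1r ev_Mx // mul0r.
by rewrite -[hx h n]mulr1 ev_xM // mul0r.
Qed.
Lemma ev_y h n : ev h (hy h n) = (n == 0)%:R * hq h.
Proof. exact: (ev_x (swap h)). Qed.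

Lemma ev_xy h (i j : int) : i + j = 0 ->
  ev h (hx h i * hy h j) = i%:~R * step K 0 i + (i == 0)%:R * (hp h * hq h).
Proof.
move=> ij; have [i0|] := eqVneq i 0.
  rewrite i0 in ij *; rewrite ev_x0M ev_y; zdecide; ring.
move=> i0; have [gt0|lt0] : 0 < i \/ i < 0 by lia.
  by rewrite ev_xcomm // hxy evZ ev1; zdecide; ring.
by rewrite ev_xM //; zdecide; ring.
Qed.
Lemma ev_yx h (i j : int) : i + j = 0 ->
  ev h (hy h i * hx h j) = i%:~R * step K 0 i + (i == 0)%:R * (hp h * hq h).
Proof. by move=> ij; rewrite [hp h * _]mulrC; apply: (ev_xy (swap h)). Qed.

Lemma ev_xx h (i j : int) : i + j = 0 -> ev h (hx h i * hx h j) = (i == 0)%:R * hp h ^+ 2.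
Proof.
move=> ij; have [i0|] := eqVneq i 0.
  rewrite i0 in ij *; rewrite ev_x0M ev_x; zdecide; ring.
move=> i0; have [gt0|lt0] : 0 < i \/ i < 0 by lia.
  by rewrite ev_xcomm // hxx ev0 mul0r.
by rewrite ev_xM // mul0r.
Qed.

(** The method for all the relations below: commuting with a mode lowers the degree, so
    an identity follows from simpler ones and from the value of one expectation. *)
Lemma schur_eq h A B : (forall k, \[A, hx h k\] = \[B, hx h k\]) ->
  (forall k, \[A, hy h k\] = \[B, hy h k\]) -> ev h A = ev h B -> A = B.
Proof.
move=> Ax Ay eAB; apply/subr0_eq.
rewrite (@schur _ _ h (A - B)).
- by rewrite -/(ev h (A - B)) evD evN eAB subrr scale0r.
- by move=> k; rewrite commDl commNl Ax subrr.
- by move=> k; rewrite commDl commNl Ay subrr.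
Qed.

Definition energy h := nquad h (fun=> 1) 0.

Lemma energy_vac h : lend_fun (energy h) (vac h) = (hp h * hq h) *: vac h.
Proof.
rewrite /energy nquadE opsumE; last exact: nquad_lfin.
rewrite (@zsum1 _ _ 0) => [|i i0].
  by rewrite sub0r oppr0 scale1r /nord lexx hx0 hy0 !lendE scalerA.
rewrite scale1r /nord; case: lerP => le0; rewrite lendE.
  by rewrite hy_vac ?linear0 //; lia.
by rewrite hx_vac ?linear0.
Qed.

Lemma vev_energy h v : vev h (lend_fun (energy h) v) = hp h * hq h * vev h v.
Proof.
rewrite /energy nquadE opsumE; last exact: nquad_lfin.
transitivity (zsum (fun i => vev h (lend_fun (1 *: nord h i (0 - i)) v))).
  exact: (zsum_morph (vev h) (nquad_lfin h (fun=> 1) 0 v)).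
rewrite (@zsum1 _ _ 0) => [|i i0].
  by rewrite sub0r oppr0 scale1r /nord lexx hx0 hy0 !lendE scalerA linearZ.
rewrite scale1r /nord; case: lerP => le0; rewrite lendE.
  by rewrite vev_hx //; lia.
by rewrite vev_hy //; lia.
Qed.

Definition homog h (d : int) A := \[energy h, A\] = (- d%:~R) *: A.

(** The degree operator [energy] takes the same value on the vacuum and on its dual, so
    the expectation of its commutator with any operator vanishes. *)
Lemma ev_homog h d A : homog h d A -> d != 0 -> ev h A = 0.
Proof.
move=> /(congr1 (ev h)); rewrite evZ commE evD evN.
rewrite {1 2}/ev !lendE energy_vac vev_energy linearZ linearZ /= subrr => /esym/eqP.
by rewrite mulf_eq0 oppr_eq0 intr_eq0 => /orP[->|/eqP].
Qed.

Lemma homog_x h k : homog h k (hx h k).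
Proof. by rewrite /homog nquad_x mulr1 add0r. Qed.
Lemma homog_y h k : homog h k (hy h k).
Proof. by rewrite /homog nquad_y mulr1 add0r. Qed.
Lemma homog_1 h : homog h 0 1.
Proof. by rewrite /homog comm1r oppr0 scale0r. Qed.
Lemma homog_D h d A B : homog h d A -> homog h d B -> homog h d (A + B).
Proof. by rewrite /homog commDr scalerDr => -> ->. Qed.
Lemma homog_Z h d c A : homog h d A -> homog h d (c *: A).
Proof. by rewrite /homog commZr => ->; rewrite !scalerA mulrC. Qed.
Lemma homog_N h d A : homog h d A -> homog h d (- A).
Proof. by rewrite /homog commNr => ->; rewrite scalerN. Qed.
Lemma homog_M h d e f A B : homog h d A -> homog h e B -> d + e = f -> homog h f (A * B).
Proof.
rewrite /homog commMr => -> -> <-; rewrite -lend_scalerAl -lend_scalerAr.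
by lincomb K; ring.
Qed.
Lemma homog_comm h d e f A B : homog h d A -> homog h e B -> d + e = f -> homog h f \[A, B\].
Proof.
move=> hA hB ef; rewrite commE; apply: homog_D; first exact: homog_M ef.
by apply: homog_N; apply: (homog_M hB hA); rewrite addrC.
Qed.
Lemma homog_opsum h d f : lfin f -> (forall i, homog h d (f i)) -> homog h d (opsum f).
Proof.
move=> ff hf; rewrite /homog comm_opsumr // opsumZ //.
by apply: eq_opsum.
Qed.
Lemma homog_dlt h d : homog h d ((d == 0)%:R *: (1 : lend V)).
Proof.
have [->|_] := eqVneq d 0; first exact/homog_Z/homog_1.
by rewrite scale0r /homog comm0r scaler0.
Qed.

Lemma homog_sqx h n : homog h n (sq (hx h) n).
Proof.
rewrite sqE; apply: homog_opsum => [|i]; first exact: sq_lfin (hx_field h) (hxx h) n.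
by apply: homog_M (homog_x _ _) (homog_x _ _) _; lia.
Qed.
Lemma homog_cubex h n : homog h n (cube (hx h) n).
Proof.
rewrite cubeE; apply: homog_opsum => [|i]; first exact: cube_lfin (hx_field h) (hxx h) n.
by apply: homog_M (homog_x _ _) (homog_sqx _ _) _; lia.
Qed.
Lemma energy_swap h : energy (swap h) = energy h.
Proof. exact: nquad_swap. Qed.
Lemma homog_sqy h n : homog h n (sq (hy h) n).
Proof. by have := homog_sqx (swap h) n; rewrite /homog energy_swap. Qed.
Lemma homog_cubey h n : homog h n (cube (hy h) n).
Proof. by have := homog_cubex (swap h) n; rewrite /homog energy_swap. Qed.
Lemma homog_nquad h f n : homog h n (nquad h f n).
Proof.
rewrite nquadE; apply: homog_opsum => [|i]; first exact: nquad_lfin.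
apply: homog_Z; rewrite /nord; case: ifP => _.
  by apply: homog_M (homog_x _ _) (homog_y _ _) _; lia.
by apply: homog_M (homog_y _ _) (homog_x _ _) _; lia.
Qed.
Lemma homog_freeL h n : homog h n (freeL h n).
Proof.
rewrite freeLE; apply: homog_D; first apply: homog_D (homog_nquad _ _ _) _.
  by apply: homog_Z; apply: homog_D (homog_x _ _) (homog_N (homog_y _ _)).
by rewrite -scalerA; apply/homog_Z/homog_dlt.
Qed.
Lemma homog_freeW h n : homog h n (freeW h n).
Proof.
rewrite freeWE; apply: homog_D; last first.
  by apply: homog_Z; apply: homog_D (homog_x _ _) (homog_y _ _).
apply: homog_D; last exact/homog_Z/homog_nquad.
apply: homog_D.
  by apply: homog_Z; apply: homog_D (homog_cubex _ _) (homog_cubey _ _).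
apply/homog_N/homog_Z; apply: homog_D (homog_sqx _ _) (homog_N (homog_sqy _ _)).
Qed.

Lemma ev_nord h (i j : int) : i + j = 0 -> ev h (nord h i j) = (i == 0)%:R * (hp h * hq h).
Proof.
move=> ij; rewrite /nord; case: lerP => i0.
  by rewrite ev_xy //; zdecide; ring.
by rewrite ev_yx; [zdecide; ring | lia].
Qed.

Lemma ev_nquad h f : ev h (nquad h f 0) = f 0 * (hp h * hq h).
Proof.
rewrite nquadE ev_opsum; last exact: nquad_lfin.
rewrite (@zsum1 _ _ 0) => [|i i0]; first by rewrite evZ ev_nord // eqxx mul1r.
by rewrite evZ ev_nord ?subrK //; [zdecide; ring | lia].
Qed.

(** The sum comes from the double contractions; the last summand collects the single
    contractions, which leave a product of zero modes. *)
Lemma ev_nquad2 h f g m :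
  ev h \[nquad h f m, nquad h g (- m)\] =
    zsum (fun i => (g i * f (m + i) * (i * (m + i))%:~R) * (step K 0 i - step K (- m) i))
    + hp h * hq h * m%:~R * (g (- m) * f 0 + g 0 * f m).
Proof.
rewrite (nquadE h g) comm_opsumr; last exact: nquad_lfin.
rewrite ev_opsum; last exact/lfin_commr/nquad_lfin.
pose u i := hp h * hq h * m%:~R * ((i + m == 0)%:R * (g i * f (m + i))).
pose u' i := hp h * hq h * m%:~R * ((i == 0)%:R * (g i * f (m + i))).
have u0 i : i != - m -> u i = 0 by move=> ne; rewrite /u; zdecide; ring.
have u'0 i : i != 0 -> u' i = 0 by move=> ne; rewrite /u'; zdecide; ring.
rewrite (eq_zsum (g := fun i => (g i * f (m + i) * (i * (m + i))%:~R) *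
  (step K 0 i - step K (- m) i) + (u i + u' i))).
  rewrite zsumD; [|exact: zfin_step | exact: zfinD (zfin1 u0) (zfin1 u'0)].
  rewrite (zsumD (zfin1 u0) (zfin1 u'0)) (zsum1 u0) (zsum1 u'0) /u /u'.
  by rewrite addNr addrN addr0 eqxx /=; ring.
move=> i; rewrite commZr evZ /nord /u /u'.
case: ifP => i0; rewrite commMr evD nquad_x nquad_y -!lend_scalerAl -!lend_scalerAr !evZ.
- rewrite !ev_xy; [|lia..].
  rewrite (_ : - (- m - i) = m + i); last by lia.
  move: (f (m + i)) (g i) => fi gi.
  have [e|ne] := eqVneq (m + i) 0; have [e'|ne'] := eqVneq i 0;
    have [l|l] := ltP 0 (m + i); zdecide; try (exfalso; lia); try ring;
    first [(have -> : i = 0 by lia); (have -> : m = 0 by lia); ring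
          | (have -> : i = - m by lia); ring | (have -> : i = 0 by lia); ring].
- rewrite !ev_yx; [|lia..].
  rewrite (_ : - (- m - i) = m + i); last by lia.
  move: (f (m + i)) (g i) => fi gi.
  have [e|ne] := eqVneq (m + i) 0; have [l|l] := ltP 0 (m + i);
    zdecide; try (exfalso; lia); try ring;
    (have -> : i = - m by lia); ring.
Qed.
End Vev.

(** * The Virasoro relations and the primarity of W *)

Section Virasoro.
Variables (K : numFieldType) (V : lmodType K).
Implicit Types (h : heisenberg V) (A B : lend V).

Ltac zclose k m n := try ring; (have [e|e] := eqVneq (m + n + k) 0; zdecide; try ring;
  (have -> : k = - (m + n) by lia); ring).

Ltac zclose2 i m :=
  (have [e|e] := eqVneq (i + m) 0); (have [e'|e'] := eqVneq i 0); zdecide; try ring;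
  first [(have -> : i = 0 by lia); (have -> : m = 0 by lia); ring
        |(have -> : i = - m by lia); ring
        |(have -> : i = 0 by lia); ring].

(** In the central charge, 2 comes from the double contractions of the two bosons and
    [24 * hb h ^+ 2] from the commutators of the linear terms. *)
Lemma freeL_freeL h m n : \[freeL h m, freeL h n\] = (m - n)%:~R *: freeL h (m + n)
  + ((2 + 24 * hb h ^+ 2) / 12 * (m * (m ^+ 2 - 1))%:~R * (m + n == 0)%:R) *: (1 : lend V).
Proof.
apply: (schur_eq (h := h)) => [k|k|].
- rewrite comm_jacobi !(freeL_x, comm_lin).
  zmerge (hx h); zmerge_eq; lincomb K; zclose k m n.
- rewrite comm_jacobi !(freeL_y, comm_lin).
  zmerge (hy h); zmerge_eq; lincomb K; zclose k m n.
have [mn|mn] := eqVneq (m + n) 0; last first.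
  rewrite mulr0 scale0r addr0 evZ (ev_homog (homog_freeL h (m + n))) // mulr0.
  exact: ev_homog (homog_comm (homog_freeL h m) (homog_freeL h n) erefl) mn.
have {mn}-> : n = - m by lia.
rewrite addrN !freeLE !comm_lin hxx hyy hxy hyx !(nquad_x, nquad_y) !evE.
rewrite (commC (hx h m)) (commC (hy h m)) !nquad_x !nquad_y !evE !ev_x !ev_y ev_nquad2.
rewrite (eq_zsum (g := fun i => (i * (m + i))%:~R * (step K 0 i - step K (- m) i))); last first.
  by move=> i; ring.
rewrite (@zsum_telescope _ _ (fun i =>
  (i * (i + 1) * (2 * i + 1))%:~R / 6 + (m * i * (i + 1))%:~R / 2)); last first.
  by move=> i; field.
by zdecide; rewrite ev_nquad; field.
Qed.

Lemma ev_freeL h n : ev h (freeL h n) = (n == 0)%:R * (hp h * hq h + hb h ^+ 2).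
Proof.
have [->|n0] := eqVneq n 0; last by rewrite (ev_homog (homog_freeL h n)) // mul0r.
by rewrite freeLE !evE ev_nquad ev_x ev_y; zdecide; ring.
Qed.

Lemma ev_MfreeL h A n : 0 < n -> ev h (A * freeL h n) = 0.
Proof.
move=> n0; rewrite /ev lendE; suff -> : lend_fun (freeL h n) (vac h) = 0 by rewrite !linear0.
rewrite freeLE !lendE hx_vac // hy_vac // (_ : (n == 0) = false); last by lia.
rewrite mulr0 scale0r subrr scaler0 !addr0 nquadE opsumE; last exact: nquad_lfin.
apply: zsum0 => i; rewrite lendE /nord; case: lerP => i0; rewrite lendE.
  by rewrite hy_vac ?linear0 ?scaler0 //; lia.
by rewrite hx_vac ?linear0 ?scaler0.
Qed.

Lemma ev_freeLM h A n : n < 0 -> ev h (freeL h n * A) = 0.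
Proof.
move=> n0; rewrite freeLE !mulrDl -!lend_scalerAl !mulrDl !evE ev_xM //.
rewrite mulNr evN (ev_yM h A n0) (_ : (n == 0) = false); last by lia.
rewrite mulr0 mul0r subrr mulr0 !addr0 nquadE opsumMr; last exact: nquad_lfin.
rewrite ev_opsum; last exact/lfinMr/nquad_lfin.
apply: zsum0 => i; rewrite -lend_scalerAl evZ /nord; case: lerP => i0; rewrite -mulrA; last first.
  by rewrite ev_yM ?mulr0 //; lia.
have [->|ne] := eqVneq i 0; last by rewrite ev_xM ?mulr0 //; lia.
by rewrite ev_x0M ev_yM ?mulr0 //; lia.
Qed.

Lemma ev_MfreeL0 h A : ev h (A * freeL h 0) = (hp h * hq h + hb h ^+ 2) * ev h A.
Proof.
rewrite freeLE mulr0z mulr0 scale0r addr0 mulr1 mulrDr -!lend_scalerAr mulr1 evD evZ.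
by rewrite {1}/ev lendE energy_vac !linearZ /= -mulrDl.
Qed.

Lemma freeL_field h : efield (freeL h).
Proof.
move=> v; have [N xN] := hx_field h v; have [M yM] := hy_field h v.
have [P QP] := nquad_field h (fun=> 1) v; exists (N + M + P).+1 => k ltk.
rewrite freeLE !lendE QP ?xN ?yM; [|lia..].
by rewrite (_ : (k == 0) = false) ?mulr0 ?scale0r ?subrr ?scaler0 ?addr0 //; lia.
Qed.

Lemma comm_sq_x h A n : \[sq (hx h) n, A\] = opsum (fun i =>
  hx h i * \[hx h (n - i), A\] + \[hx h i, A\] * hx h (n - i)).
Proof. exact: comm_sq (hx_field h) (hxx h) A n. Qed.

Lemma ev_sq_x h A n : ev h \[sq (hx h) n, A\] = zsum (fun i =>
  ev h (hx h i * \[hx h (n - i), A\]) + ev h (\[hx h i, A\] * hx h (n - i))).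
Proof.
have lf := lfin_comml A (sq_lfin (hx_field h) (hxx h) n).
rewrite comm_sq_x ev_opsum.
  by apply: eq_zsum => i; rewrite evD.
by apply: eq_lfin lf => i; rewrite commMl.
Qed.

Lemma ev_cube_x h A n : ev h \[cube (hx h) n, A\] = zsum (fun i =>
  ev h (hx h i * \[sq (hx h) (n - i), A\]) + ev h (\[hx h i, A\] * sq (hx h) (n - i))).
Proof.
have lf := lfin_comml A (cube_lfin (hx_field h) (hxx h) n).
rewrite (comm_cube (hx_field h) (hxx h)) ev_opsum.
  by apply: eq_zsum => i; rewrite evD.
by apply: eq_lfin lf => i; rewrite commMl.
Qed.

(* In the expectations below only the terms with a zero mode survive. *)
Lemma zsum_dlt2 (f : int -> K) (m : int) (a b : K) :
  (forall i, f i = (i + m == 0)%:R * a + (i == 0)%:R * b) -> zsum f = a + b.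
Proof.
move=> fE; rewrite (eq_zsum fE) zsumD.
- rewrite (@zsum1 _ _ (- m)) ?(@zsum1 _ _ 0) ?addNr ?eqxx ?mul1r //.
    by move=> i /negPf ->; rewrite mul0r.
  by move=> i ne; zdecide; rewrite mul0r.
- by apply: (@zfin1 _ _ (- m)) => i ne; zdecide; rewrite mul0r.
- by apply: (@zfin1 _ _ 0) => i /negPf ->; rewrite mul0r.
Qed.

Lemma ev_sqx h n : ev h (sq (hx h) n) = (n == 0)%:R * hp h ^+ 2.
Proof.
have [->|n0] := eqVneq n 0; last by rewrite (ev_homog (homog_sqx h n)) // mul0r.
rewrite sqE ev_opsum; last exact: sq_lfin (hx_field h) (hxx h) 0.
rewrite (@zsum1 _ _ 0) => [|i i0]; first by rewrite ev_xx // eqxx.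
by rewrite ev_xx ?(negPf i0) ?mul0r //; lia.
Qed.

Lemma ev_x_sqx h i j : i + j = 0 -> ev h (hx h i * sq (hx h) j) = (i == 0)%:R * hp h ^+ 3.
Proof.
move=> ij; have [i0|] := eqVneq i 0.
  by rewrite i0 in ij *; rewrite ev_x0M ev_sqx; zdecide; ring.
move=> i0; have [gt0|lt0] : 0 < i \/ i < 0 by lia.
  by rewrite ev_xcomm // commC sqx_x oppr0 ev0 mul0r.
by rewrite ev_xM // mul0r.
Qed.

Lemma ev_sqx_x h i j : i + j = 0 -> ev h (sq (hx h) i * hx h j) = (i == 0)%:R * hp h ^+ 3.
Proof.
move=> ij; rewrite (comm_mulC (sqx_x h i j)) ev_x_sqx; last by lia.
by congr ((nat_of_bool _)%:R * _); lia.
Qed.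

(** A power of a current with background charge is not primary: besides the homogeneous
    term there is one of lower degree, proportional to the charge. *)
Lemma freeL_sqx h m n : \[freeL h m, sq (hx h) n\] =
  (m - n)%:~R *: sq (hx h) (m + n) - (2 * hb h * m%:~R ^+ 2) *: hx h (m + n).
Proof.
apply: (schur_eq (h := h)) => [k|k|].
- rewrite comm_jacobi !(sqx_x, freeL_x, comm_lin, hxx).
  by lincomb K; ring.
- rewrite comm_jacobi !(sqx_y, freeL_x, freeL_y, comm_lin, hxy).
  zmerge (hx h); zmerge_eq; lincomb K; zclose k m n.
have [mn|mn] := eqVneq (m + n) 0; last first.
  rewrite !evE ev_sqx ev_x (ev_homog (homog_comm (homog_freeL h m) (homog_sqx h n) erefl)) //.
  by zdecide; ring.
have {mn}-> : n = - m by lia.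
rewrite commC evN ev_sq_x (@zsum_dlt2 _ m (- m%:~R * hp h ^+ 2 + hb h * m%:~R ^+ 2 * hp h)
  (- m%:~R * hp h ^+ 2 + hb h * m%:~R ^+ 2 * hp h)).
  by rewrite addrN !evE ev_sqx ev_x; zdecide; ring.
move=> i; rewrite !(commC _ (freeL h m)) !freeL_x !mul_lin !evE !ev_x !ev_xx; [|lia..].
zclose2 i m.
Qed.

Lemma freeL_sqy h m n : \[freeL h m, sq (hy h) n\] =
  (m - n)%:~R *: sq (hy h) (m + n) + (2 * hb h * m%:~R ^+ 2) *: hy h (m + n).
Proof. by rewrite -freeL_swap (freeL_sqx (swap h)) /=; lincomb K; ring. Qed.

Lemma ev_cubex h n : ev h (cube (hx h) n) = (n == 0)%:R * hp h ^+ 3.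
Proof.
have [->|n0] := eqVneq n 0; last by rewrite (ev_homog (homog_cubex h n)) // mul0r.
rewrite cubeE ev_opsum; last exact: cube_lfin (hx_field h) (hxx h) 0.
rewrite (@zsum1 _ _ 0) => [|i i0]; first by rewrite ev_x_sqx // eqxx.
by rewrite ev_x_sqx ?(negPf i0) ?mul0r //; lia.
Qed.

Lemma freeL_cubex h m n : \[freeL h m, cube (hx h) n\] =
  (2 * m - n)%:~R *: cube (hx h) (m + n) - (3 * hb h * m%:~R ^+ 2) *: sq (hx h) (m + n).
Proof.
apply: (schur_eq (h := h)) => [k|k|].
- rewrite comm_jacobi !(cubex_x, sqx_x, freeL_x, comm_lin, hxx).
  by lincomb K; ring.
- rewrite comm_jacobi !(sqx_y, cubex_y, freeL_x, freeL_y, freeL_sqx, comm_lin).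
  zmerge (hx h); zmerge (sq (hx h)); zmerge_eq; lincomb K; zclose k m n.
have [mn|mn] := eqVneq (m + n) 0; last first.
  rewrite !evE ev_sqx ev_cubex (ev_homog (homog_comm (homog_freeL h m) (homog_cubex h n) erefl)) //.
  by zdecide; ring.
have {mn}-> : n = - m by lia.
rewrite commC evN ev_cube_x (@zsum_dlt2 _ m (- m%:~R * hp h ^+ 3 + hb h * m%:~R ^+ 2 * hp h ^+ 2)
  (- (2 * m%:~R * hp h ^+ 3) + 2 * hb h * m%:~R ^+ 2 * hp h ^+ 2)).
  by rewrite addrN !evE ev_sqx ev_cubex; zdecide; ring.
move=> i; rewrite !(commC _ (freeL h m)) !freeL_x !freeL_sqx !mul_lin !evE ev_sqx ev_x_sqx;
  last by lia.
rewrite ev_xx ?ev_x_sqx; [|lia..].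
zclose2 i m.
Qed.

Lemma freeL_cubey h m n : \[freeL h m, cube (hy h) n\] =
  (2 * m - n)%:~R *: cube (hy h) (m + n) + (3 * hb h * m%:~R ^+ 2) *: sq (hy h) (m + n).
Proof. by rewrite -freeL_swap (freeL_cubex (swap h)) /=; lincomb K; ring. Qed.

Lemma freeL_nquad h m n : \[freeL h m, nquad h (asymf K n) n\] =
  (2 * m - n)%:~R *: nquad h (asymf K (m + n)) (m + n)
  + (hb h * m%:~R ^+ 2 * (2 * m + n)%:~R) *: (hx h (m + n) + hy h (m + n)).
Proof.
apply: (schur_eq (h := h)) => [k|k|].
- rewrite comm_jacobi !(nquad_x, freeL_x, freeL_y, comm_lin, hxx, hyx) /asymf.
  zmerge (hx h); zmerge (hy h); zmerge_eq; lincomb K; zclose k m n.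
- rewrite comm_jacobi !(nquad_y, freeL_x, freeL_y, comm_lin, hyy, hxy) /asymf.
  zmerge (hx h); zmerge (hy h); zmerge_eq; lincomb K; zclose k m n.
have [mn|mn] := eqVneq (m + n) 0; last first.
  rewrite !evE ev_x ev_y (ev_homog (homog_nquad h _ _)) //
    (ev_homog (homog_comm (homog_freeL h m) (homog_nquad h _ n) erefl)) //.
  by zdecide; ring.
have {mn}-> : n = - m by lia.
rewrite addrN freeLE !comm_lin (commC (hx h m)) (commC (hy h m)) !nquad_x !nquad_y !evE !ev_x !ev_y
  ev_nquad2 ev_nquad.
rewrite (eq_zsum (g := fun i => ((2 * i + m) * (i * (m + i)))%:~R *
  (step K 0 i - step K (- m) i))); last first.
  by move=> i; rewrite /asymf; ring.
rewrite (@zsum_telescope _ _ (fun i => (i * (i + 1) * (i + m) * (i + m + 1))%:~R / 2)); last first.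
  by move=> i; field.
by rewrite /asymf; zdecide; field.
Qed.

(** The lower order terms of the preceding relations cancel, which is what dictates the
    relative coefficients in [freeW]. *)
Lemma freeL_freeW h m n : \[freeL h m, freeW h n\] = (2 * m - n)%:~R *: freeW h (m + n).
Proof.
rewrite !freeWE !comm_lin freeL_cubex freeL_cubey freeL_sqx freeL_sqy freeL_nquad freeL_x freeL_y.
by lincomb K; ring.
Qed.
End Virasoro.

(** * The composite field Lambda *)

Section Lambda.
Variables (K : numFieldType) (V : lmodType K).
Implicit Types (h : heisenberg V) (A B : lend V).

Lemma comm_swap_xy h A k l : \[\[A, hx h k\], hy h l\] = \[\[A, hy h l\], hx h k\].
Proof. by rewrite comm_jacobi hxy commZr comm1r scaler0 sub0r -commC. Qed.

Definition freeLambda_term h (n r : int) : lend V :=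
  if (-2 < r)%R then freeL h (n - r) * freeL h r else freeL h r * freeL h (n - r).

Lemma freeLambda_term_lfin h n : lfin (freeLambda_term h n).
Proof.
move=> v; have [N LN] := freeL_field h v; exists (N + `|n| + 2)%N => k ltk.
by rewrite /freeLambda_term; case: ltrP => k2; rewrite lendE LN ?linear0 //; lia.
Qed.

Definition freeLambda h (n : int) : lend V := locked (opsum (freeLambda_term h n)
  - (3 / 10 * ((n + 2) * (n + 3))%:~R) *: freeL h n).
Lemma freeLambdaE h n : freeLambda h n =
  opsum (freeLambda_term h n) - (3 / 10 * ((n + 2) * (n + 3))%:~R) *: freeL h n.
Proof. by rewrite /freeLambda -lock. Qed.

Lemma freeLambda_swap h n : freeLambda (swap h) n = freeLambda h n.
Proof.
rewrite !freeLambdaE freeL_swap; congr (_ - _); apply: eq_opsum => r.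
by rewrite /freeLambda_term !freeL_swap.
Qed.

Lemma homog_freeLambda h n : homog h n (freeLambda h n).
Proof.
rewrite freeLambdaE; apply: homog_D; last exact/homog_N/homog_Z/homog_freeL.
apply: homog_opsum => [|r]; first exact: freeLambda_term_lfin.
rewrite /freeLambda_term; case: ifP => _; apply: homog_M (homog_freeL _ _) (homog_freeL _ _) _; lia.
Qed.

Lemma freeL_xx h n k l : \[\[freeL h n, hx h k\], hx h l\] = 0.
Proof. by rewrite freeL_x !comm_lin hxx; lincomb K; ring. Qed.

Lemma opsum_shiftmul h p k l :
  opsum (fun r => hx h (p - r + k) * hx h (r + l)) = sq (hx h) (p + k + l)
  /\ lfin (fun r => hx h (p - r + k) * hx h (r + l)).
Proof.
have lf := sq_lfin (hx_field h) (hxx h) (p + k + l).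
have e r : hx h (p + k - r) * hx h (p + k + l - (p + k - r)) = hx h (p - r + k) * hx h (r + l).
  by congr (hx h _ * hx h _); lia.
split; last by apply: eq_lfin (lfin_refl (p + k) lf).
by rewrite sqE -(opsum_refl (p + k) lf); apply: eq_opsum => r; rewrite e.
Qed.

(** As [freeL] is of degree one in [hy], the two modes have to be absorbed by different
    factors of a product. What is left of the two factors commutes, so that the
    ordering in the definition of Lambda no longer matters. *)
Lemma freeLambda_xx h p k l : \[\[freeLambda h p, hx h k\], hx h l\] =
  (2 * k%:~R * l%:~R) *: sq (hx h) (p + k + l)
  + (2 * hb h * k%:~R * l%:~R * (k + l)%:~R) *: hx h (p + k + l)
  + (2 * hb h ^+ 2 * k%:~R ^+ 2 * l%:~R ^+ 2 * (p + k + l == 0)%:R) *: (1 : lend V).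
Proof.
rewrite freeLambdaE !comm_lin freeL_xx scaler0 subr0.
rewrite comm_opsuml; last exact: freeLambda_term_lfin.
rewrite comm_opsuml; last exact/lfin_comml/freeLambda_term_lfin.
pose g (k l r : int) : lend V := (k%:~R * l%:~R) *: (hx h (p - r + k) * hx h (r + l))
  + (r + l == 0)%:R *: ((hb h * k%:~R * l%:~R ^+ 2) *: hx h (p - r + k))
  + (r + (- (p + k)) == 0)%:R *: ((hb h * k%:~R ^+ 2 * l%:~R) *: hx h (r + l))
  + (r + l == 0)%:R *: ((hb h ^+ 2 * k%:~R ^+ 2 * l%:~R ^+ 2 * (p - r + k == 0)%:R) *:
    (1 : lend V)).
have gE (k' l' r : int) : \[freeL h (p - r), hx h k'\] * \[freeL h r, hx h l'\] = g k' l' r.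
  rewrite /g !freeL_x !mul_lin (_ : (r - (p + k') == 0) = (p - r + k' == 0)); last by lia.
  by lincomb K; ring.
have gC (k' l' r : int) : \[freeL h r, hx h l'\] * \[freeL h (p - r), hx h k'\] = g k' l' r.
  rewrite -gE; apply: comm_mulC; rewrite !freeL_x !comm_lin hxx.
  by lincomb K; ring.
have gl (k' l' : int) : lfin (g k' l').
  apply/lfinD/lfin_dlt/lfinD/lfin_dlt/lfinD/lfin_dlt/lfinZ.
  exact: (opsum_shiftmul h p k' l').2.
have gS (k' l' : int) : opsum (g k' l') = (k'%:~R * l'%:~R) *: sq (hx h) (p + k' + l')
  + (hb h * k'%:~R * l'%:~R * (k' + l')%:~R) *: hx h (p + k' + l')
  + (hb h ^+ 2 * k'%:~R ^+ 2 * l'%:~R ^+ 2 * (p + k' + l' == 0)%:R) *: (1 : lend V).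
  rewrite /g opsumD; last exact: lfin_dlt.
    rewrite opsumD; last exact: lfin_dlt.
      rewrite opsumD; last exact: lfin_dlt.
        rewrite -opsumZ; last exact: (opsum_shiftmul h p k' l').2.
        rewrite (opsum_shiftmul h p k' l').1 !opsum_dlt.
        zmerge (hx h); zmerge_eq; lincomb K; ring.
      by apply: lfinZ; exact: (opsum_shiftmul h p k' l').2.
    by apply/lfinD/lfin_dlt/lfinZ; exact: (opsum_shiftmul h p k' l').2.
  by apply/lfinD/lfin_dlt/lfinD/lfin_dlt/lfinZ; exact: (opsum_shiftmul h p k' l').2.
clearbody g.
rewrite (eq_opsum (g := fun r => g k l r + g l k r)).
  by rewrite opsumD ?gS; [zmerge (hx h); zmerge (sq (hx h)); zmerge_eq; lincomb K; ring|..].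
move=> r; rewrite /freeLambda_term; case: ifP => _.
  rewrite commMl commDl 2!commMl !freeL_xx !gE mulr0 mul0r add0r addr0.
  by rewrite addrC.
rewrite commMl commDl 2!commMl.
rewrite !freeL_xx.
rewrite (gC l k).
rewrite (gC k l).
by rewrite mulr0 mul0r add0r addr0.
Qed.

Lemma zfin_dlt (s : int) (g : int -> K) : zfin (fun i => (i + s == 0)%:R * g i).
Proof. by apply: (@zfin1 _ _ (- s)) => i ne; zdecide; rewrite mul0r. Qed.

Lemma zsum_dlt (s : int) (g : int -> K) : zsum (fun i => (i + s == 0)%:R * g i) = g (- s).
Proof.
rewrite (@zsum1 _ _ (- s)) ?addNr ?eqxx ?mul1r // => i ne.
by zdecide; rewrite mul0r.
Qed.

Ltac zsplit := rewrite !zsumD; rewrite ?zsum_dlt;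
  do ?[exact: zfin_dlt | exact: zfin_step | apply: zfinD].

(** The two orders of the factors give contractions with opposite positive parts; both
    cases are one interval sum starting at the cut -2 of the ordering in Lambda. *)
Lemma step_flip (a r : int) : (if (-2 < r)%R then - (r + a)%:~R * step K 0 (- (r + a))
  else (r + a)%:~R * step K 0 (r + a)) = - (r + a)%:~R * (step K (-2) r - step K (- a) r) :> K.
Proof.
have [e|e] := eqVneq (r + a) 0; have [l|l] := ltrP (- a) r; case: ltrP => l2;
  zdecide; try ring; rewrite e; ring.
Qed.

Lemma comb2 (a b u v u' v' c c' : K) : u = v -> u' = v' ->
  a - b = c * (u - v) + c' * (u' - v') -> a = b.
Proof. by move=> -> ->; rewrite !subrr !mulr0 addr0 => /subr0_eq. Qed.

(** Double contractions now depend on the ordering in Lambda: the sums run from the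
    cut -2 to - l and to - k, whence the factors (l - 1) (l - 2) and (k - 1) (k - 2). *)
Lemma ev_freeLambda_xy h (k l : int) : ev h \[\[freeLambda h (- (k + l)), hx h k\], hy h l\] =
  k%:~R * l%:~R * (((k - 1) * (k - 2) + (l - 1) * (l - 2))%:~R / 2 + 2 * hp h * hq h)
  + 2 * k%:~R * l%:~R * (hp h * hq h + hb h ^+ 2)
  + 2 * hb h * k%:~R * l%:~R * (k%:~R * hq h - l%:~R * hp h)
  - 2 * hb h ^+ 2 * k%:~R ^+ 2 * l%:~R ^+ 2
  - 3 / 10 * ((2 - (k + l)) * (3 - (k + l)))%:~R * k%:~R * l%:~R.
Proof.
set p := - (k + l).
have last_term : ev h \[\[freeL h p, hx h k\], hy h l\] = k%:~R * l%:~R.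
  rewrite freeL_x !comm_lin hxy !evE; zdecide; rewrite /p; ring.
rewrite freeLambdaE !comm_lin !evE last_term.
rewrite comm_opsuml; last exact: freeLambda_term_lfin.
rewrite comm_opsuml; last exact/lfin_comml/freeLambda_term_lfin.
rewrite ev_opsum; last exact/lfin_comml/lfin_comml/freeLambda_term_lfin.
(* The lowest weight [h0] and the coefficient [c] come from the zero modes. *)
pose h0 := hp h * hq h + hb h ^+ 2.
pose g (a : int) (b : K) (r : int) := k%:~R * l%:~R * hp h * hq h + (r + a == 0)%:R * b.
pose c := hb h * k%:~R * l%:~R * (k%:~R * hq h - l%:~R * hp h)
  - hb h ^+ 2 * k%:~R ^+ 2 * l%:~R ^+ 2.
rewrite (eq_zsum (g := fun r =>
  (- (k%:~R * l%:~R * (r + l)%:~R)) * (step K (-2) r - step K (- l) r)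
  + (- (k%:~R * l%:~R * (r + k)%:~R)) * (step K (-2) r - step K (- k) r)
  + (r + l == 0)%:R * g l c r + (r + k == 0)%:R * g k c r
  + (r + 0 == 0)%:R * ((r == 0)%:R * (- (k%:~R * (p - r + k)%:~R * h0)))
  + (r + (k + l) == 0)%:R * ((p - r == 0)%:R * (- (k%:~R * (r + k)%:~R * h0))))).
  zsplit.
  rewrite (@zsum_telescope _ _ (fun r => - (k%:~R * l%:~R * ((r + l) * (r + l + 1))%:~R / 2)));
    last first.
    by move=> i; field.
  rewrite (@zsum_telescope _ _ (fun r => - (k%:~R * l%:~R * ((r + k) * (r + k + 1))%:~R / 2)));
    last first.
    by move=> i; field.
  by rewrite /g /c /h0 /p; zdecide; field.
move=> r.
have sl := step_flip l r; have sk := step_flip k r.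
have e1 : (p - r == 0) = (r + k + l == 0) by lia.
have e2 : (- (r + l) + l == 0) = (r == 0) by lia.
have e3 : r + (k + l) = r + k + l by rewrite addrA.
have pE : p = - (k + l) by [].
rewrite /freeLambda_term; case: ifP sl sk => r2 sl sk;
  apply: (comb2 (c := k%:~R * l%:~R) (c' := k%:~R * l%:~R) sl sk);
  rewrite /g /c /h0 commMl commDl 2!commMl !(freeL_x, freeL_y, comm_lin, hxy) !mul_lin !evE
    !(ev_x, ev_y, ev_freeL) ev_xy ?ev_yx; try lia.
- rewrite (_ : p - r + k = - (r + l)); last by lia.
  rewrite (_ : p - r + l = - (r + k)); last by lia.
  by rewrite !oppr_eq0 addr0 e1 e2 e3; ring.
rewrite (_ : p - r + k = - (r + l)); last by lia.
rewrite (_ : p - r + l = - (r + k)); last by lia.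
by rewrite !oppr_eq0 addr0 e1 e2 e3; ring.
Qed.

Lemma ev_freeL_x h s : ev h (freeL h (- s) * hx h s) =
  - (s%:~R * hp h + hb h * s%:~R ^+ 2) * (1 - step K 0 s)
  + (s == 0)%:R * hp h * (hp h * hq h + hb h ^+ 2).
Proof.
have [->|s0] := eqVneq s 0; first by rewrite ev_Mx0 ev_freeL; zdecide; ring.
have [gt0|lt0] : 0 < s \/ s < 0 by lia.
  by rewrite ev_Mx //; zdecide; ring.
by rewrite ev_commx // freeL_x !evE ev_x; zdecide; ring.
Qed.

Lemma ev_x_freeL h s : ev h (hx h s * freeL h (- s)) =
  (s%:~R * hp h + hb h * s%:~R ^+ 2) * step K 0 s
  + (s == 0)%:R * hp h * (hp h * hq h + hb h ^+ 2).
Proof.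
have [->|s0] := eqVneq s 0; first by rewrite ev_x0M ev_freeL; zdecide; ring.
have [gt0|lt0] : 0 < s \/ s < 0 by lia.
  by rewrite ev_xcomm // commC freeL_x !evE ev_x; zdecide; ring.
by rewrite ev_xM //; zdecide; ring.
Qed.

Lemma ev_freeLambda_x h (k : int) : ev h \[freeLambda h (- k), hx h k\] =
  - k%:~R * (hp h * ((k - 1) * (k - 2))%:~R / 2 + hb h * ((k - 1) * (k - 2) * (2 * k - 3))%:~R / 6
    + hp h + hb h + 2 * hp h * (hp h * hq h + hb h ^+ 2))
  - 2 * hb h * k%:~R ^+ 2 * (hp h * hq h + hb h ^+ 2)
  + 3 / 10 * ((2 - k) * (3 - k))%:~R * (k%:~R * hp h + hb h * k%:~R ^+ 2).
Proof.
rewrite freeLambdaE !comm_lin !evE.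
rewrite comm_opsuml; last exact: freeLambda_term_lfin.
rewrite ev_opsum; last exact/lfin_comml/freeLambda_term_lfin.
pose h0 := hp h * hq h + hb h ^+ 2.
pose b := - (k%:~R * hp h * h0 + hb h * k%:~R ^+ 2 * h0).
pose u (s : int) : K := s%:~R * hp h + hb h * s%:~R ^+ 2.
rewrite (eq_zsum (g := fun r =>
  (k%:~R * u (r + k)) * (step K (-2) r - step K (- k) r)
  + (- k%:~R * u (- r)) * (step K (-2) r - step K 0 r)
  + (r + 0 == 0)%:R * b + (r + k == 0)%:R * b)).
  zsplit.
  rewrite (@zsum_telescope _ _ (fun r => k%:~R * (hp h * ((r + k) * (r + k + 1))%:~R / 2
    + hb h * ((r + k) * (r + k + 1) * (2 * (r + k) + 1))%:~R / 6))); last first.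
    by move=> i; rewrite /u; field.
  rewrite (@zsum_telescope _ _ (fun r => - k%:~R * (- hp h * (r * (r + 1))%:~R / 2
    + hb h * (r * (r + 1) * (2 * r + 1))%:~R / 6))); last first.
    by move=> i; rewrite /u; field.
  by rewrite /b /h0 freeL_x !evE ev_x; zdecide; field.
move=> r; rewrite /freeLambda_term; case: ltrP => r2.
  have -> : freeL h (- k - r) = freeL h (- (r + k)) by congr (freeL h _); lia.
  rewrite commMl !freeL_x !mul_lin !evE !ev_freeL ev_freeL_x.
  rewrite (_ : - (r + k) + k = - r); last by lia.
  have := ev_x_freeL h (- r); rewrite opprK => ->.
  rewrite /u /b /h0.
  have -> : step K 0 (- r) = 1 - step K 0 r - (r + 0 == 0)%:R.
    by have [e|e] := eqVneq r 0; have [l|l] := ltrP 0 r; try (exfalso; lia); zdecide; ring.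
  have -> : step K 0 (r + k) = step K (- k) r by rewrite /step; congr (nat_of_bool _)%:R; lia.
  have -> : step K (-2) r = 1 by rewrite /step r2.
  have [e|e] := eqVneq r 0; zdecide; zmerge_eq; rewrite ?e; case: (_ == _) => /=; ring.
have -> : freeL h (- k - r) = freeL h (- (r + k)) by congr (freeL h _); lia.
rewrite commMl !freeL_x !mul_lin !evE !ev_freeL ev_x_freeL.
rewrite (_ : - (r + k) + k = - r); last by lia.
have := ev_freeL_x h (- r); rewrite opprK => ->.
rewrite /u /b /h0.
have -> : step K 0 (- r) = 1 by zdecide.
have -> : step K 0 (r + k) = step K (- k) r by rewrite /step; congr (nat_of_bool _)%:R; lia.
by zdecide; zmerge_eq; case: (_ == _) => /=; ring.
Qed.

(** Of the infinite sum only two terms survive on the vacuum: the square of [L_0], and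
    [L_1 L_{-1}], which the cut at -2 leaves in that order. *)
Lemma ev_freeLambda0 h : ev h (freeLambda h 0) =
  (hp h * hq h + hb h ^+ 2) ^+ 2 + (hp h * hq h + hb h ^+ 2) / 5.
Proof.
rewrite freeLambdaE !evE ev_freeL; zdecide; rewrite ev_opsum; last exact: freeLambda_term_lfin.
pose h0 := hp h * hq h + hb h ^+ 2.
rewrite (eq_zsum (g := fun r => (r + 0 == 0)%:R * (h0 ^+ 2) + (r + 1 == 0)%:R * (2 * h0))).
  by zsplit; rewrite /h0; field.
move=> r; rewrite /freeLambda_term sub0r; case: ltrP => r2; last first.
  by rewrite ev_freeLM; [zdecide; ring | lia].
have [l|l] := ltrP 0 r; first by rewrite ev_MfreeL //; zdecide; ring.
have [e|e] := eqVneq r 0.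
  have -> : freeL h (- r) = freeL h 0 by congr (freeL h _); lia.
  by rewrite e ev_MfreeL0 ev_freeL; zdecide; rewrite -/h0; ring.
have -> : r = -1 by lia.
have -> : freeL h (- (-1)) = freeL h 1 by [].
transitivity (ev h \[freeL h 1, freeL h (-1)\]).
  by rewrite commE evD evN [X in _ - X]ev_freeLM // subr0.
by rewrite freeL_freeL !evE ev_freeL; zdecide; rewrite -/h0; ring.
Qed.
End Lambda.

(** * The commutator of two modes of W *)

Section WW.
Variables (K : numFieldType) (V : lmodType K).
Implicit Types (h : heisenberg V) (A B : lend V).

Lemma ev_sqxM h A n : n < 0 -> ev h (sq (hx h) n * A) = 0.
Proof.
move=> n0; have lf := sq_lfin (hx_field h) (hxx h) n.
rewrite sqE opsumMr // ev_opsum; last exact: lfinMr.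
apply: zsum0 => i; have [i0|i0] := ltrP i 0; first by rewrite -mulrA ev_xM.
by rewrite (comm_mulC (hxx h _ _)) -mulrA ev_xM //; lia.
Qed.

Lemma sqx_vac h n : 0 <= n ->
  lend_fun (sq (hx h) n) (vac h) = ((n == 0)%:R * hp h ^+ 2) *: vac h.
Proof.
move=> n0; have lf := sq_lfin (hx_field h) (hxx h) n.
rewrite sqE opsumE // (@zsum1 _ _ 0) => [|i i0].
  rewrite subr0 hx0 !lendE; have [->|e] := eqVneq n 0.
    by rewrite hx0 !lendE scalerA mul1r expr2.
  by rewrite hx_vac ?scaler0 ?mul0r ?scale0r //; lia.
have [l|l] := ltrP 0 i; first by rewrite (comm_mulC (hxx h _ _)) lendE hx_vac ?linear0.
by rewrite lendE hx_vac ?linear0 //; lia.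
Qed.

Lemma ev_Msqx h A n : 0 <= n -> ev h (A * sq (hx h) n) = (n == 0)%:R * hp h ^+ 2 * ev h A.
Proof. by move=> n0; rewrite /ev lendE sqx_vac // !linearZ. Qed.
Lemma ev_sqyM h A n : n < 0 -> ev h (sq (hy h) n * A) = 0.
Proof. exact: (ev_sqxM (swap h)). Qed.
Lemma ev_Msqy h A n : 0 <= n -> ev h (A * sq (hy h) n) = (n == 0)%:R * hq h ^+ 2 * ev h A.
Proof. exact: (ev_Msqx (swap h)). Qed.

(** The polynomial is the sum of the double contractions 2 i (s - i) for i from 1 to s. *)
Lemma ev_sqx_sqy h s :
  ev h \[sq (hx h) s, sq (hy h) (- s)\] = (s * (s ^+ 2 - 1))%:~R / 3 + 4 * s%:~R * hp h * hq h.
Proof.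
rewrite ev_sq_x (eq_zsum (g := fun i => (2 * i * (s - i))%:~R * (step K 0 i - step K s i)
  + (i + 0 == 0)%:R * (2 * s%:~R * hp h * hq h) + (i + (- s) == 0)%:R * (2 * s%:~R * hp h * hq h))).
  rewrite !zsumD; rewrite ?zsum_dlt; do ?[exact: zfin_dlt | exact: zfin_step | apply: zfinD].
  rewrite (@zsum_telescope _ _ (fun i =>
    (s * i * (i + 1))%:~R - (i * (i + 1) * (2 * i + 1))%:~R / 3)); last first.
    by move=> i; field.
  by field.
move=> i; rewrite !(commC (hx h _)) !sqy_x !mul_lin !evE ev_xy ?ev_yx; [|lia..].
have -> : step K 0 (- s + i) = step K s i by rewrite /step; congr (nat_of_bool _)%:R; lia.
have [e|e] := eqVneq (i - s) 0; have [e'|e'] := eqVneq i 0; zdecide; try ring.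
- have -> : i = 0 by lia.
  have -> : s = 0 by lia.
  ring.
- have -> : i = s by lia.
  ring.
- have -> : i = 0 by lia.
  ring.
Qed.

Lemma ev_sq_y h A n : ev h \[sq (hy h) n, A\] = zsum (fun i =>
  ev h (hy h i * \[hy h (n - i), A\]) + ev h (\[hy h i, A\] * hy h (n - i))).
Proof. exact: (ev_sq_x (swap h)). Qed.
Lemma ev_cube_y h A n : ev h \[cube (hy h) n, A\] = zsum (fun i =>
  ev h (hy h i * \[sq (hy h) (n - i), A\]) + ev h (\[hy h i, A\] * sq (hy h) (n - i))).
Proof. exact: (ev_cube_x (swap h)). Qed.

Lemma ev_y_sqx h (i : int) : ev h (hy h i * sq (hx h) (- i)) =
  2 * i%:~R * hp h * step K 0 i + (i == 0)%:R * hq h * hp h ^+ 2.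
Proof.
have [->|i0] := eqVneq i 0; first by rewrite ev_y0M ev_sqx; zdecide; ring.
have [gt0|lt0] : 0 < i \/ i < 0 by lia.
  by rewrite ev_ycomm // commC sqx_y !evE ev_x; zdecide; ring.
by rewrite ev_yM //; zdecide; ring.
Qed.

Lemma ev_sqx_y h (i : int) : ev h (sq (hx h) i * hy h (- i)) =
  2 * i%:~R * hp h * step K 0 i + (i == 0)%:R * hq h * hp h ^+ 2.
Proof.
have [->|i0] := eqVneq i 0; first by rewrite ev_My0 ev_sqx; zdecide; ring.
have [gt0|lt0] : 0 < i \/ i < 0 by lia.
  have -> : sq (hx h) i * hy h (- i) = \[sq (hx h) i, hy h (- i)\] + hy h (- i) * sq (hx h) i.
    by rewrite commE subrK.
  by rewrite sqx_y !evE ev_yM ?ev_x; [zdecide; ring | lia].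
by rewrite ev_My; [zdecide; ring | lia].
Qed.

Lemma ev_yy h (i j : int) : i + j = 0 -> ev h (hy h i * hy h j) = (i == 0)%:R * hq h ^+ 2.
Proof. exact: (ev_xx (swap h)). Qed.

Lemma W_y h m j : \[hy h j, freeW h m\] =
  (6 * j%:~R) *: sq (hx h) (m + j) - (6 * hb h * m%:~R * j%:~R) *: hx h (m + j)
  - (3 * hb h * j%:~R * (m + 2 * j)%:~R) *: hy h (m + j)
  + (3 * hb h ^+ 2 * j%:~R ^+ 3 * (m + j == 0)%:R) *: (1 : lend V).
Proof. by rewrite commC freeW_y; lincomb K; ring. Qed.

Lemma step_shift (m i : int) : step K 0 (m + i) = step K (- m) i.
Proof. by rewrite /step; congr (nat_of_bool _)%:R; lia. Qed.

(** The value of [ev_freeW_sqy]; it enters [ev_freeW_cubey] through the zero mode of one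
    of the three factors. *)
Definition Sy h m : K := (2 * hp h - hb h * m%:~R) * (m * (m ^+ 2 - 1))%:~R
  + 12 * m%:~R * hq h * hp h ^+ 2 - 12 * hb h * m%:~R ^+ 2 * hp h * hq h
  + 6 * hb h * m%:~R ^+ 2 * hq h ^+ 2 + 6 * hb h ^+ 2 * m%:~R ^+ 3 * hq h.

Lemma ev_freeW_sqy h m : ev h \[freeW h m, sq (hy h) (- m)\] = Sy h m.
Proof.
rewrite commC evN ev_sq_y.
pose b i : K := 6 * i%:~R * hq h * hp h ^+ 2 - 6 * hb h * m%:~R * i%:~R * hp h * hq h
  - 3 * hb h * i%:~R * (m + 2 * i)%:~R * hq h ^+ 2 + 3 * hb h ^+ 2 * i%:~R ^+ 3 * hq h.
rewrite (eq_zsum (g := fun i => ((6 * hb h * m%:~R - 12 * hp h) * (i * (m + i))%:~R) *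
  (step K 0 i - step K (- m) i)
  + (i + 0 == 0)%:R * b (- m - i) + (i + m == 0)%:R * b i)).
  rewrite !zsumD; rewrite ?zsum_dlt; do ?[exact: zfin_dlt | exact: zfin_step | apply: zfinD].
  rewrite (@zsum_telescope _ _ (fun i => (6 * hb h * m%:~R - 12 * hp h) *
     ((i * (i + 1) * (2 * i + 1))%:~R / 6 + (m * i * (i + 1))%:~R / 2))); last first.
    by move=> i; field.
  by rewrite /b /Sy; field.
move=> i; rewrite !W_y !mul_lin !evE !(ev_x, ev_y).
rewrite (_ : m + (- m - i) = - i); last by lia.
rewrite (_ : - m - i = - (m + i)); last by lia.
rewrite ev_y_sqx ev_sqx_y ev_yx ?ev_xy ?ev_yy; [|lia..].
rewrite step_shift /b.
rewrite (_ : (- i == 0) = (i == 0)); last by lia.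
rewrite (_ : (- (m + i) == 0) = (m + i == 0)); last by lia.
zmerge_eq; rewrite ?addr0.
by case: (i == 0); case: (m + i == 0) => /=; ring.
Qed.

Definition Cy h m : K := (m * (m ^+ 2 - 1) * (m ^+ 2 - 4))%:~R / 10
  - (2 * hb h * m%:~R * hq h - 4 * hp h * hq h) * (m * (m ^+ 2 - 1))%:~R
  + hq h * Sy h m + 6 * m%:~R * hp h ^+ 2 * hq h ^+ 2 - 6 * hb h * m%:~R ^+ 2 * hp h * hq h ^+ 2
  + 3 * hb h * m%:~R ^+ 2 * hq h ^+ 3 + 3 * hb h ^+ 2 * m%:~R ^+ 3 * hq h ^+ 2.

(** The polynomial m (m^2 - 1) (m^2 - 4) of the central term of the relation is the triple
    contraction of two cubes. *)
Lemma ev_freeW_cubey h m : ev h \[freeW h m, cube (hy h) (- m)\] = Cy h m.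
Proof.
rewrite commC evN ev_cube_y.
(* [phi] is the expectation of the commutator of two squares, [chi] the contribution of a
   first contraction that leaves such a commutator, [b] that of the zero modes. *)
pose phi (s : int) : K := (s * (s ^+ 2 - 1))%:~R / 3 + 4 * s%:~R * hp h * hq h.
pose chi (i : int) : K := 6 * i%:~R * phi (m + i)
  - 12 * hb h * m%:~R * i%:~R * (m + i)%:~R * hq h.
pose b (i : int) : K := 6 * i%:~R * hp h ^+ 2 * hq h ^+ 2
  - 6 * hb h * m%:~R * i%:~R * hp h * hq h ^+ 2
  - 3 * hb h * i%:~R * (m + 2 * i)%:~R * hq h ^+ 3 + 3 * hb h ^+ 2 * i%:~R ^+ 3 * hq h ^+ 2.
rewrite (eq_zsum (g := fun i => (- chi i) * (step K 0 i - step K (- m) i)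
  + (i + 0 == 0)%:R * (- hq h * Sy h m) + (i + m == 0)%:R * b i)).
  rewrite !zsumD; rewrite ?zsum_dlt; do ?[exact: zfin_dlt | exact: zfin_step | apply: zfinD].
  rewrite (@zsum_telescope _ _ (fun i =>
      - 2 * ((i + m - 1) * (i + m) * (i + m + 1) * (i + m + 2))%:~R *
        ((2 * (i + m) + 1)%:~R / 10 - m%:~R / 4)
      + (12 * hb h * m%:~R * hq h - 24 * hp h * hq h) *
        ((i * (i + 1) * (2 * i + 1))%:~R / 6 + (m * i * (i + 1))%:~R / 2))); last first.
    by move=> i; rewrite /chi /phi; field.
  by rewrite /b /Cy; field.
move=> i.
have -> : - m - i = - (m + i) by lia.
have first_term : ev h (hy h i * \[sq (hy h) (- (m + i)), freeW h m\]) =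
    (- chi i) * step K 0 i + (i == 0)%:R * (- hq h * Sy h m).
  have [->|i0] := eqVneq i 0.
    by rewrite ev_y0M addr0 commC evN ev_freeW_sqy; zdecide; ring.
  have [gt0|lt0] : 0 < i \/ i < 0 by lia.
    rewrite ev_ycomm // commC evN comm_jacobi sqy_y comm0r subr0 freeW_y !comm_lin sqy_y sqy_x.
    rewrite (commC (sq (hy h) _)) !evE ev_sqx_sqy ev_y addNr; zdecide.
    by rewrite /chi /phi; field.
  by rewrite ev_yM //; zdecide; ring.
have second_term : ev h (\[hy h i, freeW h m\] * sq (hy h) (- (m + i))) =
    chi i * step K 0 (m + i) + (m + i == 0)%:R * b i.
  rewrite W_y; have [l|l] := lerP 0 (- (m + i)).
    rewrite ev_Msqy // !evE ev_sqx ev_x ev_y.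
    have [e|e] := eqVneq (m + i) 0; zdecide; last by ring.
    by rewrite /b; ring.
  have -> A : A * sq (hy h) (- (m + i)) = \[A, sq (hy h) (- (m + i))\] + sq (hy h) (- (m + i)) * A.
    by rewrite commE subrK.
  rewrite evD ev_sqyM ?addr0; last by lia.
  rewrite !comm_lin !evE ev_sqx_sqy (commC (hx h _)) (commC (hy h _)) sqy_x sqy_y !evE ev_y;
    zdecide.
  by rewrite /chi /phi; field.
rewrite first_term second_term step_shift addr0 (addrC i m).
by ring.
Qed.

Lemma ev_freeW_cubex h m : ev h \[freeW h m, cube (hx h) (- m)\] = Cy (swap h) m.
Proof. by rewrite -freeW_swap; apply: (ev_freeW_cubey (swap h)). Qed.
Lemma ev_freeW_sqx h m : ev h \[freeW h m, sq (hx h) (- m)\] = Sy (swap h) m.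
Proof. by rewrite -freeW_swap; apply: (ev_freeW_sqy (swap h)). Qed.

Lemma ev_x_sqx' h (i : int) : ev h (hx h i * sq (hx h) (- i)) = (i == 0)%:R * hp h ^+ 3.
Proof. by apply: ev_x_sqx; lia. Qed.
Lemma ev_sqy h n : ev h (sq (hy h) n) = (n == 0)%:R * hq h ^+ 2.
Proof. exact: (ev_sqx (swap h)). Qed.
Lemma ev_y_sqy h (i j : int) : i + j = 0 -> ev h (hy h i * sq (hy h) j) = (i == 0)%:R * hq h ^+ 3.
Proof. exact: (ev_x_sqx (swap h)). Qed.
Lemma ev_sqy_y h (i : int) : ev h (sq (hy h) i * hy h (- i)) = (i == 0)%:R * hq h ^+ 3.
Proof. by apply: (ev_sqx_x (swap h)); lia. Qed.

(** The zero mode part of the expectations in [ev_freeW_nquad]. *)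
Definition Gx h (m i : int) : K := - (6 * i%:~R * hq h ^+ 3) - 6 * hb h * m%:~R * i%:~R * hq h ^+ 2
  - 3 * hb h * i%:~R * (m + 2 * i)%:~R * hp h * hq h - 3 * hb h ^+ 2 * i%:~R ^+ 3 * hq h.

Lemma ev_freeW_nquad h m : ev h \[freeW h m, nquad h (asymf K (- m)) (- m)\] =
  hb h * (m * (m ^+ 2 - 1) * (m ^+ 2 - 4))%:~R / 10
  + m%:~R * Gx (swap h) m (- m) - m%:~R * Gx h m (- m).
Proof.
rewrite nquadE comm_opsumr; last exact: nquad_lfin.
rewrite ev_opsum; last exact/lfin_commr/nquad_lfin.
rewrite (eq_zsum (g := fun i => (3 * hb h * (i * (m + i) * (m + 2 * i) ^+ 2)%:~R) *
  (step K 0 i - step K (- m) i)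
  + (i + 0 == 0)%:R * ((2 * i + m)%:~R * Gx (swap h) m (- m - i))
    + (i + m == 0)%:R * ((2 * i + m)%:~R * Gx h m i))).
  rewrite !zsumD; rewrite ?zsum_dlt; do ?[exact: zfin_dlt | exact: zfin_step | apply: zfinD].
  (* The summand is 4 i^4 + 8 m i^3 + 5 m^2 i^2 + m^3 i, up to the factor 3 hb. *)
  rewrite (@zsum_telescope _ _ (fun i => 3 * hb h * (
      4 * (i * (i + 1) * (2 * i + 1) * (3 * i ^+ 2 + 3 * i - 1))%:~R / 30
      + 8 * m%:~R * (i * (i + 1))%:~R ^+ 2 / 4
      + 5 * m%:~R ^+ 2 * (i * (i + 1) * (2 * i + 1))%:~R / 6
      + m%:~R ^+ 3 * (i * (i + 1))%:~R / 2))); last first.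
    by move=> i; field.
  by rewrite /Gx /=; field.
move=> i; rewrite commZr evZ /asymf /nord.
have -> : - m - i = - (m + i) by lia.
case: lerP => i0; rewrite commMr !freeW_x !freeW_y !mul_lin !evE.
  rewrite (_ : m - (m + i) = - i); last by lia.
  rewrite !ev_x !ev_y ev_x_sqx' ev_sqy_y !ev_xx ?ev_yy ?ev_xy; [|lia..].
  rewrite step_shift (_ : step K 0 i = 0); last by zdecide.
  rewrite (_ : (- i == 0) = (i == 0)); last by lia.
  rewrite (_ : (- (m + i) == 0) = (m + i == 0)); last by lia.
  rewrite (_ : (i + 0 == 0) = (i == 0)); last by lia.
  rewrite (_ : (i + m == 0) = (m + i == 0)); last by lia.
  by rewrite /Gx /=; case: (i == 0); case: (m + i == 0) => /=; ring.
rewrite (_ : m - (m + i) = - i); last by lia.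
rewrite !ev_x !ev_y ev_y_sqy ?ev_sqx_x ?ev_xx ?ev_yy ?ev_yx; [|lia..].
have -> : step K 0 (- (m + i)) = 1 - step K (- m) i - (m + i == 0)%:R.
  by have [e|e] := eqVneq (m + i) 0; have [l|l] := ltrP (- m) i; try (exfalso; lia); zdecide; ring.
have -> : step K 0 (- i) = 0 by zdecide.
have -> : step K 0 i = 1 by zdecide.
rewrite (_ : (- i == 0) = (i == 0)); last by lia.
rewrite (_ : (- (m + i) == 0) = (m + i == 0)); last by lia.
rewrite /Gx /=; have [e|e] := eqVneq (i + m) 0; zdecide; last by ring.
have -> : m = - i by lia.
by ring.
Qed.

(** The structure constants for [freeW], which is 6 / b times W: with
    b^2 = 16 / (22 + 5 c) and c = 2 + 24 hb^2, the factor b^2 of Lambda becomes 36, the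
    factor 1 / 30 of L becomes 36 / (30 b^2) = [DL h], and c / 360 becomes
    36 c / (360 b^2) = [DC h]. *)
Definition DL h : K := (12 + 45 * hb h ^+ 2) / 5.
Definition DC h : K := (4 + 15 * hb h ^+ 2) * (1 + 12 * hb h ^+ 2) / 10.
Definition WW_rhs h (m n : int) : lend V := locked (
  (36 * (m - n)%:~R) *: freeLambda h (m + n)
  + (DL h * ((m - n) * (2 * m ^+ 2 - m * n + 2 * n ^+ 2 - 8))%:~R) *: freeL h (m + n)
  + (DC h * ((m ^+ 2 - 4) * (m ^+ 2 - 1) * m)%:~R * (m + n == 0)%:R) *: (1 : lend V)).
Lemma WW_rhsE h m n : WW_rhs h m n = (36 * (m - n)%:~R) *: freeLambda h (m + n)
  + (DL h * ((m - n) * (2 * m ^+ 2 - m * n + 2 * n ^+ 2 - 8))%:~R) *: freeL h (m + n)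
  + (DC h * ((m ^+ 2 - 4) * (m ^+ 2 - 1) * m)%:~R * (m + n == 0)%:R) *: (1 : lend V).
Proof. by rewrite /WW_rhs -lock. Qed.

Lemma WW_rhs_swap h m n : WW_rhs (swap h) m n = WW_rhs h m n.
Proof. by rewrite !WW_rhsE freeLambda_swap freeL_swap /DL /DC /= sqrrN. Qed.

Lemma homog_WW_rhs h m n : homog h (m + n) (WW_rhs h m n).
Proof.
rewrite WW_rhsE; apply: homog_D; first apply: homog_D.
- exact/homog_Z/homog_freeLambda.
- exact/homog_Z/homog_freeL.
by rewrite -scalerA; apply/homog_Z/homog_dlt.
Qed.

(** Its vanishing is proved first for its commutators with two modes, then with one. *)
Definition defect h m n : lend V := \[freeW h m, freeW h n\] - WW_rhs h m n.

Lemma comm_dbl A B X Y : \[\[\[A, B\], X\], Y\] =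
  \[A, \[\[B, X\], Y\]\] - \[\[B, X\], \[A, Y\]\]
  - (\[B, \[\[A, X\], Y\]\] - \[\[A, X\], \[B, Y\]\]).
Proof. by rewrite (comm_jacobi A B) commDl commNl !comm_jacobi. Qed.

Lemma sqy_sqy h m n : \[sq (hy h) m, sq (hy h) n\] = 0.
Proof. exact: sq_sq (hy_field h) (hyy h) _ _. Qed.
Lemma y_sqy h m n : \[hy h m, sq (hy h) n\] = 0.
Proof. by rewrite commC sqy_y oppr0. Qed.
Lemma x_sqx h m n : \[hx h m, sq (hx h) n\] = 0.
Proof. by rewrite commC sqx_x oppr0. Qed.
Lemma y_sqx h m n : \[hy h m, sq (hx h) n\] = (2 * m%:~R) *: hx h (n + m).
Proof. by rewrite commC sqx_y; lincomb K; ring. Qed.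
Lemma ev_sqy_sqx h (s t : int) : s + t = 0 -> ev h \[sq (hy h) s, sq (hx h) t\] =
  (s * (s ^+ 2 - 1))%:~R / 3 + 4 * s%:~R * hp h * hq h.
Proof.
move=> st; have -> : t = - s by lia.
by rewrite -mulrA [hp h * _]mulrC mulrA; apply: (ev_sqx_sqy (swap h)).
Qed.
Lemma x_sqy h m n : \[hx h m, sq (hy h) n\] = (2 * m%:~R) *: hy h (n + m).
Proof. by rewrite commC sqy_x; lincomb K; ring. Qed.

(** A mode of [hx] removes a factor [hy], so that two of them leave only squares and
    single modes, whose coefficients are compared directly. *)
Lemma defect_xx h m n k l : \[\[defect h m n, hx h k\], hx h l\] = 0.
Proof.
rewrite /defect 2!commDl 2!commNl comm_dbl WW_rhsE !commDl !commZl freeL_xx freeLambda_xx comm1l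
  comm0l.
rewrite !(freeW_x, freeW_y, sqy_x, sqy_y, x_sqy, y_sqy, sqy_sqy, comm_lin, hxx, hyy, hyx, hxy).
zmerge (sq (hx h)); zmerge (hx h); zmerge (hy h); zmerge_eq.
lincomb K; try ring.
have [e|e] := eqVneq (m + n + k + l) 0; zdecide; last by ring.
have -> : l = - (m + n + k) by lia.
by ring.
Qed.

Lemma defect_swap h m n : defect (swap h) m n = defect h m n.
Proof. by rewrite /defect !freeW_swap WW_rhs_swap. Qed.

Lemma defect_yy h m n k l : \[\[defect h m n, hy h k\], hy h l\] = 0.
Proof. by rewrite -defect_swap; apply: (defect_xx (swap h)). Qed.

Lemma homog_defect h m n : homog h (m + n) (defect h m n).
Proof.
apply: homog_D (homog_N (homog_WW_rhs _ _ _)).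
exact: homog_comm (homog_freeW _ _) (homog_freeW _ _) erefl.
Qed.

(** Normal ordered quadratics occur here, but need not be computed: by the Jacobi
    identity the commutator of this operator with any mode involves [defect_xx] or
    [defect_yy], so only its expectation remains. *)
Lemma defect_xy h m n k l : \[\[defect h m n, hx h k\], hy h l\] = 0.
Proof.
apply: (schur_eq (h := h)) => [r|r|].
- by rewrite -comm_swap_xy defect_xx !comm0l.
- by rewrite (comm_swap_xy h _ k l) (comm_swap_xy h _ k r) defect_yy !comm0l.
rewrite ev0; have [e|e] := eqVneq (m + n + k + l) 0; last first.
  apply: ev_homog e; apply: homog_comm (homog_y _ _) erefl.
  exact: homog_comm (homog_defect _ _ _) (homog_x _ _) erefl.
rewrite /defect 2!commDl 2!commNl comm_dbl WW_rhsE !commDl !commZl comm1l comm0l freeL_x.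
have mnE : m + n = - (k + l) by lia.
rewrite [in freeLambda _ _]mnE !evE ev_freeLambda_xy.
rewrite !(freeW_x, freeW_y, sqx_y, sqy_x, sqy_y, x_sqy, y_sqy, y_sqx, x_sqx, sqy_sqy, comm_lin,
  hxx, hyy, hyx, hxy).
rewrite !evE !ev_sqy_sqx; [|lia..].
rewrite !ev_x !ev_y.
zdecide; rewrite /DL.
have -> : l = - (m + n + k) by lia.
by field.
Qed.

Lemma ev_defect_x h m n k : ev h \[defect h m n, hx h k\] = 0.
Proof.
have [e|e] := eqVneq (m + n + k) 0; last first.
  by apply: ev_homog e; apply: homog_comm (homog_defect _ _ _) (homog_x _ _) erefl.
have mnE : m + n = - k by lia.
rewrite /defect commDl commNl comm_jacobi WW_rhsE !commDl !commZl comm1l.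
rewrite {1}mnE !evE ev_freeLambda_x !freeW_x freeL_x !comm_lin !evE.
have -> : n + k = - m by lia.
have -> : m + k = - n by lia.
rewrite !ev_freeW_sqy !freeW_x !freeW_y !evE !ev_sqx !ev_sqy !ev_x !ev_y; zdecide.
rewrite /Sy /DL; have -> : k = - (m + n) by lia.
by field.
Qed.

Lemma defect_x h m n k : \[defect h m n, hx h k\] = 0.
Proof.
apply: (schur_eq (h := h)) => [l|l|].
- by rewrite defect_xx comm0l.
- by rewrite defect_xy comm0l.
- by rewrite ev_defect_x ev0.
Qed.

Lemma defect_y h m n k : \[defect h m n, hy h k\] = 0.
Proof. by rewrite -defect_swap; apply: (defect_x (swap h)). Qed.

Lemma ev_defect h m n : ev h (defect h m n) = 0.
Proof.
have [e|e] := eqVneq (m + n) 0; last exact: ev_homog (homog_defect h m n) e.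
have -> : n = - m by lia.
rewrite /defect (freeWE h (- m)) !comm_lin !evE ev_freeW_cubex ev_freeW_cubey ev_freeW_sqx
  ev_freeW_sqy ev_freeW_nquad.
rewrite !freeW_x !freeW_y WW_rhsE subrr !evE ev_freeLambda0 ev_freeL !ev_sqx !ev_sqy !ev_x !ev_y;
  zdecide.
rewrite /Cy /Sy /Gx /DL /DC /=.
by field.
Qed.

Theorem freeW_freeW h m n : \[freeW h m, freeW h n\] = WW_rhs h m n.
Proof.
apply/subr0_eq/(schur_eq (h := h)) => [k|k|].
- by rewrite defect_x comm0l.
- by rewrite defect_y comm0l.
- by rewrite ev_defect ev0.
Qed.
End WW.

(** * The vacuum as a lowest weight vector *)

Section VacuumVector.
Variables (K : numFieldType) (V : lmodType K).
Implicit Types (h : heisenberg V).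

Lemma nquad_vac h f n : 0 <= n ->
  lend_fun (nquad h f n) (vac h) = ((n == 0)%:R * f 0 * hp h * hq h) *: vac h.
Proof.
move=> n0; rewrite nquadE opsumE; last exact: nquad_lfin.
rewrite (@zsum1 _ _ 0) => [|i i0].
  rewrite subr0 lendE /nord lexx lendE; have [->|e] := eqVneq n 0.
    by rewrite hy0 hx0 !lendE !scalerA mul1r.
  by rewrite hy_vac ?linear0 ?scaler0 ?mul0r ?scale0r //; lia.
rewrite lendE /nord; case: lerP => le0; rewrite lendE.
  by rewrite hy_vac ?linear0 ?scaler0 //; lia.
by rewrite hx_vac ?linear0 ?scaler0.
Qed.

Lemma cubex_vac h n : 0 <= n ->
  lend_fun (cube (hx h) n) (vac h) = ((n == 0)%:R * hp h ^+ 3) *: vac h.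
Proof.
move=> n0; rewrite cubeE opsumE; last exact: cube_lfin (hx_field h) (hxx h) n.
rewrite (@zsum1 _ _ 0) => [|i i0].
  rewrite subr0 hx0 !lendE sqx_vac // scalerA; congr (_ *: _).
  by rewrite mulrCA -exprS.
have [l|l] := ltrP 0 i.
  by rewrite -(comm_mulC (sqx_x h _ _)) lendE hx_vac ?linear0.
rewrite lendE sqx_vac; last by lia.
by rewrite (_ : (n - i == 0) = false) ?mul0r ?scale0r ?linear0 //; lia.
Qed.

Lemma freeL_vac h n : 0 <= n ->
  lend_fun (freeL h n) (vac h) = ((n == 0)%:R * (hp h * hq h + hb h ^+ 2)) *: vac h.
Proof.
move=> n0; rewrite freeLE !lendE nquad_vac //; have [->|e] := eqVneq n 0.
  by rewrite mulr0z mulr0 scale0r addr0 -scalerDl; congr (_ *: _); rewrite /=; ring.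
rewrite hx_vac ?hy_vac; [|lia..].
by rewrite subrr scaler0 !mul0r mulr0 scale0r !addr0.
Qed.

Lemma freeW_vac h n : 0 <= n ->
  lend_fun (freeW h n) (vac h) = ((n == 0)%:R * 2 * (hp h ^+ 3 + hq h ^+ 3)) *: vac h.
Proof.
move=> n0; rewrite freeWE !lendE nquad_vac // cubex_vac // (cubex_vac (swap h) n0) sqx_vac //.
rewrite (sqx_vac (swap h) n0) /=; have [->|e] := eqVneq n 0.
  rewrite mulr0z /asymf mulr0 subr0 mulr0z expr0n /= !mulr0 !scale0r subr0.
  by rewrite !mul0r scale0r scaler0 !addr0 -scalerDl scalerA; congr (_ *: _); rewrite /=; ring.
rewrite hx_vac ?hy_vac; [|lia..].
by rewrite !mul0r !scale0r !(subrr, addr0, scaler0).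
Qed.

Lemma freeW_field h : efield (freeW h).
Proof.
move=> v; have [N xN] := hx_field h v; have [M yM] := hy_field h v.
have [P QP] := cube_field (hx_field h) (hxx h) v.
have [P' QP'] := cube_field (hy_field h) (hyy h) v.
have [S SP] := sq_field (hx_field h) (hxx h) v.
have [S' SP'] := sq_field (hy_field h) (hyy h) v.
have [T QT] := nquad_vanish h v.
exists (N + M + P + P' + S + S' + T)%N => k ltk; rewrite freeWE !lendE.
rewrite QP ?QP' ?SP ?SP' ?QT ?xN ?yM; [|lia..].
by rewrite !(subrr, addr0, scaler0).
Qed.
End VacuumVector.

(** * The Fock space *)

(** The basis states. Infinite support is allowed, which spares proofs of finiteness
    inside the states; [fock] excludes it. *)
Definition occ := nat -> nat.
HB.instance Definition _ := Choice.on occ.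
Definition inc (i : nat) (f : occ) : occ := fun j => (f j + (j == i))%N.
Definition dec (i : nat) (f : occ) : occ := fun j => (f j - (j == i))%N.

Lemma incK i : cancel (inc i) (dec i).
Proof. by move=> f; apply/funext => j; rewrite /inc /dec addnK. Qed.
Lemma decK i f : (0 < f i)%N -> inc i (dec i f) = f.
Proof.
by move=> fi; apply/funext => j; rewrite /inc /dec; case: eqVneq => [->|_];
  rewrite ?subnK ?subn0 ?addn0.
Qed.
Lemma inc_dec i j f : i != j -> dec j (inc i f) = inc i (dec j f).
Proof.
move=> ij; apply/funext => k; rewrite /inc /dec.
by case: (eqVneq k i) => [->|_]; rewrite ?(negPf ij) ?subn0 ?addn0.
Qed.
Lemma incC i j f : inc i (inc j f) = inc j (inc i f).
Proof. by apply/funext => k; rewrite /inc addnAC. Qed.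
Lemma decC i j f : dec i (dec j f) = dec j (dec i f).
Proof. by apply/funext => k; rewrite /dec subnAC. Qed.
Lemma inc_ii i f : inc i f i = (f i).+1.
Proof. by rewrite /inc eqxx addn1. Qed.
Lemma inc_ne i j f : j != i -> inc i f j = f j.
Proof. by rewrite /inc => /negPf ->; rewrite addn0. Qed.
Lemma dec_ne i j f : j != i -> dec i f j = f j.
Proof. by rewrite /dec => /negPf ->; rewrite subn0. Qed.
Lemma dec_ii i f : dec i f i = (f i).-1.
Proof. by rewrite /dec eqxx subn1. Qed.

Definition bounded_occ (N : nat) : set occ := [set f | forall j, (f j <= N * (j < N))%N].

Lemma bounded_occ_finite N : finite_set (bounded_occ N).
Proof.
pose ext (g : {ffun 'I_N -> 'I_N.+1}) : occ :=
  fun j => if insub j is Some i then g i : nat else 0%N.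
apply: (@sub_finite_set _ _ (ext @` [set: {ffun 'I_N -> 'I_N.+1}])); last first.
  exact/finite_image/finite_finset.
move=> f fN; exists [ffun i : 'I_N => inord (f i)] => //; apply/funext => j.
rewrite /ext; case: insubP => [i _ <-|]; last first.
  by move=> /negPf jN; have := fN j; rewrite jN muln0 leqn0 => /eqP.
by rewrite ffunE inordK // ltnS; have := fN i; rewrite ltn_ord muln1.
Qed.

Section Occupation.
Variable C : numClosedFieldType.
Local Notation U := (occ -> C^o).
Implicit Types (u v : U) (f : occ).

Definition sq_nat (n : nat) : C := sqrtC n%:R.
Lemma sq_natM n : sq_nat n * sq_nat n = n%:R.
Proof. by rewrite -expr2 sqrtCK. Qed.
Lemma sq_nat0 : sq_nat 0 = 0.
Proof. by rewrite /sq_nat sqrtC0. Qed.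
Lemma sq_nat_neq0 n : sq_nat n.+1 != 0.
Proof. by rewrite sqrtC_eq0 pnatr_eq0. Qed.
Lemma sq_nat_conj n : (sq_nat n)^* = sq_nat n.
Proof. by apply: geC0_conj; rewrite sqrtC_ge0 ler0n. Qed.

(** Matrix elements in the orthonormal number basis. Where [f i = 0], the truncation in
    [dec] does no harm because the square root vanishes. *)
Definition raise (i : nat) u : U := fun f => sq_nat (f i) * u (dec i f).
Definition lower (i : nat) u : U := fun f => sq_nat (f i).+1 * u (inc i f).

Lemma raise_linear i : linear (raise i).
Proof.
by move=> a u v; apply/funext => f; rewrite /raise !fctE mulrDr [in RHS]/GRing.scale /= mulrCA.
Qed.
Lemma lower_linear i : linear (lower i).
Proof.
by move=> a u v; apply/funext => f; rewrite /lower !fctE mulrDr [in RHS]/GRing.scale /= mulrCA.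
Qed.

Lemma raise_raise i j u : raise i (raise j u) = raise j (raise i u).
Proof.
have [->//|ij] := eqVneq i j; apply/funext => f; rewrite /raise.
by rewrite !dec_ne // 1?eq_sym // decC mulrCA.
Qed.
Lemma lower_lower i j u : lower i (lower j u) = lower j (lower i u).
Proof.
have [->//|ij] := eqVneq i j; apply/funext => f; rewrite /lower.
by rewrite !inc_ne // 1?eq_sym // incC mulrCA.
Qed.
Lemma lower_raise i j u : lower i (raise j u) = raise j (lower i u) + (i == j)%:R *: u.
Proof.
apply/funext => f; rewrite !fctE /lower /raise.
have [->|ij] := eqVneq i j.
  rewrite inc_ii incK mulrA sq_natM scale1r.
  case fj: (f j) => [|n]; first by rewrite sq_nat0 mul0r add0r mul1r.
  by rewrite dec_ii fj /= decK ?fj // !mulrA sq_natM -natr1 mulrDl mul1r.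
by rewrite scale0r addr0 inc_ne 1?eq_sym // dec_ne // inc_dec // mulrCA.
Qed.

Definition vacf : U := fun f => `[< f = fun=> 0%N >]%:R.

Lemma lower_vacf i : lower i vacf = 0.
Proof.
apply/funext => f; rewrite /lower /vacf asboolF ?mulr0 //.
by move=> /(congr1 (@^~ i)); rewrite inc_ii.
Qed.

(** Inductive, for the sake of the induction on states in [fock_schur]. *)
Inductive fock : U -> Prop :=
| fock_vac : fock vacf
| fock_lin a u v : fock u -> fock v -> fock (a *: u + v)
| fock_raise i u : fock u -> fock (raise i u).

Lemma fock0 : fock 0.
Proof. by have := fock_lin (-1) fock_vac fock_vac; rewrite scaleN1r addNr. Qed.

Lemma fock_lower i u : fock u -> fock (lower i u).
Proof.
elim=> {u} [|a u v _ Hu _ Hv|j u uf Hu].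
- by rewrite lower_vacf; apply: fock0.
- by rewrite lower_linear; apply: fock_lin.
by rewrite lower_raise addrC; apply: fock_lin => //; apply: fock_raise.
Qed.

Definition supp (N : nat) u := forall f, u f != 0 -> bounded_occ N f.

Lemma bounded_occ_le N M : (N <= M)%N -> bounded_occ N `<=` bounded_occ M.
Proof.
move=> leNM f fN j; apply: leq_trans (fN j) _.
by case: (ltnP j N) => [lt|_]; rewrite ?muln0 // (leq_trans lt leNM) !muln1.
Qed.

Lemma supp_le N M u : (N <= M)%N -> supp N u -> supp M u.
Proof. by move=> /bounded_occ_le NM uN f /uN /NM. Qed.

Lemma fock_supp u : fock u -> exists N, supp N u.
Proof.
elim=> {u} [|a u v _ [N uN] _ [M vM]|i u _ [N uN]].
- exists 0%N => f; rewrite /vacf; case: asboolP => [-> _ j //|_]; by rewrite eqxx.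
- exists (maxn N M) => f; have [uf|uf] := eqVneq (u f) 0.
    rewrite !fctE uf scaler0 add0r => /vM; apply: bounded_occ_le; exact: leq_maxr.
  by move=> _; apply: (bounded_occ_le (leq_maxl N M)); apply: uN.
exists (N + i).+1 => f; rewrite /raise mulf_eq0 negb_or => /andP[fi /uN fN] j.
have := fN j; rewrite /dec; case: eqVneq => [->|_].
  have -> : (i < (N + i).+1)%N by lia.
  by case: (i < N)%N; lia.
by rewrite subn0; case: ltnP => l1; case: ltnP => l2; lia.
Qed.

Definition fock_pred : {pred U} := fun u => `[< fock u >].
Lemma fock_submod : submod_closed fock_pred.
Proof.
split; first exact/asboolP/fock0.
by move=> a u v /asboolP Fu /asboolP Fv; apply/asboolP/fock_lin.
Qed.
HB.instance Definition _ := GRing.isSubmodClosed.Build C U fock_pred fock_submod.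

Record fock_space := FockSpace { fock_val : U; _ : fock_val \in fock_pred }.
HB.instance Definition _ := [isSub of fock_space for fock_val].
HB.instance Definition _ := [Choice of fock_space by <:].
HB.instance Definition _ := [SubChoice_isSubLmodule of fock_space by <:].
Local Notation F := fock_space.

Lemma fock_valP (v : F) : fock (fock_val v).
Proof. by case: v => u /= /asboolP. Qed.

Lemma fock_val_lin a (u v : F) f :
  fock_val (a *: u + v) f = a * fock_val u f + fock_val v f.
Proof. by []. Qed.

Lemma fock_eq (u v : F) : (forall f, fock_val u f = fock_val v f) -> u = v.
Proof. by move=> uv; apply/val_inj/funext. Qed.

Definition vacF : F := FockSpace (introT (asboolP _) fock_vac).

Definition raise_fun i (v : F) : F :=
  FockSpace (introT (asboolP _) (fock_raise i (fock_valP v))).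
Definition lower_fun i (v : F) : F :=
  FockSpace (introT (asboolP _) (fock_lower i (fock_valP v))).

Fact raise_key i : raise_fun i \in linear_pred (V := F).
Proof. by apply/asboolP => a u v; apply: val_inj; apply: raise_linear. Qed.
Fact lower_key i : lower_fun i \in linear_pred (V := F).
Proof. by apply/asboolP => a u v; apply: val_inj; apply: lower_linear. Qed.
Definition raiseF i : lend F := Lend (raise_key i).
Definition lowerF i : lend F := Lend (lower_key i).

Lemma comm_raise i j : \[raiseF i, raiseF j\] = 0.
Proof.
rewrite commE; apply: lendP => v; rewrite !lendE; apply/eqP; rewrite subr_eq0; apply/eqP.
by apply: val_inj; apply: raise_raise.
Qed.
Lemma comm_lower i j : \[lowerF i, lowerF j\] = 0.
Proof.
rewrite commE; apply: lendP => v; rewrite !lendE; apply/eqP; rewrite subr_eq0; apply/eqP.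
by apply: val_inj; apply: lower_lower.
Qed.
Lemma comm_lower_raise i j : \[lowerF i, raiseF j\] = (i == j)%:R *: (1 : lend F).
Proof.
rewrite commE; apply: lendP => v; rewrite !lendE; apply/eqP; rewrite subr_eq addrC; apply/eqP.
by apply: val_inj; apply: lower_raise.
Qed.

(** The modes of positive index of the two currents take turns: even numbers for one,
    odd numbers for the other. *)
Definition mode (b : bool) (k : nat) : nat := (b + k.-1.*2)%N.

Lemma mode_eq b b' k k' : (0 < k)%N -> (0 < k')%N ->
  (mode b k == mode b' k') = (b == b') && (k == k').
Proof. by rewrite /mode; case: b; case: b' => /=; lia. Qed.

Variables (z : bool -> C).

(** Each current raises its own oscillators and lowers those of the other one; this is
    why the two currents pair with each other and commute with themselves. The square
    roots turn the canonical relations into those of a Heisenberg algebra. *)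
Definition osc (b : bool) (n : int) : lend F :=
  if (0 < n)%R then sq_nat `|n| *: lowerF (mode (~~ b) `|n|)
  else if (n < 0)%R then sq_nat `|n| *: raiseF (mode b `|n|)
  else z b *: (1 : lend F).

Lemma osc_comm b b' m n :
  \[osc b m, osc b' n\] = (m%:~R * (m + n == 0)%:R * (b != b')%:R) *: (1 : lend F).
Proof.
rewrite /osc; case: (ltrgt0P m) => m0; case: (ltrgt0P n) => n0;
  rewrite ?commZl ?commZr ?comm_raise ?comm_lower ?comm1l ?comm1r ?scaler0 //.
all: try by rewrite (_ : (m + n == 0) = false) ?mulr0 ?mul0r ?scale0r //; lia.
- rewrite comm_lower_raise mode_eq; [|lia|lia]; rewrite !scalerA; congr (_ *: _).
  have [e|e] := eqVneq (m + n) 0; last first.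
    rewrite (_ : (`|m| == `|n|)%N = false) ?andbF ?mulr0 ?mul0r //; lia.
  have -> : absz n = absz m by lia.
  rewrite eqxx andbT mulr1 sq_natM; congr (_ * _).
    by rewrite -[in RHS](gtz0_abs m0).
  by case: (b); case: (b').
- rewrite commC comm_lower_raise mode_eq; [|lia|lia]; rewrite -scaleNr !scalerA.
  congr (_ *: _); have [e|e] := eqVneq (m + n) 0; last first.
    rewrite (_ : (`|n| == `|m|)%N = false) ?andbF ?oppr0 ?mulr0 ?mul0r //; lia.
  have -> : absz n = absz m by lia.
  rewrite eqxx andbT mulr1 sq_natM mulrN -mulNr; congr (_ * _).
    by rewrite -[in RHS](opprK m) -(ltz0_abs m0) rmorphN.
  by case: (b); case: (b').
by rewrite m0 !mul0r scale0r.
Qed.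

Lemma osc_field b (v : F) : exists N : nat, forall k : int, N%:Z <= k -> lend_fun (osc b k) v = 0.
Proof.
have [N vN] := fock_supp (fock_valP v); exists N.+1 => k leNk.
rewrite /osc (_ : (0 < k)%R = true); last by lia.
rewrite lendE; suff -> : lend_fun (lowerF (mode (~~ b) `|k|)) v = 0 by rewrite scaler0.
apply: fock_eq => f; rewrite /= /lower;
  have [->|/vN] := eqVneq (fock_val v (inc (mode (~~ b) `|k|) f)) 0.
  by rewrite mulr0.
move=> /(_ (mode (~~ b) `|k|)); rewrite inc_ii (_ : (mode _ _ < N)%N = false) ?muln0 //.
by rewrite /mode; lia.
Qed.

Lemma lowerF_vac i : lend_fun (lowerF i) vacF = 0.
Proof. by apply: val_inj; apply: lower_vacf. Qed.

Lemma osc_vac b (n : int) : (0 < n)%R -> lend_fun (osc b n) vacF = 0.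
Proof. by move=> n0; rewrite /osc n0 lendE lowerF_vac scaler0. Qed.

Lemma osc0 b : osc b 0 = z b *: (1 : lend F).
Proof. by []. Qed.

Definition fock_vev (v : F) : C := fock_val v (fun=> 0%N).
Lemma fock_vev_linear : scalar fock_vev.
Proof. by []. Qed.
HB.instance Definition _ := GRing.isLinear.Build C F C *%R fock_vev fock_vev_linear.

Lemma fock_vev_osc b (n : int) (v : F) : (n < 0)%R -> fock_vev (lend_fun (osc b n) v) = 0.
Proof.
move=> n0; rewrite /osc ltNge ltW //= n0 lendE linearZ /=.
by rewrite /raise sq_nat0 mul0r mulr0.
Qed.

Lemma fock_vev_vac : fock_vev vacF = 1.
Proof. by rewrite /fock_vev /= /vacf asboolT. Qed.

Lemma mode_surj i : mode (odd i) i./2.+1 = i.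
Proof. by rewrite /mode /= odd_double_half. Qed.

(** The image of the vacuum is annihilated by all lowering operators, hence a multiple of
    the vacuum; the operator acts by the same scalar on all the states raised from it. *)
Lemma fock_schur (A : lend F) : (forall b k, \[A, osc b k\] = 0) ->
  A = fock_vev (lend_fun A vacF) *: (1 : lend F).
Proof.
move=> AO.
have AR i : \[A, raiseF i\] = 0.
  have := AO (odd i) (- (i./2.+1)%:Z); rewrite /osc commZr /= mode_surj.
  by move=> /eqP; rewrite scaler_eq0 (negPf (sq_nat_neq0 _)) => /eqP.
have AL i : \[A, lowerF i\] = 0.
  have := AO (~~ odd i) (i./2.+1)%:Z; rewrite /osc commZr /= negbK mode_surj.
  by move=> /eqP; rewrite scaler_eq0 (negPf (sq_nat_neq0 _)) => /eqP.
set c := fock_vev _.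
have Avac : lend_fun A vacF = c *: vacF.
  apply: fock_eq => f; have -> : fock_val (c *: vacF) f = c * vacf f by [].
  have [->|f0] := eqVneq f (fun=> 0%N); rewrite /vacf.
    by rewrite asboolT // mulr1.
  rewrite asboolF ?mulr0; last exact/eqP.
  have [i fi] : exists i, (0 < f i)%N.
    apply: contrapT => /forallNP fn; move/eqP: f0; apply; apply/funext => i.
    by apply/eqP; rewrite -leqn0 leqNgt; apply/negP/fn.
  have : lend_fun (lowerF i) (lend_fun A vacF) = 0.
    have := congr1 (fun B => lend_fun B vacF) (AL i); rewrite commE !lendE lowerF_vac linear0 sub0r.
    by move=> /eqP; rewrite oppr_eq0 => /eqP.
  move=> /(congr1 (fun v : F => fock_val v (dec i f))); rewrite /= /lower decK // => /eqP.
  by rewrite mulf_eq0 (negPf (sq_nat_neq0 _)) => /eqP.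
apply: lendP => -[u uF]; rewrite !lendE.
have /asboolP uf := uF; elim: {u} uf uF => [|a u v uf IHu vf IHv|i u uf IHu] uF.
- have -> : FockSpace uF = vacF by apply: val_inj.
  exact: Avac.
- pose u' : F := FockSpace (introT (asboolP _) uf);
  pose v' : F := FockSpace (introT (asboolP _) vf).
  have -> : FockSpace uF = a *: u' + v' by apply: val_inj.
  have Eu : lend_fun A u' = c *: u' := IHu _.
  have Ev : lend_fun A v' = c *: v' := IHv _.
  by rewrite lend_linear Eu Ev scalerDr !scalerA mulrC.
- pose u' : F := FockSpace (introT (asboolP _) uf).
  have -> : FockSpace uF = lend_fun (raiseF i) u' by apply: val_inj.
  have Eu : lend_fun A u' = c *: u' := IHu _.
  by rewrite -lendM (comm_mulC (AR i)) lendE Eu linearZ.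
Qed.

(** * The inner product of the Fock space *)

Definition ip (u v : U) : C := \sum_(f \in [set: occ]) u f * (v f)^*.

Lemma ipE N u v : supp N u -> ip u v = \sum_(f <- fset_set (bounded_occ N)) u f * (v f)^*.
Proof.
move=> uN; rewrite /ip -fsbig_finite; last exact: bounded_occ_finite.
apply/esym/fsbig_widen => // f [_ nf]; rewrite /preimage /=.
by have [->|/uN //] := eqVneq (u f) 0; rewrite mul0r.
Qed.

Lemma ip_conj u v N : supp N u -> supp N v -> ip u v = (ip v u)^*.
Proof.
move=> uN vN; rewrite (ipE _ uN) (ipE _ vN) rmorph_sum; apply: eq_bigr => f _.
by rewrite /= rmorphM /= conjCK mulrC.
Qed.

(** Reindexing by [inc i], which misses only states where the square root vanishes. *)
Lemma ip_raise i u v : ip (raise i u) v = ip u (lower i v).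
Proof.
rewrite /ip /raise /lower.
transitivity (\sum_(f \in [set f : occ | (0 < f i)%N]) sq_nat (f i) * u (dec i f) * (v f)^*).
  apply/esym/fsbig_widen => // f [_ /= /negP]; rewrite -leqNgt leqn0 => /eqP fi.
  by rewrite /preimage /= fi sq_nat0 !mul0r.
rewrite (reindex_fsbig (inc i) [set: occ]).
  by apply: eq_fsbigr => f _; rewrite inc_ii incK rmorphM /= sq_nat_conj mulrCA mulrA.
split.
- by move=> f _ /=; rewrite inc_ii.
- by move=> f g _ _ /(congr1 (dec i)); rewrite !incK.
- by move=> f /= fi; exists (dec i f) => //; rewrite decK.
Qed.

Definition fock_form (u v : F) : C := ip (fock_val u) (fock_val v).

Lemma fock_form_lin a (u u' v : F) : fock_form (a *: u + u') v = a * fock_form u v + fock_form u' v.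
Proof.
have [N uN] := fock_supp (fock_valP u); have [M u'M] := fock_supp (fock_valP u').
have uL := supp_le (leq_maxl N M) uN; have u'L := supp_le (leq_maxr N M) u'M.
have sL : supp (maxn N M) (fock_val (a *: u + u')).
  move=> f; rewrite fock_val_lin; have [->|/uL //] := eqVneq (fock_val u f) 0.
  by rewrite mulr0 add0r; apply: u'L.
rewrite /fock_form (ipE _ uL) (ipE _ u'L) (ipE _ sL) big_distrr -big_split.
by apply: eq_bigr => f _; rewrite fock_val_lin mulrDl /= mulrA.
Qed.

Lemma fock_form_conj (u v : F) : fock_form u v = (fock_form v u)^*.
Proof.
have [N uN] := fock_supp (fock_valP u); have [M vM] := fock_supp (fock_valP v).
exact: ip_conj (supp_le (leq_maxl N M) uN) (supp_le (leq_maxr N M) vM).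
Qed.

Lemma fock_form_bilinear : bilinear_for *%R (Num.conj \; *%R) fock_form.
Proof.
split=> [v a u u'|u a v v']; first exact: fock_form_lin.
by rewrite fock_form_conj fock_form_lin rmorphD rmorphM /= -!fock_form_conj.
Qed.
HB.instance Definition _ := bilinear_isBilinear.Build C F F C *%R (Num.conj \; *%R)
  fock_form fock_form_bilinear.

Lemma fock_form_hermitian (u v : F) : fock_form u v = (-1) ^+ false * (fock_form v u)^*.
Proof. by rewrite expr0 mul1r; apply: fock_form_conj. Qed.
HB.instance Definition _ :=
  isHermitianSesquilinear.Build C F false Num.conj fock_form fock_form_hermitian.

Lemma fock_form_gt0 (u : F) : u != 0 -> 0 < fock_form u u.
Proof.
move=> u0; have [N uN] := fock_supp (fock_valP u); rewrite /fock_form (ipE _ uN).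
have ge0 f : 0 <= fock_val u f * (fock_val u f)^* by apply: mul_conjC_ge0.
rewrite lt0r sumr_ge0 // andbT psumr_eq0 //; apply: contra u0 => /allP all0.
apply/eqP/fock_eq => f; apply/eqP; have [//|uf] := boolP (fock_val u f == 0).
have := all0 f; rewrite in_fset_set; last exact: bounded_occ_finite.
by rewrite mem_set; [move=> /(_ isT); rewrite mul_conjC_eq0 (negPf uf) | apply: uN].
Qed.
HB.instance Definition _ := isDotProduct.Build C F fock_form fock_form_gt0.

Definition adjoint (A B : lend F) : Prop :=
  forall u v : F, fock_form (lend_fun A u) v = fock_form u (lend_fun B v).

Lemma adjointC A B : adjoint A B -> adjoint B A.
Proof. by move=> AB u v; rewrite fock_form_conj -AB -fock_form_conj. Qed.
Lemma adjointD A B A' B' : adjoint A A' -> adjoint B B' -> adjoint (A + B) (A' + B').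
Proof. by move=> hA hB u v; rewrite !lendE linearDl linearDr /= hA hB. Qed.
Lemma adjointZ a A A' : adjoint A A' -> adjoint (a *: A) (a^* *: A').
Proof. by move=> hA u v; rewrite !lendE linearZl linearZr /= conjCK hA. Qed.
Lemma adjointN A A' : adjoint A A' -> adjoint (- A) (- A').
Proof. by move=> hA u v; rewrite !lendE linearNl linearNr /= hA. Qed.
Lemma adjointM A B A' B' : adjoint A A' -> adjoint B B' -> adjoint (A * B) (B' * A').
Proof. by move=> hA hB u v; rewrite !lendE hA hB. Qed.
Lemma adjoint1 : adjoint 1 1.
Proof. by []. Qed.
Lemma adjoint_opsum (f g : int -> lend F) : lfin f -> lfin g ->
  (forall i, adjoint (f i) (g i)) -> adjoint (opsum f) (opsum g).
Proof.
move=> ff fg fgi u v; rewrite !opsumE //.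
pose form : {dot F for Num.conj} := fock_form.
have formE (w : F) (k : int -> F) : zfin k -> fock_form w (zsum k) =
  zsum (fun i => fock_form w (k i)).
  exact: (zsum_morph (form w : {additive F -> C})).
rewrite formE // fock_form_conj formE // (zsum_morph (Num.conj : {additive C -> C})).
  by apply: eq_zsum => i /=; rewrite -fock_form_conj fgi.
exact: (zfin_morph (form v : {additive F -> C})).
Qed.

Lemma adjoint_raise i : adjoint (raiseF i) (lowerF i).
Proof. by move=> u v; apply: ip_raise. Qed.

Hypothesis z_conj : z true = (z false)^*.

Lemma adjoint_osc b n : adjoint (osc b n) (osc (~~ b) (- n)).
Proof.
rewrite /osc oppr_gt0 oppr_lt0 abszN negbK; case: (ltrgt0P n) => n0.
- by rewrite -{2}(sq_nat_conj `|n|); apply/adjointZ/adjointC/adjoint_raise.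
- by rewrite -{2}(sq_nat_conj `|n|); apply/adjointZ/adjoint_raise.
have -> : z (~~ b) = (z b)^* by case: (b); rewrite /= z_conj ?conjCK.
exact/adjointZ/adjoint1.
Qed.
End Occupation.

(** * Hermiticity of the free fields *)

Section FockHeisenberg.
Variables (C : numClosedFieldType) (p beta : C).
Hypothesis beta_real : beta^* = beta.
Local Notation F := (fock_space C).

Definition charge (b : bool) : C := if b then p^* else p.

Definition fock_heisenberg : heisenberg F.
Proof.
refine (@Heisenberg C F (osc charge false) (osc charge true) p p^* beta (vacF C) (@fock_vev C)
  _ _ _ _ _ _ _ _ _ _ _ _ _).
- by move=> m n; rewrite osc_comm mulr0 scale0r.
- by move=> m n; rewrite osc_comm mulr0 scale0r.
- by move=> m n; rewrite osc_comm mulr1.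
- exact: osc0.
- exact: osc0.
- exact: osc_field.
- exact: osc_field.
- exact: osc_vac.
- exact: osc_vac.
- exact: fock_vev_osc.
- exact: fock_vev_osc.
- exact: fock_vev_vac.
- by move=> A Ax Ay; apply: (fock_schur (z := charge)) => -[].
Defined.
Local Notation fh := fock_heisenberg.

Lemma adjoint_x n : adjoint (hx fh n) (hy fh (- n)).
Proof. exact: adjoint_osc. Qed.
Lemma adjoint_y n : adjoint (hy fh n) (hx fh (- n)).
Proof. exact: adjoint_osc. Qed.

Lemma adjoint_nord (i j : int) : adjoint (nord fh i j) (nord fh (- j) (- i)).
Proof.
rewrite /nord; case: (lerP i 0) => i0; case: (lerP (- j) 0) => j0.
- exact: adjointM (adjoint_x _) (adjoint_y _).
- have -> : hy fh (- i) * hx fh (- j) = hx fh (- j) * hy fh (- i).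
    by apply/esym/comm_mulC; rewrite hxy (_ : (_ == 0) = false) ?mulr0 ?scale0r //; lia.
  exact: adjointM (adjoint_x _) (adjoint_y _).
- have -> : hx fh (- j) * hy fh (- i) = hy fh (- i) * hx fh (- j).
    by apply/comm_mulC; rewrite hxy (_ : (_ == 0) = false) ?mulr0 ?scale0r //; lia.
  exact: adjointM (adjoint_y _) (adjoint_x _).
exact: adjointM (adjoint_y _) (adjoint_x _).
Qed.

(** Taking adjoints exchanges the currents: [x_i y_{n-i}] becomes [x_{i-n} y_{-i}], hence the
    shift of the weights. *)
Lemma adjoint_nquad f g n : (forall i, (f i)^* = g (i - n)) ->
  adjoint (nquad fh f n) (nquad fh g (- n)).
Proof.
move=> fg; rewrite !nquadE; have lf := nquad_lfin fh g (- n).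
rewrite -(opsum_shift (- n) lf); apply: adjoint_opsum => [||i].
- exact: nquad_lfin.
- exact: (lfin_shift (- n) lf).
rewrite -fg; apply: adjointZ; have := adjoint_nord i (n - i).
by rewrite opprB (_ : - n - (i - n) = - i) //; lia.
Qed.

Lemma adjoint_sqx n : adjoint (sq (hx fh) n) (sq (hy fh) (- n)).
Proof.
have lx := sq_lfin (hx_field fh) (hxx fh) n; have ly := sq_lfin (hy_field fh) (hyy fh) (- n).
rewrite !sqE -(opsum_shift (- n) ly); apply: adjoint_opsum => // [|i].
  exact: (lfin_shift (- n) ly).
have := adjointM (adjoint_x i) (adjoint_x (n - i)).
by rewrite opprB (_ : - n - (i - n) = - i) //; lia.
Qed.

Lemma adjoint_cubex n : adjoint (cube (hx fh) n) (cube (hy fh) (- n)).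
Proof.
have lx := cube_lfin (hx_field fh) (hxx fh) n; have ly := cube_lfin (hy_field fh) (hyy fh) (- n).
rewrite !cubeE -(opsum_refl 0 ly); apply: adjoint_opsum => // [|i].
  exact: (lfin_refl 0 ly).
have := adjointM (adjoint_x i) (adjoint_sqx (n - i)).
rewrite (comm_mulC (sqy_y _ _ _)) sub0r.
by rewrite (_ : - n - - i = - (n - i)) //; lia.
Qed.

Lemma int_conj (n : int) : (n%:~R : C)^* = n%:~R.
Proof. exact: rmorph_int. Qed.

Lemma adjoint_freeL n : adjoint (freeL fh n) (freeL fh (- n)).
Proof.
have -> : freeL fh (- n) = nquad fh (fun=> 1) (- n)
    + (beta * n%:~R)^* *: (hy fh (- n) - hx fh (- n)) + (beta ^+ 2 * (n == 0)%:R)^* *: (1 : lend F).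
  rewrite !rmorphM /= ?rmorphXn /= !beta_real int_conj conjC_nat freeLE.
  by rewrite (_ : (- n == 0) = (n == 0)) /=; [lincomb C; ring | lia].
rewrite freeLE; apply: adjointD; last exact/adjointZ/adjoint1.
apply: adjointD; first by apply: adjoint_nquad => i; rewrite conjC1.
by apply/adjointZ/adjointD; [apply: adjoint_x | apply/adjointN/adjoint_y].
Qed.

Lemma adjoint_freeW n : adjoint (freeW fh n) (freeW fh (- n)).
Proof.
have n3 : (3 : C)^* = 3 by rewrite conjC_nat.
have -> : freeW fh (- n) = (2 : C)^* *: (cube (hy fh) (- n) + cube (hx fh) (- n))
  - (3 * beta * n%:~R)^* *: (sq (hy fh) (- n) - sq (hx fh) (- n))
  + (3 * beta)^* *: nquad fh (asymf C (- n)) (- n)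
  + (3 * beta ^+ 2 * n%:~R ^+ 2)^* *: (hy fh (- n) + hx fh (- n)).
  rewrite freeWE; move: (cube (hx fh) (- n)) (cube (hy fh) (- n)) (sq (hx fh) (- n))
    (sq (hy fh) (- n)) (nquad fh (asymf C (- n)) (- n)) (hx fh (- n)) (hy fh (- n)).
  move=> X3 Y3 X2 Y2 XY X Y; rewrite !rmorphM /= ?rmorphXn /= !beta_real !int_conj n3 conjC_nat.
  by lincomb C; ring.
rewrite freeWE; apply: adjointD; last first.
  by apply/adjointZ/adjointD; [apply: adjoint_x | apply: adjoint_y].
apply: adjointD; last first.
  apply/adjointZ/adjoint_nquad => i; rewrite /asymf int_conj; congr (_%:~R); lia.
apply: adjointD.
  by apply/adjointZ/adjointD; [apply: adjoint_cubex | apply/adjointC; rewrite -{2}(opprK n);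
    apply: adjoint_cubex].
apply/adjointN/adjointZ/adjointD; first exact: adjoint_sqx.
by apply/adjointN/adjointC; rewrite -{2}(opprK n); apply: adjoint_sqx.
Qed.
End FockHeisenberg.

(** * The cyclic subspace of a lowest weight vector *)

Section Generation.
Variables (R : realType) (H : lmodType R[i]) (L W : int -> {linear H -> H}).
Variables (h w : R[i]) (Om : H).

(** The property [submod_closed] of a predicate in [Prop]. *)
Definition lin_closed (S : H -> Prop) := S 0 /\ forall a u v, S u -> S v -> S (a *: u + v).

(* Of the commutators of modes of [W] only this is needed: they belong to every subspace
   that contains the vector and its images under one and two modes of [L]. *)
Hypotheses
  (LL : forall m n v, exists a b, L m (L n v) = L n (L m v) + a *: L (m + n) v + b *: v)
  (LW : forall m n v, exists a, L m (W n v) = W n (L m v) + a *: W (m + n) v)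
  (WW : forall m n v S, lin_closed S -> S v -> (forall k, S (L k v)) ->
    (forall k l, S (L k (L l v))) -> S (W m (W n v) - W n (W m v)))
  (L0L : forall n v, L 0 (L n v) = L n (L 0 v) - n%:~R *: L n v)
  (L0W : forall n v, L 0 (W n v) = W n (L 0 v) - n%:~R *: W n v)
  (Om_lw : lowest_weight_vector h w L W Om).

(** Filtration of the span of the words in lowering modes applied to [Om]; a mode
    of [L] counts 2, one of [W] counts 3, so that the quadratic term [Lambda] of
    a commutator of [W]'s has lower weight than the product. *)
Inductive lvl : nat -> H -> Prop :=
| lvl_vac d : lvl d Om
| lvl_0 d : lvl d 0
| lvl_lin d a u v : lvl d u -> lvl d v -> lvl d (a *: u + v)
| lvl_L d (n : int) u : n < 0 -> lvl d u -> lvl d.+2 (L n u)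
| lvl_W d (n : int) u : n < 0 -> lvl d u -> lvl d.+3 (W n u)
| lvl_S d u : lvl d u -> lvl d.+1 u.

Lemma lvl_le d d' u : (d <= d')%N -> lvl d u -> lvl d' u.
Proof. by move=> /subnK <- lu; elim: (d' - d)%N => [//|k IH]; apply: lvl_S. Qed.

Lemma lvl_Z d a u : lvl d u -> lvl d (a *: u).
Proof. by move=> lu; rewrite -[_ *: _]addr0; apply: lvl_lin lu (lvl_0 _). Qed.
Lemma lvl_D d u v : lvl d u -> lvl d v -> lvl d (u + v).
Proof. by move=> lu lv; rewrite -[u]scale1r; apply: lvl_lin. Qed.
Lemma lvl_closed d : lin_closed (lvl d).
Proof. by split; [apply: lvl_0 | move=> a u v; apply: lvl_lin]. Qed.

(** A mode is moved to the right through a word, until it reaches [Om]; the commutators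
    have lower weight and fall under the induction hypotheses. *)
Lemma lvl_stable d u : lvl d u -> forall n, lvl d.+2 (L n u) /\ lvl d.+3 (W n u).
Proof.
elim/ltn_ind: d u => D IHD u lu.
have {lu} : exists2 d, (d <= D)%N & lvl d u by exists D.
move=> [d dD lu]; suff stab n : lvl d.+2 (L n u) /\ lvl d.+3 (W n u).
  by move=> n; have [HL HW] := stab n; split; [apply: lvl_le HL | apply: lvl_le HW]; lia.
elim: lu dD n => {d u} [d|d|d a u v _ IHu _ IHv|d k u k0 lu IHu|d k u k0 lu IHu|d u lu IHu] dD n.
- have [nlt|ngt|->] := ltrgt0P n.
  + by rewrite (lwv_L Om_lw) ?(lwv_W Om_lw) //; split; apply: lvl_0.
  + by split; [apply: lvl_L | apply: lvl_W] => //; apply: lvl_vac.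
  + by rewrite (lwv_L0 Om_lw) (lwv_W0 Om_lw); split; apply/lvl_Z/lvl_vac.
- by rewrite !linear0; split; apply: lvl_0.
- have [Lu Wu] := IHu dD n; have [Lv Wv] := IHv dD n.
  by rewrite !linearP; split; apply: lvl_lin.
- have [Lu Wu] := IHu ltac:(lia) n; have [Lu' Wu'] := IHu ltac:(lia) (n + k).
  split.
    have [a [b ->]] := LL n k u.
    apply: lvl_D; last by apply: lvl_Z; apply: lvl_le lu; lia.
    by apply: lvl_D; [apply: lvl_L | apply: lvl_Z; apply: lvl_le Lu'; lia].
  have [a E] := LW k n u.
  have -> : W n (L k u) = L k (W n u) + (- a) *: W (n + k) u.
    by rewrite E scaleNr [k + n]addrC addrK.
  apply: lvl_D; last by apply: lvl_Z; apply: lvl_le Wu'; lia.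
  exact: lvl_L.
- have [Lu Wu] := IHu ltac:(lia) n; have [Lu' Wu'] := IHu ltac:(lia) (n + k).
  split.
    have [a ->] := LW n k u.
    by apply: lvl_D; [apply: lvl_W | apply: lvl_Z; apply: lvl_le Wu'; lia].
  have -> : W n (W k u) = W k (W n u) + (W n (W k u) - W k (W n u)) by rewrite addrC subrK.
  apply: lvl_D; first exact: lvl_W.
  apply: WW; first exact: lvl_closed.
  + by apply: lvl_le lu; lia.
  + by move=> r; apply: lvl_le (IHu _ r).1; lia.
  + move=> r s; have [Lsu _] := IHu ltac:(lia) s.
    by apply: lvl_le (IHD _ _ _ Lsu r).1; lia.
- by have [Lu Wu] := IHu ltac:(lia) n; split; apply: lvl_S.
Qed.

Definition generated : set H := smallest (invariant_subspace L W) [set Om].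

Lemma invariant_subspaceP (S : set H) : invariant_subspace L W S <->
  lin_closed S /\ forall n v, S v -> S (L n v) /\ S (W n v).
Proof.
have SE u : (u \in mem S) = `[< S u >] by [].
split=> -[ [S0 SD] SLW]; split=> //; split.
- by apply/asboolP; rewrite -SE.
- move=> a u v /asboolP Su /asboolP Sv; apply/asboolP; rewrite -SE; apply: SD; by rewrite SE.
- by rewrite SE; apply/asboolP.
- move=> a u v; rewrite !SE => /asboolP Su /asboolP Sv; apply/asboolP; exact: SD.
Qed.

Lemma generated_sub (S : set H) : invariant_subspace L W S -> S Om -> generated `<=` S.
Proof. by move=> Sinv SOm; apply: smallest_sub => // _ ->. Qed.

Lemma generated_vac : generated Om.
Proof. by apply: sub_gen_smallest. Qed.

Lemma generated_inv : invariant_subspace L W generated.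
Proof.
apply/invariant_subspaceP; split.
  split=> [S [/invariant_subspaceP[ [S0 _] _] _] //|a u v gu gv S SP].
  have [/invariant_subspaceP[ [_ SD] _] _] := SP.
  by apply: SD; [apply: gu | apply: gv].
move=> n v gv; split=> S SP; have [/invariant_subspaceP[_ SLW] _] := SP;
  by have [] := SLW n v (gv S SP).
Qed.

Lemma generated_lvl u : generated u -> exists d, lvl d u.
Proof.
apply: (@generated_sub [set u | exists d, lvl d u]); last by exists 0%N; apply: lvl_vac.
apply/invariant_subspaceP; split.
  split=> [|a u' v [d lu] [e lv]]; first by exists 0%N; apply: lvl_0.
  by exists (maxn d e); apply: lvl_lin; [apply: lvl_le lu | apply: lvl_le lv]; lia.
move=> n v [d lv]; have [lL lW] := lvl_stable lv n.
by split; [exists d.+2 | exists d.+3].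
Qed.

Inductive excited : H -> Prop :=
| excited_0 : excited 0
| excited_lin a u v : excited u -> excited v -> excited (a *: u + v)
| excited_eig (j : nat) u : L 0 u = (h + j.+1%:R) *: u -> excited u.

Lemma excited_L n u : n < 0 -> excited u -> excited (L n u) /\ excited (W n u).
Proof.
move=> n0; elim=> [|a v v' _ [IHL IHW] _ [IHL' IHW']|j v vj].
- by rewrite !linear0; split; apply: excited_0.
- by rewrite !linearP; split; apply: excited_lin.
have nE : n = - `|n|%N%:Z by lia.
have e : j.+1%:R - n%:~R = (j + `|n|)%N.+1%:R :> R[i].
  by rewrite {1}nE rmorphN opprK /= -addSn natrD.
split; apply: (@excited_eig (j + `|n|)).
  by rewrite L0L vj linearZ -scalerBl -e addrA.
by rewrite L0W vj linearZ -scalerBl -e addrA.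
Qed.

(** Lowering modes raise the energy by a positive integer, so that only the empty word
    contributes a multiple of [Om]. *)
Lemma lvl_excited d u : lvl d u -> exists a g, u = a *: Om + g /\ excited g.
Proof.
elim=> {d u} [d|d|d a u v _ [b [g [-> eg]]] _ [b' [g' [-> eg']]]
  |d n u n0 _ [a [g [-> eg]]]|d n u n0 _ [a [g [-> eg]]]|//].
- by exists 1, 0; rewrite scale1r addr0; split=> //; apply: excited_0.
- by exists 0, 0; rewrite scale0r addr0; split=> //; apply: excited_0.
- exists (a * b + b'), (a *: g + g'); split; last exact: excited_lin.
  by rewrite scalerDr scalerDl scalerA addrACA.
all: have nE : n = - (`|n|.-1).+1%:Z by lia.
all: have e : - n%:~R = (`|n|.-1).+1%:R :> R[i] by rewrite {1}nE rmorphN opprK.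
all: have [eL eW] := excited_L n0 eg; exists 0.
  exists (L n (a *: Om + g)); split; first by rewrite scale0r add0r.
  rewrite linearP; apply: excited_lin eL; apply: (@excited_eig `|n|.-1).
  by rewrite L0L (lwv_L0 Om_lw) linearZ -scalerBl -e.
exists (W n (a *: Om + g)); split; first by rewrite scale0r add0r.
rewrite linearP; apply: excited_lin eW; apply: (@excited_eig `|n|.-1).
by rewrite L0W (lwv_L0 Om_lw) linearZ -scalerBl -e.
Qed.

Lemma generated_decomp u : generated u -> exists a g, u = a *: Om + g /\ excited g.
Proof. by move=> /generated_lvl[d /lvl_excited]. Qed.
End Generation.

(** * Transfer of unitarity between lowest weight representations *)

Lemma pullback_dot (C : numClosedFieldType) (V F : lmodType C) (f : {linear V -> F})
    (form : {dot F for Num.conj}) : (forall x, f x = 0 -> x = 0) ->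
  exists d : {dot V for Num.conj}, forall x y, d x y = form (f x) (f y).
Proof.
move=> f_inj; pose d (x y : V) : C := form (f x) (f y).
have d_bilin : bilinear_for *%R (Num.conj \; *%R) d.
  split=> [y a u v|x a u v]; rewrite /d linearP.
    by rewrite linearPl.
  by rewrite linearPr.
have d_herm x y : d x y = (-1) ^+ false * Num.conj (d y x).
  exact: hermitian_subproof.
have d_pos u : u != 0 -> 0 < d u u.
  move=> u0; apply: neq0_dnorm_gt0; apply: contraNneq u0 => /f_inj ->.
  exact: eqxx.
pose m1 := bilinear_isBilinear.Build C V V C *%R (Num.conj \; *%R) d d_bilin.
pose m2 := isHermitianSesquilinear.Build C V false Num.conj d d_herm.
pose m3 := isDotProduct.Build C V d d_pos.
pose D : {dot V for Num.conj} := HB.pack d m1 m2 m3.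
by exists D.
Qed.

Section LambdaSum.
Variables (R : realType) (V : lmodType R[i]) (L : int -> {linear V -> V}).

Definition Lterm (n : int) (v : V) (k : int) : V :=
  if (-2 < k)%R then L (n - k) (L k v) else L k (L (n - k) v).

Lemma Lterm_bound n v : is_field (fun n => L (n - 2)) -> zfin (Lterm n v).
Proof.
move=> /(_ v)[nv Lv]; exists (`|nv| + `|n| + 4)%N => k ltk; rewrite /Lterm.
have Lk j : nv - 2 <= j -> L j v = 0.
  by move=> lej; have := Lv (j + 2) ltac:(lia); rewrite addrK.
by case: ltrP => k2; rewrite Lk ?linear0 //; lia.
Qed.

(** Merging the two sums into one makes the lemmas on [zsum] available. *)
Lemma LambdaE n v : is_field (fun n => L (n - 2)) ->
  Lambda L n v = zsum (Lterm n v) - (3 / 10 * ((n + 2) * (n + 3))%:~R) *: L n v.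
Proof.
move=> Lfield; rewrite /Lambda; congr (_ - _).
have [N fN] := Lterm_bound n v Lfield.
have mE (b : int -> bool) k : (k \in [set k | b k]) = b k by apply: asboolb.
rewrite fsbig_mkcond [X in _ + X]fsbig_mkcond -/(zsum _) -/(zsum _) -zsumD.
- apply: eq_zsum => k; rewrite /patch /Lterm !mE leNgt.
  by case: (-2 < k)%R; rewrite ?addr0 ?add0r.
- by exists N => k /fN; rewrite /patch /Lterm mE; case: (-2 < k)%R.
- by exists N => k /fN; rewrite /patch /Lterm mE leNgt; case: (-2 < k)%R.
Qed.
End LambdaSum.

(** A polynomial in [L 0] with roots at sufficiently many of the higher energies kills a
    given excited vector, but not the lowest weight vector. *)
Section ExcitedVectors.
Variables (R : realType) (V : lmodType R[i]) (L : int -> {linear V -> V}) (h : R[i]).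

Fixpoint kill (N : nat) (u : V) : V :=
  if N is N'.+1 then L 0 (kill N' u) - (h + N%:R) *: kill N' u else u.

Lemma kill_linear N : linear (kill N).
Proof.
elim: N => [//|N IH] a u v /=; rewrite IH linearP scalerDr !scalerBr opprD.
by rewrite !scalerA [_ * a]mulrC addrACA.
Qed.
HB.instance Definition _ N := GRing.isLinear.Build R[i] V V *:%R (kill N) (kill_linear N).

Lemma kill_eig N u e : L 0 u = e *: u ->
  kill N u = (\prod_(j < N) (e - (h + j.+1%:R))) *: u.
Proof.
move=> ue; elim: N => [|N IH] /=; first by rewrite big_ord0 scale1r.
by rewrite IH linearZ /= ue !scalerA -scalerBl big_ord_recr /= mulrBr ![_ * \prod_(_ < _) _]mulrC.
Qed.

Lemma excited_kill u : excited L h u -> exists N, forall M, (N <= M)%N -> kill M u = 0.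
Proof.
elim=> [|a v v' _ [N HN] _ [N' HN']|j v vj].
- by exists 0%N => M _; rewrite linear0.
- exists (maxn N N') => M leM.
  by rewrite kill_linear HN ?HN' ?scaler0 ?addr0 //; lia.
exists j.+1 => M ltj; rewrite (kill_eig M vj) (bigD1 (Ordinal ltj)) //=.
by rewrite subrr mul0r scale0r.
Qed.

Lemma vac_not_excited (Om : V) (a : R[i]) : Om != 0 -> L 0 Om = h *: Om ->
  excited L h (a *: Om) -> a = 0.
Proof.
move=> Om0 LOm /excited_kill[N /(_ N (leqnn _))]; rewrite linearZ /= (kill_eig N LOm) scalerA.
move=> /eqP; rewrite scaler_eq0 (negPf Om0) orbF mulf_eq0 => /orP[/eqP //|].
rewrite prodf_seq_eq0 => /hasP[j _] /=.
by rewrite opprD addrA subrr sub0r oppr_eq0 pnatr_eq0.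
Qed.
End ExcitedVectors.

(** Two representations with the same central charge and lowest weight are compared in
    their direct sum: the cyclic subspace [G] of the pair of lowest weight vectors turns
    out to be the graph of an intertwiner. *)
Section PairRepresentation.
Variables (R : realType) (V F : lmodType R[i]).

Local Notation VF := (V * F)%type.

Definition pair_op (f : {linear V -> V}) (g : {linear F -> F}) (u : VF) : VF :=
  (f u.1, g u.2).
Fact pair_op_linear f g : linear (pair_op f g).
Proof. by move=> a u v; rewrite /pair_op !linearP. Qed.
HB.instance Definition _ f g :=
  GRing.isLinear.Build R[i] VF VF *:%R (pair_op f g) (pair_op_linear f g).

Variables (c h w : R[i]) (L W : int -> {linear V -> V}) (LF WF : int -> {linear F -> F}).
Variables (Om : V) (OmF : F).
Hypotheses (rV : W3_representation c L W) (rF : W3_representation c LF WF)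
  (lV : lowest_weight_vector h w L W Om) (lF : lowest_weight_vector h w LF WF OmF).

Let LP n : {linear VF -> VF} := pair_op (L n) (LF n).
Let WP n : {linear VF -> VF} := pair_op (W n) (WF n).

Lemma pair_eq (u v : VF) : u.1 = v.1 -> u.2 = v.2 -> u = v.
Proof. by case: u v => [? ?] [? ?] /= -> ->. Qed.

Lemma pair_LL m n v : exists a b, LP m (LP n v) = LP n (LP m v) + a *: LP (m + n) v + b *: v.
Proof.
exists (m - n)%:~R, (c / 12 * (m * (m ^+ 2 - 1))%:~R * (m + n == 0)%:R).
by apply: pair_eq => /=; apply/eqP; rewrite -addrA addrC -subr_eq; apply/eqP;
  [apply: (W3_LL rV) | apply: (W3_LL rF)].
Qed.

Lemma pair_LW m n v : LP m (WP n v) = WP n (LP m v) + (2 * m - n)%:~R *: WP (m + n) v.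
Proof.
by apply: pair_eq => /=; apply/eqP; rewrite addrC -subr_eq; apply/eqP;
  [apply: (W3_LW rV) | apply: (W3_LW rF)].
Qed.

Lemma pair_L0L n v : LP 0 (LP n v) = LP n (LP 0 v) - n%:~R *: LP n v.
Proof.
apply: pair_eq => /=; apply/eqP; rewrite addrC -subr_eq; apply/eqP.
  by rewrite (W3_LL rV) sub0r mul0r mulr0 mul0r scale0r addr0 add0r rmorphN scaleNr.
by rewrite (W3_LL rF) sub0r mul0r mulr0 mul0r scale0r addr0 add0r rmorphN scaleNr.
Qed.

Lemma pair_L0W n v : LP 0 (WP n v) = WP n (LP 0 v) - n%:~R *: WP n v.
Proof. by rewrite pair_LW mulr0 sub0r add0r rmorphN scaleNr. Qed.

Lemma lin_closed_sum S n (u : nat -> VF) : lin_closed S -> (forall i, S (u i)) ->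
  S (\sum_(i < n) (u i).1, \sum_(i < n) (u i).2).
Proof.
move=> [S0 SD] Su; elim: n => [|n IH]; first by rewrite !big_ord0.
have := SD 1 _ _ (Su n) IH; rewrite !big_ord_recr scale1r addrC /=.
by case: (u n).
Qed.

Lemma pair_Lambda n v S : lin_closed S -> S (LP n v) -> (forall k l, S (LP k (LP l v))) ->
  S (Lambda L n v.1, Lambda LF n v.2).
Proof.
move=> Scl SL SLL; rewrite !LambdaE; [|exact: W3_fieldL rF | exact: W3_fieldL rV].
have [N fN] := Lterm_bound n v.1 (W3_fieldL rV).
have [M fM] := Lterm_bound n v.2 (W3_fieldL rF).
rewrite (zsumE (zboundW (leq_maxl N M) fN)) (zsumE (zboundW (leq_maxr N M) fM)).
set D := maxn N M; set a := 3 / 10 * _.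
pose u (i : nat) : VF := (Lterm L n v.1 (i%:Z - D%:Z), Lterm LF n v.2 (i%:Z - D%:Z)).
have [S0 SD] := Scl.
have Su i : S (u i).
  by rewrite /u /Lterm; case: ifP => _; apply: SLL.
have := SD (- a) _ _ SL (lin_closed_sum D.*2.+1 Scl Su).
by congr S; apply: pair_eq; rewrite /= scaleNr addrC.
Qed.

Lemma pair_WW m n v S : lin_closed S -> S v -> (forall k, S (LP k v)) ->
  (forall k l, S (LP k (LP l v))) -> S (WP m (WP n v) - WP n (WP m v)).
Proof.
move=> Scl Sv SL SLL; have [S0 SD] := Scl.
have -> : WP m (WP n v) - WP n (WP m v) =
    (c / (3 * 5`!%:R) * ((m ^+ 2 - 4) * (m ^+ 2 - 1) * m)%:~R * (m + n == 0)%:R) *: v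
    + ((16 / (22 + 5 * c) * (m - n)%:~R) *: (Lambda L (m + n) v.1, Lambda LF (m + n) v.2)
    + ((1 / 30 * ((m - n) * (2 * m ^+ 2 - m * n + 2 * n ^+ 2 - 8))%:~R) *: LP (m + n) v + 0)).
  by apply: pair_eq; rewrite /= addr0 addrA; [apply: (W3_WW rV) | apply: (W3_WW rF)].
by apply: (SD) => //; apply: (SD); [apply: pair_Lambda | apply: SD].
Qed.

Lemma pair_lwv : lowest_weight_vector h w LP WP (Om, OmF).
Proof.
split.
- by apply: contraTneq (lwv_neq0 lV) => -[-> _]; rewrite eqxx.
- by move=> n n0; apply: pair_eq; [apply: (lwv_L lV) | apply: (lwv_L lF)].
- by move=> n n0; apply: pair_eq; [apply: (lwv_W lV) | apply: (lwv_W lF)].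
- by apply: pair_eq; [apply: (lwv_L0 lV) | apply: (lwv_L0 lF)].
- by apply: pair_eq; [apply: (lwv_W0 lV) | apply: (lwv_W0 lF)].
Qed.

Let G := generated LP WP (Om, OmF).

Lemma pair_generated_decomp u : G u -> exists a g, u = a *: (Om, OmF) + g /\ excited LP h g.
Proof.
apply: (@generated_decomp _ _ LP WP h w (Om, OmF)).
- exact: pair_LL.
- by move=> m n v; exists (2 * m - n)%:~R; apply: pair_LW.
- exact: pair_WW.
- exact: pair_L0L.
- exact: pair_L0W.
- exact: pair_lwv.
Qed.

Lemma excited_fst g : excited LP h g -> excited L h g.1.
Proof.
elim=> [|a u v _ IHu _ IHv|j u uj]; first exact: excited_0.
  exact: excited_lin.
by apply: (@excited_eig _ _ _ _ j); apply: (congr1 fst uj).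
Qed.
Lemma excited_snd g : excited LP h g -> excited LF h g.2.
Proof.
elim=> [|a u v _ IHu _ IHv|j u uj]; first exact: excited_0.
  exact: excited_lin.
by apply: (@excited_eig _ _ _ _ j); apply: (congr1 snd uj).
Qed.

Hypotheses (V_cyclic : cyclic_vector L W Om) (V_irr : irreducible_representation L W).
Variable form : {dot F for Num.conj}.
Hypothesis form_inv : forall (n : int) x y,
  form (LF (- n) x) y = form x (LF n y) /\ form (WF (- n) x) y = form x (WF n y).
Hypothesis h_real : h^* = h.

(** [L 0] is self-adjoint: its eigenvectors for distinct eigenvalues are orthogonal. *)
Lemma excited_orthogonal y : excited LF h y -> form y OmF = 0.
Proof.
elim=> [|a u v _ IHu _ IHv|j u uj]; first by rewrite linear0l.
  by rewrite linearPl /= IHu IHv mulr0 addr0.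
have [E _] := form_inv 0 u OmF; move: E.
rewrite oppr0 uj (lwv_L0 lF) linearZl linearZr /= h_real => /eqP.
by rewrite -subr_eq0 -mulrBl addrC addKr mulf_eq0 pnatr_eq0 => /eqP.
Qed.

Lemma G_closed : lin_closed G.
Proof. by have /invariant_subspaceP[] := generated_inv LP WP (Om, OmF). Qed.
Lemma G_op n u : G u -> G (LP n u) /\ G (WP n u).
Proof. have /invariant_subspaceP[_] := generated_inv LP WP (Om, OmF); exact. Qed.
Lemma G_sub u v : G u -> G v -> G (u - v).
Proof.
move=> Gu Gv; have [_ GD] := G_closed; have := GD (-1) _ _ Gv Gu.
by rewrite scaleN1r addrC.
Qed.

Lemma form_vac_neq0 : form OmF OmF != 0.
Proof. by rewrite gt_eqF // neq0_dnorm_gt0 // (lwv_neq0 lF). Qed.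

(** These vectors form an invariant subspace, to which [Om] does not belong; irreducibility
    does the rest. *)
Lemma G_ker_fst x : G (x, 0) -> x = 0.
Proof.
pose S : set V := [set x | G (x, 0)].
have S_inv : invariant_subspace L W S.
  have [G0 GD] := G_closed; apply/invariant_subspaceP; split.
    split=> // a u v Su Sv; have := GD a _ _ Su Sv.
    by rewrite /S /=; congr G; apply: pair_eq; rewrite //= scaler0 addr0.
  move=> n v Sv; have [GL GW] := G_op n Sv.
  by split; [move: GL | move: GW]; rewrite /S /=; congr G; apply: pair_eq; rewrite //= linear0.
case: (V_irr.2 _ S_inv) => [S0|ST] Gx; first by have : S x := Gx; rewrite S0.
have : S Om by rewrite ST.
move=> /pair_generated_decomp[a [g [E exg]]].
have a0 : a = 0.
  have : form (0 : F) OmF = a * form OmF OmF.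
    have -> : (0 : F) = a *: OmF + g.2 := congr1 snd E.
    by rewrite linearPl /= (excited_orthogonal (excited_snd exg)) addr0.
  rewrite linear0l => /esym/eqP; rewrite mulf_eq0 (negPf form_vac_neq0) orbF.
  by move=> /eqP.
have := congr1 fst E; rewrite a0 /= scale0r add0r => OmE.
have : 1 = 0 :> R[i].
  apply: (vac_not_excited (lwv_neq0 lV) (lwv_L0 lV)); rewrite scale1r OmE.
  exact: excited_fst.
by move=> /eqP; rewrite oner_eq0.
Qed.

(** These vectors are excited, hence orthogonal to [OmF]; by invariance of the form they
    are then orthogonal to all that is generated from it, and so to themselves. *)
Lemma G_ker_snd y : G (0, y) -> y = 0.
Proof.
have orth z : G (0, z) -> form z OmF = 0.
  move=> /pair_generated_decomp[a [g [E exg]]].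
  have a0 : a = 0.
    apply: oppr_inj; rewrite oppr0.
    apply: (vac_not_excited (lwv_neq0 lV) (lwv_L0 lV)).
    have -> : - a *: Om = g.1; last exact: excited_fst.
    have : 0 = a *: Om + g.1 := congr1 fst E.
    by move=> /esym/eqP; rewrite addrC addr_eq0 scaleNr => /eqP ->.
  have -> : z = g.2 by have := congr1 snd E; rewrite a0 /= scale0r add0r.
  exact: excited_orthogonal (excited_snd exg).
move=> Gy; apply: contrapT => /eqP y0.
suff : form y y = 0.
  by move=> /eqP; rewrite gt_eqF // neq0_dnorm_gt0.
pose S : set VF := [set u | forall z, G (0, z) -> form z u.2 = 0].
suff GS : G `<=` S by exact: (GS _ Gy).
apply: generated_sub; last by move=> z; apply: orth.
apply/invariant_subspaceP; split.
  split=> [z _|a u v Su Sv z Gz]; first by rewrite linear0r.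
  by rewrite linearPr /= (Su z Gz) (Sv z Gz) mulr0 addr0.
move=> n v Sv; split=> z Gz; have [GL GW] := G_op (- n) Gz.
  rewrite -(form_inv n z v.2).1; apply: Sv.
  by move: GL; congr G; apply: pair_eq; rewrite //= linear0.
rewrite -(form_inv n z v.2).2; apply: Sv.
by move: GW; congr G; apply: pair_eq; rewrite //= linear0.
Qed.

Lemma G_total x : exists y, G (x, y).
Proof.
have [G0 GD] := G_closed.
pose S : set V := [set x | exists y, G (x, y)].
suff : S x by [].
have : [set: V] x by [].
rewrite -V_cyclic; apply; split.
  apply/invariant_subspaceP; split.
    split=> [|a u v [y Gy] [z Gz]]; first by exists 0.
    by exists (a *: y + z); have := GD a _ _ Gy Gz.
  move=> n v [y Gy]; have [GL GW] := G_op n Gy.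
  by split; [exists (LF n y) | exists (WF n y)].
by move=> _ ->; exists OmF; apply: generated_vac.
Qed.

Definition emb (x : V) : F := projT1 (cid (G_total x)).
Lemma embP x : G (x, emb x).
Proof. exact: (projT2 (cid (G_total x))). Qed.
Lemma emb_unique x y : G (x, y) -> emb x = y.
Proof.
move=> Gxy; apply/subr0_eq/G_ker_snd.
have := G_sub (embP x) Gxy; congr G.
by apply: pair_eq; rewrite //= subrr.
Qed.
Lemma emb_linear : linear emb.
Proof. by move=> a u v; apply: emb_unique; apply: (G_closed.2 a _ _ (embP u) (embP v)). Qed.
HB.instance Definition _ := GRing.isLinear.Build R[i] V F *:%R emb emb_linear.

Lemma emb_L n x : emb (L n x) = LF n (emb x).
Proof. by apply: emb_unique; have [] := G_op n (embP x). Qed.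
Lemma emb_W n x : emb (W n x) = WF n (emb x).
Proof. by apply: emb_unique; have [] := G_op n (embP x). Qed.

Lemma unitary_pullback : unitary_representation L W.
Proof.
have [|d dE] := @pullback_dot _ V F emb form.
  by move=> x ex; apply: G_ker_fst; rewrite -ex; apply: embP.
exists d => n x y; rewrite !dE /= !emb_L !emb_W.
exact: form_inv.
Qed.
End PairRepresentation.

(** The irreducible representation is isomorphic to the cyclic subspace of [OmF], which
    inherits the invariant form. *)
Theorem unitary_of_lowest_weight (R : realType) (c h w : R[i]) (V F : lmodType R[i])
    (L W : int -> {linear V -> V}) (LF WF : int -> {linear F -> F}) (OmF : F) :
  h^* = h -> lowest_weight_representation c h w L W -> irreducible_representation L W ->
  W3_representation c LF WF -> lowest_weight_vector h w LF WF OmF ->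
  unitary_representation LF WF -> unitary_representation L W.
Proof.
move=> h_real [rV [Om [lV V_cyclic]]] V_irr rF lF [form form_inv].
exact: (unitary_pullback rV rF lV lF V_cyclic V_irr form_inv h_real).
Qed.

(** * The free field representation *)

Section FreeFieldRepresentation.
Variables (R : realType) (p beta b : R[i]).
Hypotheses (beta_real : beta^* = beta) (b_real : b^* = b).
Local Notation F := (fock_space R[i]).
Local Notation fh := (fock_heisenberg p beta).

Definition LFock (n : int) : {linear F -> F} := lend_fun (freeL fh n).
Definition WFock (n : int) : {linear F -> F} := lend_fun ((b / 6) *: freeW fh n).

Lemma LFock_field : is_field (fun n => LFock (n - 2)).
Proof.
move=> v; have [N LN] := freeL_field fh v; exists (N%:Z + 2) => n leNn.
by apply: LN; lia.
Qed.

Lemma Lambda_Fock n v : Lambda LFock n v = lend_fun (freeLambda fh n) v.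
Proof.
rewrite LambdaE; last exact: LFock_field.
rewrite freeLambdaE lendD lendN lendZ opsumE; last exact: freeLambda_term_lfin.
congr (_ - _); apply: eq_zsum => k; rewrite /Lterm /freeLambda_term.
by case: ifP.
Qed.

Lemma Fock_representation c : c = 2 + 24 * beta ^+ 2 -> 4 + 15 * beta ^+ 2 != 0 ->
  b ^+ 2 = 16 / (22 + 5 * c) -> c != - (22 / 5) -> W3_representation c LFock WFock.
Proof.
move=> cE nz bE c_ne; split => //.
- exact: LFock_field.
- move=> v; have [N WN] := freeW_field fh v; exists (N%:Z + 3) => n leNn.
  have -> : WFock (n - 3) v = (b / 6) *: lend_fun (freeW fh (n - 3)) v by [].
  by rewrite WN ?scaler0 //; lia.
- move=> m n v; have := congr1 (fun A => lend_fun A v) (freeL_freeL fh m n).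
  by rewrite commE !lendE cE.
- move=> m n v; have := congr1 (fun A => lend_fun A v) (freeL_freeW fh m n).
  rewrite commE !lendE => E.
  rewrite /LFock /WFock /= linearZ /= -scalerBr E.
  by rewrite !scalerA mulrC.
move=> m n v; have := congr1 (fun A => lend_fun A v) (freeW_freeW fh m n).
rewrite commE WW_rhsE !lendE => E.
have WWE i j : WFock i (WFock j v) =
  (b / 6 * (b / 6)) *: lend_fun (freeW fh i) (lend_fun (freeW fh j) v).
  have lZ (A : lend F) a u : lend_fun A (a *: u) = a *: lend_fun A u by exact: linearZ.
  by rewrite -scalerA -lZ.
rewrite !WWE -scalerBr E Lambda_Fock.
have b2 : b / 6 * (b / 6) = 2 / (4 + 15 * beta ^+ 2) / 36.
  rewrite mulrACA -expr2 bE cE.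
  have nz' : 22 + 5 * (2 + 24 * beta ^+ 2) != 0.
    by rewrite (_ : _ + _ = 8 * (4 + 15 * beta ^+ 2)) ?mulf_neq0 ?pnatr_eq0 //; ring.
  by field; rewrite nz nz'.
rewrite b2 cE /DL /DC /=.
have nz' : 22 + 5 * (2 + 24 * beta ^+ 2) != 0.
  by rewrite (_ : _ + _ = 8 * (4 + 15 * beta ^+ 2)) ?mulf_neq0 ?pnatr_eq0 //; ring.
have -> : 5`! = 120 by [].
lincomb (R[i]); field; rewrite ?nz ?nz' //.
Qed.

Lemma Fock_lowest_weight :
  lowest_weight_vector (p * p^* + beta ^+ 2) (b / 3 * (p ^+ 3 + p^* ^+ 3)) LFock WFock (vacF R[i]).
Proof.
have WFE n v : WFock n v = (b / 6) *: lend_fun (freeW fh n) v by [].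
have Lvac := @freeL_vac _ _ fh; have Wvac := @freeW_vac _ _ fh.
split.
- apply/eqP => /(congr1 (@fock_vev R[i])); rewrite fock_vev_vac linear0.
  by move/eqP; rewrite oner_eq0.
- by move=> n n0; rewrite /LFock /= Lvac ?ltW // gt_eqF // mul0r scale0r.
- by move=> n n0; rewrite WFE Wvac ?ltW // gt_eqF // !mul0r scale0r scaler0.
- by rewrite /LFock /= Lvac // eqxx mul1r.
rewrite WFE Wvac // eqxx mul1r scalerA /=; congr (_ *: _).
by field.
Qed.

Lemma Fock_unitary : unitary_representation LFock WFock.
Proof.
exists (@fock_form R[i] : {dot F for Num.conj}) => n x y.
have aL := adjoint_freeL p beta_real (- n); have aW := adjoint_freeW p beta_real (- n).
rewrite opprK in aL; rewrite opprK in aW.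
split; first exact: aL.
have b6 : (b / 6)^* = b / 6 by rewrite rmorphM fmorphV /= b_real conjC_nat.
by have := adjointZ (b / 6) aW; rewrite b6; apply.
Qed.
End FreeFieldRepresentation.

(** [p] is a cube root of t + i sqrt (r^3 - t^2), a number of modulus r^(3/2). *)
Lemma complex_charge (R : realType) (r t : R) : 0 <= r -> t ^+ 2 <= r ^+ 3 ->
  exists p : R[i], p * p^* = r%:C /\ p ^+ 3 + p^* ^+ 3 = (2 * t)%:C.
Proof.
move=> r0 tr; pose s := Num.sqrt (r ^+ 3 - t ^+ 2).
have s2 : s ^+ 2 = r ^+ 3 - t ^+ 2 by rewrite sqr_sqrtr // subr_ge0.
pose zeta : R[i] := (t +i* s)%C; pose p := 3.-root zeta.
have p3 : p ^+ 3 = zeta by rewrite rootCK.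
have pc3 : p^* ^+ 3 = zeta^* by rewrite -rmorphXn p3.
exists p; split.
  apply/eqP; rewrite -(@eqrXn2 _ 3) //.
  - by rewrite exprMn p3 pc3; apply/eqP; rewrite -rmorphXn /=; simpc; rewrite /zeta;
      congr (_ +i* _)%C; [rewrite -!expr2 s2 addrC subrK | ring].
  - exact: mul_conjC_ge0.
  - by rewrite ler0c.
rewrite p3 pc3 /zeta; simpc; congr (_ +i* _)%C; ring.
Qed.

Theorem theorem3p12 (R : realType) (c h w : R)
    (V : lmodType R[i]) (L W : int -> {linear V -> V}) :
  2 <= c ->
  (c - 2) / 24 <= h ->
  `|w| <= Num.sqrt (8 / (198 + 45 * c)) * (2 * h - (c - 2) / 12) `^ (3 / 2) ->
  lowest_weight_representation c%:C h%:C w%:C L W ->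
  irreducible_representation L W ->
  unitary_representation L W.
Proof.
move=> c_ge2 h_ge w_le lwr irr.
(* [r] has to be the squared modulus of the charge [p], and [B] is the constant b; then
   w = (b / 3) (p^3 + conj(p)^3) prescribes the real part t = 3 w / (2 b) of p^3. *)
pose r := h - (c - 2) / 24; pose B := Num.sqrt (16 / (22 + 5 * c)).
have r_ge0 : 0 <= r by rewrite subr_ge0.
have c_pos : 0 < 22 + 5 * c by lra.
have B_pos : 0 < B by rewrite sqrtr_gt0 divr_gt0.
have B2 : B ^+ 2 = 16 / (22 + 5 * c) by rewrite sqr_sqrtr // divr_ge0 // ltW.
have be2 : Num.sqrt ((c - 2) / 24) ^+ 2 = (c - 2) / 24 :> R.
  by rewrite sqr_sqrtr // divr_ge0 // subr_ge0.
have w2_le : w ^+ 2 <= 8 / (198 + 45 * c) * (2 * r) ^+ 3.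
  have -> : 2 * r = 2 * h - (c - 2) / 12 by rewrite /r; field.
  have base_ge0 : 0 <= 2 * h - (c - 2) / 12 by rewrite /r in r_ge0; lra.
  rewrite -real_normK ?num_real // -(sqr_sqrtr (a := 8 / _)); last first.
    by rewrite divr_ge0 //; lra.
  have <- : ((2 * h - (c - 2) / 12) `^ (3 / 2)) ^+ 2 = (2 * h - (c - 2) / 12) ^+ 3.
    rewrite -powR_mulrn ?powR_ge0 // -powRrM -powR_mulrn //.
    by congr (_ `^ _); field.
  rewrite -exprMn lerXn2r // nnegrE ?normr_ge0 // mulr_ge0 ?sqrtr_ge0 ?powR_ge0 //.
have t2_le : (3 * w / (2 * B)) ^+ 2 <= r ^+ 3.
  have -> : (3 * w / (2 * B)) ^+ 2 = 9 * (22 + 5 * c) / 64 * w ^+ 2.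
    by rewrite !exprMn exprVn exprMn B2; field; rewrite gt_eqF.
  apply: le_trans (ler_wpM2l _ w2_le) _.
    by rewrite divr_ge0 // mulr_ge0 // ltW.
  by rewrite le_eqVlt; apply/orP; left; apply/eqP; field; rewrite gt_eqF //=; lra.
have [p [pp p3]] := complex_charge r_ge0 t2_le.
pose beta := (Num.sqrt ((c - 2) / 24))%:C; pose b := B%:C.
have real_conj (x : R) : Num.conj (x%:C) = x%:C by exact: conjc_real.
have b2 : beta ^+ 2 = ((c - 2) / 24)%:C by rewrite -be2 rmorphXn.
apply: (@unitary_of_lowest_weight R c%:C h%:C w%:C V (fock_space R[i]) L W
  (LFock p beta) (WFock p beta b) (vacF R[i])) => //.
- apply: Fock_representation.
  + by rewrite b2; rewrite -[24]/(24%:R) -[2]/(2%:R) -!(rmorph_nat (real_complex R)) -rmorphM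
    -rmorphD; congr (_%:C); field.
  + rewrite b2 -(rmorph_nat (real_complex R) 15) -(rmorph_nat (real_complex R) 4) -rmorphM -rmorphD.
    by rewrite fmorph_eq0 gt_eqF //; lra.
  + rewrite -(rmorph_nat (real_complex R) 16) -(rmorph_nat (real_complex R) 22)
    -(rmorph_nat (real_complex R) 5).
    by rewrite -rmorphXn B2 -rmorphM -rmorphD -fmorphV -rmorphM.
  + exact: (W3_charge lwr.1).
- have := Fock_lowest_weight p beta b.
  have -> : p * p^* + beta ^+ 2 = h%:C.
    by rewrite pp b2 -rmorphD; congr (_%:C); rewrite /r subrK.
  suff -> : b / 3 * (p ^+ 3 + p^* ^+ 3) = w%:C by [].
  rewrite p3 -(rmorph_nat (real_complex R) 3) -fmorphV -!rmorphM; congr (_%:C).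
  by field; rewrite gt_eqF.
by apply: Fock_unitary; apply: real_conj.
Qed.
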